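(* Let $1\leqslant h<t\leqslant \lfloor (n-1)/3\rfloor$ be integers, so that the set $\mathcal{C}_{h,t}$ of $(h,t)$-uniform comb inequalities for $\mathrm{TSP}_n$ is nonempty. If $\mathcal{H}$ is a set of inequalities valid for $\mathrm{TSP}_n$ such that $\mathcal{H}\cap\mathcal{C}_{h,t}=\emptyset$, then the $\mathcal{H}$-free extension complexity of $\mathrm{TSP}_n$ is at least $2^{\Omega(n/t)}$.
   Context: $\mathrm{TSP}_n$ is the convex hull of the characteristic vectors (in $\mathbb{R}^{E(K_n)}$) of Hamiltonian cycles of $K_n$. For a vertex subset $S$, $\delta(S)$ is the set of edges with exactly one endpoint in $S$. A comb in $K_n$ consists of a handle $H$ and teeth $T_1,\dots,T_k$ (vertex subsets), $k\geqslant 3$ odd, with $H\cap T_i\ne\emptyset$, $T_i\cap T_j=\emptyset$ for $i\ne j$, $H\setminus\bigcup_iT_i\neq\emptyset$; its comb inequality is $x(\delta(H))+\sum_{i=1}^kx(\delta(T_i))\geqslant 3k+1$ (facet-defining for $\mathrm{TSP}_n$, $n\geqslant 6$). A comb is $(h,t)$-uniform if $|T_i|=t$ and $|H\cap T_i|=h$ for all $i$; the corresponding comb inequalities are the $(h,t)$-uniform comb inequalities. The $\mathcal{H}$-free extension complexity of $\mathrm{TSP}_n$ is the extension complexity of the polytope formed by removing the inequalities in $\mathcal{H}$ from the facet-defining inequalities of $\mathrm{TSP}_n$ (i.e. the set of points satisfying all facet-defining inequalities of $\mathrm{TSP}_n$ not in $\mathcal{H}$). The extension complexity of a polytope $P$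 is the minimum number of facets of a polytope projecting onto $P$. *)

(* Defs.v *)
From HB Require Import structures.
From mathcomp Require Import all_boot all_order all_algebra.
From mathcomp Require Import all_classical all_reals all_analysis.

Set Implicit Arguments.
Unset Strict Implicit.
Unset Printing Implicit Defensive.

Import Order.TTheory GRing.Theory Num.Theory.
Local Open Scope classical_set_scope.
Local Open Scope ring_scope.

(** * Polytopes and extension complexity in R^I, for a finite index type I *)

(* [R^o] rather than [R], so that [vec R I] is a [vectType R]. *)
Definition vec (R : realType) (I : finType) := {ffun I -> R^o}.

Definition dot (R : realType) (I : finType) (a x : vec R I) : R :=
  \sum_i a i * x i.

(* The pair (a, b) is the inequality  a.x >= b. *)
Definition ineq (R : realType) (I : finType) := (vec R I * R)%type.

Definition satisfies (R : realType) (I : finType) (c : ineq R I) :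
  set (vec R I) := [set x | c.2 <= dot c.1 x].

Definition valid (R : realType) (I : finType) (P : set (vec R I)) :
  set (ineq R I) := [set c | P `<=` satisfies c].

Definition face (R : realType) (I : finType) (P : set (vec R I))
  (c : ineq R I) : set (vec R I) := P `&` [set x | dot c.1 x = c.2].

Definition conv_hull (R : realType) (I : finType) (A : set (vec R I)) :
  set (vec R I) :=
  [set x | exists (k : nat) (v : 'I_k -> vec R I) (w : 'I_k -> R),
    [/\ forall i, A (v i), forall i, 0 <= w i, \sum_i w i = 1
      & x = \sum_i w i *: v i]].

Definition polytope (R : realType) (I : finType) (P : set (vec R I)) : Prop :=
  exists s : seq (vec R I), P = conv_hull [set` s].

(* The points x0 :: s of A are affinely independent. *)
Definition aff_indep_in (R : realType) (I : finType) (A : set (vec R I))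
  (x0 : vec R I) (s : seq (vec R I)) : Prop :=
  [/\ A x0, [set` s] `<=` A & free [seq y - x0 | y <- s]].

(* The affine hull of A is d-dimensional: A contains d + 1 affinely independent
   points and no more.  No d satisfies this when A is empty. *)
Definition has_dim (R : realType) (I : finType) (A : set (vec R I))
  (d : nat) : Prop :=
  (exists x0 s, aff_indep_in A x0 s /\ size s = d) /\
  (forall x0 s, aff_indep_in A x0 s -> (size s <= d)%N).

Definition facet_defining (R : realType) (I : finType) (P : set (vec R I)) :
  set (ineq R I) :=
  [set c | valid P c /\ exists d, has_dim P d.+1 /\ has_dim (face P c) d].

Definition facets (R : realType) (I : finType) (P : set (vec R I)) :
  set (set (vec R I)) := face P @` facet_defining P.

Definition extension (R : realType) (I J : finType) (P : set (vec R I))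
  (Q : set (vec R J)) : Prop :=
  polytope Q /\ exists f : {linear vec R J -> vec R I}, f @` Q = P.

(* The minimum number of facets of an extension of P; it is +oo when P is not a
   polytope, since then P has no extension. *)
Definition ext_complexity (R : realType) (I : finType) (P : set (vec R I)) :
  \bar R :=
  ereal_inf [set (r%:R)%:E | r in [set r : nat |
    exists (m : nat) (Q : set (vec R 'I_m)),
      extension P Q /\ (facets Q #= `I_r)%card]].

(* The same inequality for P: one is a positive multiple of the other up to
   adding an equation satisfied by P, i.e. the slacks are proportional on P. *)
Definition same_ineq (R : realType) (I : finType) (P : set (vec R I))
  (c d : ineq R I) : Prop :=
  exists2 l : R, 0 < l &
    forall x, P x -> dot c.1 x - c.2 = l * (dot d.1 x - d.2).

(* The set H of inequalities valid for P, read up to [same_ineq].  Without this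
   reading, removing an inequality would be void: a positive multiple of it
   would still define the same facet. *)
Definition ineq_closure (R : realType) (I : finType) (P : set (vec R I))
  (H : set (ineq R I)) : set (ineq R I) :=
  [set c | exists2 d, H d & same_ineq P c d].

(* The equations of the affine hull of P need not be added: if c defines a facet
   and e is such an equation, then c + r e, for every real r, is the same
   inequality, so that any facet kept forces e. *)
Definition remove_ineqs (R : realType) (I : finType) (P : set (vec R I))
  (H : set (ineq R I)) : set (vec R I) :=
  [set x | forall c, facet_defining P c -> ~ ineq_closure P H c ->
    satisfies c x].

Definition free_ext_complexity (R : realType) (I : finType)
  (P : set (vec R I)) (H : set (ineq R I)) : \bar R :=
  ext_complexity (remove_ineqs P H).

(** * The travelling salesman polytope and combs *)

Definition edge (n : nat) := {e : {set 'I_n} | #|e| == 2%N}.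

Definition char_vec (R : realType) (n : nat) (C : {set edge n}) :
  vec R (edge n) := [ffun e => (e \in C)%:R].

(* A cyclic ordering s of all the vertices; for n < 3 its edges do not form a
   cycle. *)
Definition hamiltonian_cycle (n : nat) (C : {set edge n}) : Prop :=
  (3 <= n)%N /\ exists s : seq 'I_n,
    [/\ uniq s, forall v, v \in s
      & C = [set e : edge n | [exists v, val e == [set v; next s v]%SET]]%SET].

Definition TSP (R : realType) (n : nat) : set (vec R (edge n)) :=
  conv_hull [set char_vec R C | C in @hamiltonian_cycle n].
Arguments TSP : clear implicits.

Definition delta (n : nat) (S : {set 'I_n}) : {set edge n} :=
  [set e : edge n | #|val e :&: S| == 1%N]%SET.

Definition is_comb (n k : nat) (H : {set 'I_n}) (T : 'I_k -> {set 'I_n}) :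
  Prop :=
  [/\ (3 <= k)%N /\ odd k,
      forall i, H :&: T i != finset.set0,
      forall i j, i != j -> T i :&: T j == finset.set0
    & H :\: (\bigcup_i T i)%SET != finset.set0].

(* x(delta(H)) + \sum_i x(delta(T_i)) >= 3k + 1 *)
Definition comb_ineq (R : realType) (n k : nat) (H : {set 'I_n})
  (T : 'I_k -> {set 'I_n}) : ineq R (edge n) :=
  (char_vec R (delta H) + \sum_i char_vec R (delta (T i)), (3 * k + 1)%:R).

Definition uniform_comb_ineqs (R : realType) (n h t : nat) :
  set (ineq R (edge n)) :=
  [set c | exists (k : nat) (H : {set 'I_n}) (T : 'I_k -> {set 'I_n}),
    [/\ is_comb H T, forall i, #|T i| = t /\ #|H :&: T i| = h
      & c = comb_ineq R H T]].
Arguments uniform_comb_ineqs : clear implicits.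

(* Main.v *)
Require Import Defs.
From HB Require Import structures.
From mathcomp Require Import all_boot all_order all_algebra all_fingroup.
From mathcomp Require Import all_classical all_reals all_analysis.
From mathcomp Require Import ring lra zify.

Set Implicit Arguments.
Unset Strict Implicit.
Unset Printing Implicit Defensive.

Import Order.TTheory GRing.Theory Num.Theory.
Local Open Scope ring_scope.

(* If a polytope with r facets projects onto a polytope P, then every family of
   inequalities valid on P, evaluated at points of P, gives a slack matrix of
   nonnegative rank at most r. The slack matrix used here comes from combs that
   are facets and hence remain valid when H is removed.

   A comb whose handle has exactly one vertex z outside the teeth, and that leaves
   at least two vertices uncovered, defines a facet: moving segments around in tight
   Hamiltonian cycles shows that the cost of a cycle under any edge weighting which is
   constant on the tight cycles is an affine function of its comb value.

   Given an even vertex set V, cut the n vertices into blocks of t vertices, one for each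
   element of V and two more, and one vertex z. An odd U in V gives an (h,t)-uniform
   comb with teeth the blocks of U and the two extra ones, and a perfect matching M
   of V gives a Hamiltonian cycle which traverses the blocks in pairs; the slack is
   |delta(U) :&: M| - 1. The nonnegative rank of this matrix is exponential
   (Rothvoss): restrict to cuts and matchings that cross in 3 edges (one random line
   of the Fano plane) or in 7 edges (all points). The slacks are 2 and 6. In a
   nonnegative rank-one term, two unskewed lines would give, since lines meet in one
   point, a positive entry where the slack is 0; so at most one unskewed line
   contributes. Skewed lines carry a small part of the mass, up to an exponentially
   small error, so in each term the seven lines together weigh less than 5/3 times
   the 7-crossings, while in the whole matrix this ratio is (7 * 2) / 6 = 7/3. *)

(** * Facets of polytopes *)

Section Facets.
Local Open Scope classical_set_scope.
Local Open Scope ring_scope.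
Context (R : realType) (I : finType).
Notation vec := (vec R I).
Notation ineq := (ineq R I).
Implicit Types (a x y v : vec) (c l g : ineq) (V : seq vec).

(** Removing inequalities keeps only facet-defining ones, so validity of a comb on [TSP] is not
    enough: each comb in the slack matrix has to be proved a facet. The two extra blocks make the
    number of teeth odd and at least three even if U is a single vertex, and they are the two
    neighbours of z on every tour, so that a tour closes through z without breaking a pair of M. In
    the rank bound, for a single placement of the template in V the line terms may be skewed, and
    then nothing bounds them; what cannot happen is that this is typical. The singled-out coordinate
    is hidden among q + 1 equal ones, by blocks of the same shape and a sum over all permutations of
    V, and a function bounded by 1 on a product space has few skewed coordinates unless its total
    mass is exponentially small. Hiding must work for the cut with the matching side unchanged and
    conversely, which is why there are two kinds of blocks. A bound exp(c q) / (constant times q)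
    says nothing for small q; that every extension has two facets is proved separately to absorb
    such constants. *)

Definition slack c x : R := dot c.1 x - c.2.

Lemma dotDl a b x : dot (a + b) x = dot a x + dot b x.
Proof. by rewrite /dot -big_split; apply: eq_bigr => i _; rewrite ffunE mulrDl. Qed.
Lemma dotDr a x y : dot a (x + y) = dot a x + dot a y.
Proof. by rewrite /dot -big_split; apply: eq_bigr => i _; rewrite ffunE mulrDr. Qed.
Lemma dotZl (k : R) a x : dot (k *: a) x = k * dot a x.
Proof. by rewrite /dot mulr_sumr; apply: eq_bigr => i _; rewrite ffunE mulrA. Qed.
Lemma dotZr (k : R) a x : dot a (k *: x) = k * dot a x.
Proof. by rewrite /dot mulr_sumr; apply: eq_bigr => i _; rewrite ffunE mulrCA. Qed.
Lemma dotBr a x y : dot a (x - y) = dot a x - dot a y.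
Proof. by rewrite -scaleN1r dotDr dotZr mulN1r. Qed.
Lemma dot_sumr (J : Type) (s : seq J) (P : pred J) (F : J -> vec) a :
  dot a (\sum_(j <- s | P j) F j) = \sum_(j <- s | P j) dot a (F j).
Proof.
elim/big_ind2 : _ => [|? ? ? ? <- <-|//]; last by rewrite dotDr.
by rewrite -(scale0r 0) dotZr mul0r.
Qed.

Definition delta_vec (e : I) : vec := [ffun i => (i == e)%:R].

Lemma dot_delta_vec e x : dot (delta_vec e) x = x e.
Proof.
rewrite /dot (bigD1 e)//= ffunE eqxx mul1r big1 ?addr0// => i /negbTE ie.
by rewrite ffunE ie mul0r.
Qed.

Definition comb_ineqs c (s : R) g : ineq := (c.1 + s *: g.1, c.2 + s * g.2).

Lemma slack_comb c s g x : slack (comb_ineqs c s g) x = slack c x + s * slack g x.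
Proof. by rewrite /slack /= dotDl dotZl; ring. Qed.

Lemma linear_dot (F : vec -> R) : (forall x y, F (x + y) = F x + F y) ->
  (forall (k : R) x, F (k *: x) = k * F x) -> exists a, forall x, F x = dot a x.
Proof.
move=> FD FZ; exists [ffun e => F (delta_vec e)] => x.
have {1}-> : x = \sum_e x e *: delta_vec e.
  apply/ffunP => i; rewrite sum_ffunE (bigD1 i)//= big1 ?addr0 => [|e ei].
    by rewrite !ffunE eqxx [RHS]mulr1.
  by rewrite !ffunE eq_sym (negbTE ei) [LHS]mulr0.
rewrite (big_morph F FD (_ : F 0 = 0)); last by rewrite -(scale0r 0) FZ mul0r.
by apply: eq_bigr => e _; rewrite FZ ffunE mulrC.
Qed.

(** The functional is a nonzero coordinate of [v - projv W v], the component off [W]; it vanishes on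
    [W] because the projection fixes [W]. *)
Lemma separate_vspace (W : {vspace vec}) v : v \notin W ->
  exists a, (forall u, u \in W -> dot a u = 0) /\ dot a v != 0.
Proof.
move=> vW; have [e ve] : exists e, (v - projv W v) e != 0.
  apply/existsP; apply: contraR vW => /existsPn h.
  suff /eqP : v - projv W v = 0 by rewrite subr_eq0 => /eqP ->; exact: memv_proj.
  by apply/ffunP => e; rewrite [RHS]ffunE; apply/eqP; rewrite -[_ == _]negbK h.
have [|k x|a aE] := @linear_dot (fun u => (u - projv W u) e).
- by move=> x y; rewrite linearD !ffunE /=; ring.
- by rewrite linearZ !ffunE /=; rewrite -mulrBr.
exists a; split=> [u uW|]; last by rewrite -aE.
by rewrite -aE projv_id// subrr ffunE.
Qed.

Lemma span_free_subseq (X : seq vec) :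
  exists s, [/\ {subset s <= X}, free s & span s = span X].
Proof.
elim: X => [|x X [s [sX fs sE]]]; first by exists [::]; split=> //; exact: nil_free.
have [xs|xs] := boolP (x \in span s).
  exists s; split=> //; first by move=> u /sX; rewrite inE orbC => ->.
  by rewrite span_cons sE; apply/esym/addv_idPr; rewrite -sE -memvE.
exists (x :: s); split; last by rewrite !span_cons sE.
  by move=> u; rewrite !inE => /orP[->//|/sX ->]; rewrite orbT.
by rewrite free_cons xs.
Qed.

Lemma has_dim_span (A : set vec) x0 (s : seq vec) : A x0 -> [set` s] `<=` A ->
  (forall x, A x -> x - x0 \in span [seq y - x0 | y <- s]) ->
  has_dim A (\dim (span [seq y - x0 | y <- s])).
Proof.
move=> Ax0 sA spanA; set W := span _; split.
  have [t [ts ft tE]] := span_free_subseq [seq y - x0 | y <- s].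
  have tK : [seq y - x0 | y <- [seq u + x0 | u <- t]] = t.
    by rewrite -map_comp -[RHS]map_id; apply: eq_map => u /=; rewrite addrK.
  exists x0, [seq u + x0 | u <- t]; split; last first.
    by rewrite size_map /W -tE; apply/esym/eqP.
  split=> //; last by rewrite tK.
  by move=> _ /= /mapP[u /ts /mapP[y ys ->] ->]; rewrite subrK; exact: sA.
move=> x1 t [Ax1 tA /eqP tf]; rewrite -(size_map (fun y => y - x1) t) -tf.
apply: dimvS; apply/span_subvP => _ /mapP[y yt ->].
have -> : y - x1 = (y - x0) - (x1 - x0) by rewrite opprB addrA subrK.
by apply: memvB; apply: spanA => //; exact: tA.
Qed.

(** Weights are regrouped by vertex, so that one weight function on [undup V] serves all
    inequalities; slacks are affine and average with the same weights. *)
Lemma conv_hull_slack V x : conv_hull [set` V] x -> exists w : vec -> R,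
  [/\ forall v, 0 <= w v, \sum_(v <- undup V) w v = 1,
      x = \sum_(v <- undup V) w v *: v
    & forall c, slack c x = \sum_(v <- undup V) w v * slack c v].
Proof.
move=> [k [v [w [vV w0 w1 xE]]]].
pose W u := \sum_(i | v i == u) w i.
have one i : [seq u <- undup V | v i == u] = [:: v i].
  rewrite (eq_filter (a2 := pred1 (v i))); last by move=> u; exact: eq_sym.
  by apply: filter_pred1_uniq; rewrite ?undup_uniq// mem_undup; exact: vV.
have part (F : vec -> vec) : \sum_i w i *: F (v i) = \sum_(u <- undup V) W u *: F u.
  rewrite (eq_bigr (fun i => \sum_(u <- undup V | v i == u) w i *: F u)).
    rewrite (exchange_big_dep predT)//=; apply: eq_bigr => u _.
    by rewrite scaler_suml.
  move=> i _; rewrite -big_filter.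
  by rewrite one big_seq1.
have W1 : \sum_(u <- undup V) W u = 1.
  rewrite -w1 (exchange_big_dep predT)//=; apply: eq_bigr => i _.
  by rewrite -big_filter one big_seq1.
have xE' : x = \sum_(u <- undup V) W u *: u by rewrite xE (part id).
exists W; split=> //; first by move=> u; apply: sumr_ge0.
move=> c; rewrite /slack {1}xE' dot_sumr -[X in _ - X]mul1r -W1 mulr_suml -sumrB.
by apply: eq_bigr => u _; rewrite dotZr mulrBr.
Qed.

Lemma affine_comb_sub (s : seq vec) (w : vec -> R) x0 : \sum_(v <- s) w v = 1 ->
  \sum_(v <- s) w v *: v - x0 = \sum_(v <- s) w v *: (v - x0).
Proof.
move=> w1; rewrite -[X in _ - X]scale1r -w1 scaler_suml -sumrB.
by apply: eq_bigr => v _; rewrite scalerBr.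
Qed.

Lemma conv_hull_sub (A : set vec) : A `<=` conv_hull A.
Proof.
move=> x Ax; exists 1%N, (fun=> x), (fun=> 1); split=> //; first by rewrite big_ord1.
by rewrite big_ord1 scale1r.
Qed.

Definition valid_on V c : Prop := forall v, v \in V -> 0 <= slack c v.

Lemma valid_conv_hull V c x : valid_on V c -> conv_hull [set` V] x -> 0 <= slack c x.
Proof.
move=> cV /conv_hull_slack[w [w0 _ _ ->]]; rewrite big_seq; apply: sumr_ge0 => v.
by rewrite mem_undup => vV; rewrite mulr_ge0// cV.
Qed.

(* A dimension-free form of being a facet: on [V], the affine functions vanishing at
   the tight points are the multiples of the slack. *)
Definition facet_on V c : Prop :=
  [/\ valid_on V c, exists2 x, x \in V & slack c x = 0,
      exists2 y, y \in V & 0 < slack c y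
    & forall g, (forall v, v \in V -> slack c v = 0 -> slack g v = 0) ->
        exists k, forall v, v \in V -> slack g v = k * slack c v].

(** The last clause of [facet_on] says in effect that the differences of tight points, together with
    the one direction [y - x0], span all differences; so the face has codimension one. *)
Lemma facet_on_facet_defining V c : facet_on V c ->
  facet_defining (conv_hull [set` V]) c.
Proof.
case=> cV [x0 x0V cx0] [y yV cy] cg; set P := conv_hull _.
split; first by move=> x /(valid_conv_hull cV); rewrite /slack subr_ge0.
pose T := [seq v <- V | slack c v == 0].
pose W0 := span [seq v - x0 | v <- T].
have dotc v : slack c v = dot c.1 (v - x0) by rewrite dotBr; move: cx0; rewrite /slack; lra.
have W0c u : u \in W0 -> dot c.1 u = 0.
  have [u0|] := eqVneq (dot c.1 u) 0; first by [].
  move/eqP => nz uW; exfalso; apply: nz.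
  have := @coord_span _ _ _ (in_tuple [seq v - x0 | v <- T]) u uW => ->.
  rewrite dot_sumr big1// => i _; rewrite dotZr.
  have : (in_tuple [seq v - x0 | v <- T])`_i \in [seq v - x0 | v <- T] by apply: mem_nth.
  by case/mapP => v; rewrite mem_filter => /andP[/eqP cv _] ->; rewrite -dotc cv mulr0.
pose W := span [seq v - x0 | v <- V].
have WE : W = (W0 + <[y - x0]>)%VS.
  apply/eqP; rewrite eqEsubv; apply/andP; split.
    apply/span_subvP => _ /mapP[v vV ->]; apply: contraT => vW.
    have [a [aW av]] := separate_vspace vW.
    (* This affine function vanishes at the tight points and at the loose point [y], so it can only
       be the zero multiple of the slack, yet it is nonzero at [v]. *)
    pose g : ineq := (a, dot a x0).
    have gE u : slack g u = dot a (u - x0) by rewrite /slack dotBr.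
    have [|k kE] := cg g.
      move=> u uV /eqP cu; rewrite gE aW//; apply: (subvP (addvSl _ _)).
      by apply/memv_span/map_f; rewrite mem_filter cu.
    have := kE y yV; rewrite gE aW; last by rewrite (subvP (addvSr _ _))// memv_line.
    move/esym/eqP; rewrite mulf_eq0 (gt_eqF cy) orbF => /eqP k0.
    by move: av; rewrite -gE kE// k0 mul0r eqxx.
  apply/subvP => u /memv_addP[u0 u0W [u1 /vlineP[k ->] ->]].
  apply: memvD; last by apply/memvZ/memv_span/map_f.
  apply: subvP u0W; apply: sub_span => _ /mapP[v vT ->].
  by apply: map_f; move: vT; rewrite mem_filter => /andP[].
have yW0 : y - x0 \notin W0.
  by apply/negP => /W0c; rewrite -dotc => cy0; rewrite cy0 ltxx in cy.
exists (\dim W0); split.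
  have -> : (\dim W0).+1 = \dim W.
    rewrite WE dimv_disjoint_sum ?dim_vline; last first.
      apply/eqP; rewrite -subv0; apply/subvP => u /memv_capP[uW /vlineP[k uE]].
      have := W0c _ uW; rewrite uE dotZr -dotc => /eqP.
      by rewrite mulf_eq0 (gt_eqF cy) orbF => /eqP ->; rewrite scale0r memv0.
    have -> : y - x0 != 0 by apply: contraNneq yW0 => ->; exact: mem0v.
    by rewrite addn1.
  apply: has_dim_span; [exact: conv_hull_sub|by move=> v vV; exact: conv_hull_sub|].
  move=> x /conv_hull_slack[w [_ w1 -> _]].
  rewrite (affine_comb_sub _ w1) big_seq; apply: memv_suml => v.
  by rewrite mem_undup => vV; apply/memvZ/memv_span/map_f.
apply: has_dim_span.
- by split; [exact: conv_hull_sub|move/eqP: cx0; rewrite subr_eq0 => /eqP].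
- move=> v /=; rewrite mem_filter subr_eq0 => /andP[/eqP cv vV].
  by split => //; exact: conv_hull_sub.
move=> x [/conv_hull_slack[w [w0 w1 -> wc]] cx].
have : \sum_(v <- undup V) w v * slack c v = 0.
  by rewrite -wc; apply/eqP; rewrite subr_eq0; apply/eqP.
move/eqP; rewrite big_seq psumr_eq0 => [/allP allz|v]; last first.
  by rewrite mem_undup => vV; rewrite mulr_ge0// cV.
rewrite (affine_comb_sub _ w1) big_seq; apply: memv_suml => v vV.
have := allz v vV; rewrite vV implyTb mulf_eq0 => /orP[/eqP ->|cv].
  by rewrite scale0r mem0v.
by apply/memvZ/memv_span/map_f; rewrite mem_filter cv -mem_undup.
Qed.

End Facets.

(** * Valid inequalities as nonnegative combinations of facets *)

Lemma seq_min_witness (R : realType) (T : eqType) (s : seq T) (P : pred T) (F : T -> R) :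
  (exists2 x, x \in s & P x) ->
  exists x, [/\ x \in s, P x & forall y, y \in s -> P y -> F x <= F y].
Proof.
elim: s => [|a s IH] [x]; first by rewrite in_nil.
rewrite inE => xs Px; have [|nos] := boolP (has P s).
  move/hasP => [z zs Pz]; have [|u [us Pu umin]] := IH; first by exists z.
  have [Pa|nPa] := boolP (P a); last first.
    exists u; split; rewrite ?inE ?us ?orbT// => y; rewrite inE => /orP[/eqP ->|ys] Py.
      by rewrite Py in nPa.
    exact: umin.
  have [au|ua] := leP (F a) (F u).
    exists a; split; rewrite ?inE ?eqxx// => y; rewrite inE => /orP[/eqP ->//|ys] Py.
    exact: le_trans au (umin _ ys Py).
  exists u; split; rewrite ?inE ?us ?orbT// => y; rewrite inE => /orP[/eqP ->|ys] Py.
    exact: ltW.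
  exact: umin.
have xa : x = a.
  by case/orP: xs => [/eqP//|xs]; move/hasPn: nos => /(_ _ xs); rewrite Px.
subst x; exists a; split; rewrite ?inE ?eqxx// => y; rewrite inE => /orP[/eqP ->//|ys] Py.
by move/hasPn: nos => /(_ _ ys); rewrite Py.
Qed.

Section Decomposition.
Local Open Scope classical_set_scope.
Local Open Scope ring_scope.
Context (R : realType) (I : finType).
Notation vec := (vec R I).
Notation ineq := (ineq R I).
Implicit Types (a x y v : vec) (c l g : ineq) (V : seq vec).

Lemma dot0l v : dot 0 v = 0.
Proof. by rewrite -(scale0r 0) dotZl mul0r. Qed.

(** The induction measure of [facet_decomposition]. *)
Definition loose V c : nat := count (fun v => slack c v != 0) V.

Lemma loose_lt V c d y : (forall v, v \in V -> slack c v = 0 -> slack d v = 0) ->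
  y \in V -> slack c y != 0 -> slack d y = 0 -> (loose V d < loose V c)%N.
Proof.
move=> cd yV cy dy; rewrite /loose.
have sub : {in V, subpred (fun v => slack d v != 0) (fun v => slack c v != 0)}.
  by move=> v vV /=; apply: contra_neq; exact: cd.
elim: V yV sub {cd} => [//|v V IH]; rewrite inE => /orP[/eqP <-|yV] sub /=.
  rewrite dy eqxx cy add0n add1n ltnS.
  rewrite -!size_filter.
  have -> : [seq x <- V | slack d x != 0] = [seq x <- [seq x <- V | slack c x != 0] | slack d x != 0].
    rewrite -filter_predI; apply: eq_in_filter => x xV /=.
    case: (boolP (slack d x != 0)) => //= dx; apply/esym/sub => //.
    by rewrite inE xV orbT.
  by rewrite size_filter count_size.
have {}IH := IH yV (fun u uV => sub u (mem_behead (s := v :: V) uV)).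
have := sub v (mem_head _ _).
by case: (slack d v != 0) => /= [->//|_]; rewrite ?add1n ?add0n ?ltnS// ltn_addl.
Qed.

(* Push [l] in the direction [g] until a new point of [V] becomes tight. *)
Lemma push V l g y : valid_on V l ->
  (forall v, v \in V -> slack l v = 0 -> slack g v = 0) ->
  y \in V -> slack g y < 0 ->
  exists2 s, 0 < s & valid_on V (comb_ineqs l s g) /\
    (loose V (comb_ineqs l s g) < loose V l)%N.
Proof.
move=> lV lg yV gy.
have l0 v : v \in V -> slack g v < 0 -> 0 < slack l v.
  move=> vV gv; rewrite lt_def lV// andbT; apply: contraTneq gv => /(lg _ vV) ->.
  by rewrite ltxx.
(* Ratio test: the point with the least ratio is the first to become tight. *)
have [|u [uV gu umin]] := @seq_min_witness R _ V (fun v => slack g v < 0)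
  (fun v => slack l v / - slack g v); first by exists y.
exists (slack l u / - slack g u); first by rewrite divr_gt0 ?oppr_gt0// l0.
split.
  move=> v vV; rewrite slack_comb; have [gv|gv] := ltP (slack g v) 0.
    have := umin v vV gv; rewrite ler_pdivlMr ?oppr_gt0// => h.
    by rewrite -subr_ge0 in h; apply: le_trans h _; rewrite mulrN opprK.
  by rewrite addr_ge0 ?lV// mulr_ge0// divr_ge0 ?lV// oppr_ge0 ltW.
apply: (@loose_lt _ _ _ u) => //.
- by move=> v vV lv; rewrite slack_comb lv (lg v)// mulr0 addr0.
- by rewrite gt_eqF// l0.
by rewrite slack_comb; field; rewrite lt_eqF.
Qed.

(** Testing with the constant 1 makes [slack l] constant on [V], and testing with coordinates then
    makes [V] a single point. This settles the case of an [l] that is tight nowhere. *)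
Lemma not_all_proportional V l x y : x \in V -> y \in V -> x != y ->
  ~ (forall g, exists k, forall v, v \in V -> slack g v = k * slack l v).
Proof.
move=> xV yV /eqP xy h; apply: xy; apply/ffunP => e.
have [k1 k1E] := h (0, -1); have [k kE] := h (delta_vec R e, 0).
have E v : v \in V -> 1 = k1 * slack l v.
  move=> vV; rewrite -k1E// /slack /=.
  rewrite dot0l.
  by rewrite sub0r opprK.
have ve v : v \in V -> v e = k * slack l v.
  by move=> vV; rewrite -kE// /slack /= dot_delta_vec subr0.
have k10 : k1 != 0.
  by apply/eqP => k10; have := E x xV; rewrite k10 mul0r => /eqP; rewrite oner_eq0.
rewrite !ve//; congr (_ * _); apply: (mulfI k10); rewrite -!E//.
Qed.

(** A Farkas lemma, by induction on the number of loose points: an [l] that is not a facet is a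
    positive combination of two valid inequalities with fewer loose points. Two distinct points are
    assumed because a single point has no facet, while the constant 1 is valid on it. *)
Lemma facet_decomposition V (r : nat) (Phi : 'I_r -> ineq) x0 y0 :
  x0 \in V -> y0 \in V -> x0 != y0 ->
  (forall c, facet_on V c -> exists j k, 0 <= k /\
     forall v, v \in V -> slack c v = k * slack (Phi j) v) ->
  forall l, valid_on V l -> exists w : 'I_r -> R, (forall j, 0 <= w j) /\
    forall v, v \in V -> slack l v = \sum_j w j * slack (Phi j) v.
Proof.
move=> x0V y0V xy0 rep l; have [n] := ubnP (loose V l).
elim: n l => // n IH l ln lV.
have [/hasP[y yV ly]|/hasPn none] := boolP (has (fun v => slack l v != 0) V); last first.
  exists (fun=> 0); split=> // v /none /negPn /eqP ->.
  by rewrite big1// => j _; rewrite mul0r.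
have ly0 : 0 < slack l y by rewrite lt_def ly lV.
have [lF|nF] := pselect (facet_on V l).
  have [j [k [k0 kE]]] := rep _ lF.
  exists (fun i => if i == j then k else 0); split; first by move=> i; case: ifP.
  move=> v vV; rewrite (bigD1 j)//= eqxx big1 ?addr0 ?kE// => i /negbTE ->.
  by rewrite mul0r.
have [g [lg gn]] : exists g, (forall v, v \in V -> slack l v = 0 -> slack g v = 0) /\
    ~ exists k, forall v, v \in V -> slack g v = k * slack l v.
  apply: contrapT => no; have [tight|ntight] := pselect (exists2 x, x \in V & slack l x = 0).
    apply: nF; split=> //; first by exists y.
    by move=> g lg; apply: contrapT => gn; apply: no; exists g.
  apply: (not_all_proportional (l := l) x0V y0V xy0) => g.
  apply: contrapT => gn; apply: no; exists g; split=> // v vV lv.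
  by exfalso; apply: ntight; exists v.
(* Correcting [g] by a multiple of [l] makes it vanish also at [y], where [l] is loose. If [h] or
   [- h] turns out to be valid, it then has fewer loose points than [l]. *)
pose m := slack g y / slack l y; pose h := comb_ineqs g (- m) l.
have hE v : slack h v = slack g v - m * slack l v by rewrite slack_comb mulNr.
have lh v : v \in V -> slack l v = 0 -> slack h v = 0.
  by move=> vV lv; rewrite hE lv lg// mulr0 subr0.
have hy : slack h y = 0 by rewrite hE /m divfK// subrr.
have [z zV hz] : exists2 z, z \in V & slack h z != 0.
  apply: contrapT => no; apply: gn; exists m => v vV; apply/eqP; rewrite -subr_eq0 -hE.
  by apply: contrapT => hv; apply: no; exists v => //; apply/negP.
have key h' : (forall v, v \in V -> slack l v = 0 -> slack h' v = 0) ->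
    slack h' y = 0 -> (exists2 z, z \in V & slack h' z < 0) ->
    exists w : 'I_r -> R, (forall j, 0 <= w j) /\
      forall v, v \in V -> slack l v = \sum_j w j * slack (Phi j) v.
  move=> {h hE lh hy z zV hz} lh hy [z zV hz].
  have [s s0 [v1 lt1]] := push lV lh zV hz.
  have [w1 [w10 w1E]] := IH _ (leq_trans lt1 ln) v1.
  pose h1 := comb_ineqs (0, 0) (-1) h'.
  have h1E v : slack h1 v = - slack h' v.
    rewrite slack_comb /slack /=; rewrite dot0l.
    ring.
  have lh1 v : v \in V -> slack l v = 0 -> slack h1 v = 0.
    by move=> vV lv; rewrite h1E lh// oppr0.
  have [/hasP[z' z'V hz']|/hasPn hneg] := boolP (has (fun v => slack h1 v < 0) V).
    have [s' s'0 [v2 lt2]] := push lV lh1 z'V hz'.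
    have [w2 [w20 w2E]] := IH _ (leq_trans lt2 ln) v2.
    (* [l] lies between its two pushes, [l + s h'] and [l - s' h']. *)
    exists (fun j => s' / (s + s') * w1 j + s / (s + s') * w2 j); split.
      by move=> j; rewrite addr_ge0// mulr_ge0// divr_ge0// ?addr_ge0// ltW.
    move=> v vV; under eq_bigr do rewrite mulrDl -!mulrA.
    rewrite big_split/= -!mulr_sumr -w1E// -w2E// (slack_comb l s) (slack_comb l s') h1E.
    by field; rewrite gt_eqF// addr_gt0.
  have v2 : valid_on V h1 by move=> v /hneg; rewrite -leNgt.
  have lt2 : (loose V h1 < loose V l)%N.
    by apply: (@loose_lt _ _ _ y) => //; rewrite h1E hy oppr0.
  have [w2 [w20 w2E]] := IH _ (leq_trans lt2 ln) v2.
  (* Here [- h'] is itself valid, and [l] is the push [l + s h'] plus [s] times [- h']. *)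
  exists (fun j => w1 j + s * w2 j); split.
    by move=> j; rewrite addr_ge0// mulr_ge0// ltW.
  move=> v vV; under eq_bigr do rewrite mulrDl -mulrA.
  rewrite big_split/= -mulr_sumr -w1E// -w2E// slack_comb h1E.
  by ring.
have [hz0|hz0] := ltP (slack h z) 0; first by apply: (key h) => //; exists z.
pose h1 := comb_ineqs (0, 0) (-1) h.
have h1E v : slack h1 v = - slack h v.
  rewrite slack_comb /slack /=; rewrite dot0l.
  ring.
apply: (key h1).
- by move=> v vV lv; rewrite h1E lh// oppr0.
- by rewrite h1E hy oppr0.
by exists z => //; rewrite h1E oppr_lt0 lt_def hz.
Qed.

Lemma facet_on_same_face V c d : facet_on V c -> facet_on V d ->
  face (conv_hull [set` V]) c = face (conv_hull [set` V]) d ->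
  exists k, 0 <= k /\ forall v, v \in V -> slack c v = k * slack d v.
Proof.
move=> [cV _ _ _] [dV _ [y yV dy] dg] cd.
have [|k kE] := dg c.
  move=> v vV dv; have : face (conv_hull [set` V]) d v.
    by split; [exact: conv_hull_sub|move/eqP: dv; rewrite subr_eq0 => /eqP].
  by rewrite -cd => -[_ cv]; apply/eqP; rewrite subr_eq0; apply/eqP.
exists k; split=> //; have := cV y yV; rewrite kE//.
by rewrite pmulr_lge0.
Qed.

(** One representative per face suffices, since facets with the same face have proportional slacks.
    An index that no [facet_on] inequality reaches gets the trivial inequality. *)
Lemma facet_basis V (r : nat) : (facets (conv_hull [set` V]) #= `I_r)%card ->
  exists Phi : 'I_r -> ineq, (forall j, valid_on V (Phi j)) /\
  forall c, facet_on V c -> exists j k, 0 <= k /\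
     forall v, v \in V -> slack c v = k * slack (Phi j) v.
Proof.
move=> /card_set_bijP [f [fI finj _]]; set Q := conv_hull _ in fI finj *.
have wit (j : 'I_r) : exists c, valid_on V c /\
    ((exists2 d, facet_on V d & f (face Q d) = j) -> facet_on V c /\ f (face Q c) = j).
  have [[d dF fd]|no] := pselect (exists2 d, facet_on V d & f (face Q d) = j).
    by exists d; split=> //; case: dF.
  exists (0, 0); split=> // v vV.
  by rewrite /slack /= dot0l subr0.
have [Phi PhiP] := choice wit; exists Phi; split; first by move=> j; case: (PhiP j).
move=> c cF; have cQ : facets Q (face Q c).
  by exists c => //; exact: facet_on_facet_defining.
have fr : (f (face Q c) < r)%N by have := fI _ cQ.
exists (Ordinal fr); have [_] := PhiP (Ordinal fr).
case; first by exists c.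
move=> PF fP; apply: (facet_on_same_face cF PF).
apply: finj; last by move: fP; rewrite /Q => ->.
  by rewrite inE.
by rewrite inE; exists (Phi (Ordinal fr)) => //; exact: facet_on_facet_defining.
Qed.

End Decomposition.

Section Polytope.
Local Open Scope classical_set_scope.
Local Open Scope ring_scope.
Context (R : realType) (J : finType).
Notation vec := (vec R J).
Notation ineq := (ineq R J).

Lemma facet_factorization (V : seq vec) (r : nat) x0 y0 :
  x0 \in V -> y0 \in V -> x0 != y0 ->
  (facets (conv_hull [set` V]) #= `I_r)%card ->
  exists Phi : 'I_r -> ineq,
    (forall j x, conv_hull [set` V] x -> 0 <= slack (Phi j) x) /\
    forall l : ineq, valid_on V l -> exists w : 'I_r -> R, (forall j, 0 <= w j) /\
      forall x, conv_hull [set` V] x -> slack l x = \sum_j w j * slack (Phi j) x.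
Proof.
move=> x0V y0V xy fr; have [Phi [PhiV rep]] := facet_basis fr.
exists Phi; split; first by move=> j x; exact: valid_conv_hull.
move=> l lV; have [w [w0 wE]] := facet_decomposition x0V y0V xy rep lV.
exists w; split=> // x /conv_hull_slack[u [_ _ _ uE]].
rewrite uE; under [RHS]eq_bigr do rewrite uE mulr_sumr.
rewrite [RHS]exchange_big/= big_seq [RHS]big_seq; apply: eq_bigr => v.
rewrite mem_undup => vV; rewrite wE// mulr_sumr; apply: eq_bigr => j _.
by rewrite mulrCA.
Qed.

(** Take a coordinate that varies on [V]. With one facet, [x e - min] and [max - x e] would be
    multiples of the same slack; at a minimizer the second is positive, so that slack is nonzero
    there, and the first would have multiplier 0. *)
Lemma two_facets (V : seq vec) (r : nat) x0 y0 :
  x0 \in V -> y0 \in V -> x0 != y0 ->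
  (facets (conv_hull [set` V]) #= `I_r)%card -> (2 <= r)%N.
Proof.
move=> x0V y0V xy fr; have [Phi [Phi0 dec]] := facet_factorization x0V y0V xy fr.
have VQ v : v \in V -> conv_hull [set` V] v by move=> vV; exact: conv_hull_sub.
have [e xye] : exists e, x0 e != y0 e.
  apply/existsP; apply: contraNT xy => /existsPn h.
  by apply/eqP/ffunP => e; apply/eqP/negPn.
have [|m [mV _ mmin]] := @seq_min_witness R _ V xpredT (fun v => v e); first by exists x0.
have [|M [MV _ Mmax]] := @seq_min_witness R _ V xpredT (fun v => - v e); first by exists x0.
have mM : m e < M e.
  rewrite lt_neqAle mmin// andbT; apply: contraNneq xye => mM.
  have E v : v \in V -> v e = m e.
    move=> vV; apply/eqP; rewrite eq_le mmin// andbT mM -lerN2; exact: Mmax.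
  by rewrite !E.
have [|w [w0 wE]] := dec (delta_vec R e, m e).
  by move=> v vV; rewrite /slack /= dot_delta_vec subr_ge0 mmin.
have [|w' [w'0 w'E]] := dec (- delta_vec R e, - M e).
  move=> v vV; rewrite /slack /= -scaleN1r dotZl dot_delta_vec mulN1r subr_ge0; exact: Mmax.
have Em := wE _ (VQ _ mV); have EM := wE _ (VQ _ MV); have Em' := w'E _ (VQ _ mV).
have dotN v : dot (- delta_vec R e) v = - v e.
  by rewrite -scaleN1r dotZl dot_delta_vec mulN1r.
rewrite [LHS]/slack /= dot_delta_vec in Em; rewrite [LHS]/slack /= dot_delta_vec in EM.
rewrite [LHS]/slack /= dotN in Em'.
case: r => [|[|//]] in fr Phi Phi0 dec w w0 wE w' w'0 w'E Em EM Em' *.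
  by rewrite big_ord0 in EM; move: mM; rewrite (_ : M e = m e) ?ltxx//; lra.
rewrite !big_ord1 in Em EM Em'.
have p0 : slack (Phi ord0) m != 0.
  by apply/eqP => p0; move: Em'; rewrite p0 mulr0; lra.
have /eqP : w ord0 * slack (Phi ord0) m = 0 by rewrite -[LHS]Em subrr.
rewrite mulf_eq0 (negbTE p0) orbF => /eqP w00.
by move: EM; rewrite w00 mul0r; lra.
Qed.

End Polytope.

(** * Slack matrices factor through extensions *)

Section Extensions.
Local Open Scope classical_set_scope.
Local Open Scope ring_scope.

Lemma dot_pullback (R : realType) (I J : finType) (f : {linear vec R J -> vec R I})
    (a : vec R I) : exists b, forall y, dot a (f y) = dot b y.
Proof.
apply: linear_dot => [x y|k x]; first by rewrite linearD dotDr.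
by rewrite linearZ dotZr.
Qed.

(** The easy half of Yannakakis' theorem: pull the inequalities back along [f], expand them in facet
    slacks of [Q], and evaluate these at preimages of the points. *)
Lemma extension_factorization (R : realType) (I J : finType) (P : set (vec R I))
    (Q : set (vec R J)) (r : nat) x y :
  extension P Q -> (facets Q #= `I_r)%card -> P x -> P y -> x <> y ->
  (2 <= r)%N /\
  forall (A B : Type) (c : A -> ineq R I) (z : B -> vec R I),
    (forall i, P `<=` satisfies (c i)) -> (forall j, P (z j)) ->
    exists (a : 'I_r -> A -> R) (b : 'I_r -> B -> R),
      [/\ forall k i, 0 <= a k i, forall k j, 0 <= b k j &
          forall i j, slack (c i) (z j) = \sum_k a k i * b k j].
Proof.
move=> [[V QE] [f fQ]] fr Px Py xy; rewrite QE in fQ fr.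
have lift z : P z -> exists u, conv_hull [set` V] u /\ f u = z.
  by rewrite -fQ => -[u Qu fu]; exists u.
have [x0 [y0 [x0V y0V xy0]]] : exists x0 y0, [/\ x0 \in V, y0 \in V & x0 != y0].
  have [u [Qu fu]] := lift x Px; have [v [Qv fv]] := lift y Py.
  apply: contrapT => no; apply: xy; rewrite -fu -fv; congr (f _).
  case: Qu => k [p [w [pV w0 w1 ->]]]; case: Qv => k' [p' [w' [pV' w0' w1' ->]]].
  have same v1 v2 : v1 \in V -> v2 \in V -> v1 = v2.
    by move=> v1V v2V; apply/eqP; apply: contrapT => /negP n; apply: no; exists v1, v2.
  case: k => [|k] in p w pV w0 w1 *.
    by move: w1; rewrite big_ord0 => /eqP; rewrite eq_sym oner_eq0.
  rewrite (eq_bigr (fun i => w i *: p ord0)); last by move=> i _; rewrite (same (p i) (p ord0) (pV i) (pV ord0)).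
  rewrite [RHS](eq_bigr (fun i => w' i *: p ord0)); last first.
    by move=> i _; rewrite (same (p' i) (p ord0) (pV' i) (pV ord0)).
  by rewrite -!scaler_suml w1 w1'.
split; first exact: two_facets x0V y0V xy0 fr.
move=> A B c z cP zP.
have [Phi [Phi0 dec]] := facet_factorization x0V y0V xy0 fr.
have liftz j : exists u, conv_hull [set` V] u /\ f u = z j by exact: lift.
have [u uP] := choice liftz.
have wit i : exists w : 'I_r -> R, (forall k, 0 <= w k) /\
    forall v, conv_hull [set` V] v -> slack (c i) (f v) = \sum_k w k * slack (Phi k) v.
  have [b bE] := dot_pullback f (c i).1.
  have [|w [w0 wE]] := dec (b, (c i).2).
    move=> v vV; rewrite /slack /= -bE subr_ge0; apply: cP.
    by rewrite -fQ; exists v => //; exact: conv_hull_sub.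
  by exists w; split=> // v Qv; rewrite -wE// /slack /= bE.
have [w wP] := choice wit.
exists (fun k i => w i k), (fun k j => slack (Phi k) (u j)); split.
- by move=> k i; case: (wP i).
- by move=> k j; case: (uP j) => Qu _; exact: Phi0.
by move=> i j; case: (uP j) => Qu <-; case: (wP i) => _ ->.
Qed.

End Extensions.

(** * Path costs and comb regions *)

Section Paths.
Context (R : realType) (T : eqType).
Implicit Types (w : T -> T -> R) (x y z : T) (s : seq T).

Fixpoint pcost w x s : R := if s is y :: s' then w x y + pcost w y s' else 0.

Lemma pcost_cat w x s1 s2 : pcost w x (s1 ++ s2) = pcost w x s1 + pcost w (last x s1) s2.
Proof. by elim: s1 x => [|y s1 IH] x /=; rewrite ?add0r// IH addrA. Qed.

Lemma pcost_rcons w x s y : pcost w x (rcons s y) = pcost w x s + w (last x s) y.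
Proof. by rewrite -cats1 pcost_cat /= addr0. Qed.

Lemma pcost_rev w x s : (forall u v, w u v = w v u) ->
  pcost w (last x s) (rev (belast x s)) = pcost w x s.
Proof.
move=> wC; elim: s x => [//|y s IH] x /=.
by rewrite rev_cons pcost_rcons IH addrC; congr (_ + _); rewrite wC; case: (s) => //= a l;
  rewrite rev_cons last_rcons.
Qed.

Definition cycost w z s : R := pcost w z (rcons s z).

(* Subtracting the potential [w z] changes all tour costs by the same constant. *)
Definition normal w z u v : R := w u v - w z u - w z v.

Lemma pcost_normal w z x s : pcost w x s =
  pcost (normal w z) x s + 2 * (\sum_(v <- x :: s) w z v) - w z x - w z (last x s).
Proof.
elim: s x => [|y s IH] x /=; first by rewrite big_seq1; ring.
by rewrite IH !big_cons /normal; ring.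
Qed.

(** The edges at [z] become free, so a tour turns into a path with free ends, and rearranging its
    segments never has to take [z] into account. *)
Lemma cycost_normal w z x s : (forall u v, w u v = w v u) ->
  cycost w z (x :: s) = pcost (normal w z) x s + 2 * (\sum_(v <- x :: s) w z v).
Proof.
move=> wC; rewrite /cycost /= pcost_rcons (pcost_normal w z) (wC (last x s)); ring.
Qed.

(* Segments: nonempty paths, given by their first vertex and the others. *)
Definition segment : Type := (T * seq T)%type.
Implicit Types (S : segment) (L : seq segment).

Definition seg_seq S : seq T := S.1 :: S.2.
Definition seg_head S : T := S.1.
Definition seg_last S : T := last S.1 S.2.
Definition seg_rev S : segment := (last S.1 S.2, rev (belast S.1 S.2)).
Definition seg_cat S S' : segment := (S.1, S.2 ++ seg_seq S').
Definition seg_cost w S : R := pcost w S.1 S.2.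
Definition segs_seq L : seq T := flatten (map seg_seq L).

Fixpoint segs_cost w L : R := if L is a :: L' then
  seg_cost w a + (if L' is b :: _ then w (seg_last a) (seg_head b) + segs_cost w L' else 0) else 0.

Lemma seg_seq_rev S : seg_seq (seg_rev S) = rev (seg_seq S).
Proof. by case: S => x s; rewrite /seg_seq /= [in RHS]lastI rev_rcons. Qed.
Lemma seg_head_rev S : seg_head (seg_rev S) = seg_last S. Proof. by []. Qed.
Lemma seg_last_rev S : seg_last (seg_rev S) = seg_head S.
Proof. by case: S => x [|y s]//=; rewrite /seg_last /= rev_cons last_rcons. Qed.
Lemma seg_cost_rev w S : (forall u v, w u v = w v u) -> seg_cost w (seg_rev S) = seg_cost w S.
Proof. by move=> wC; exact: pcost_rev. Qed.

Lemma seg_seq_cat S S' : seg_seq (seg_cat S S') = seg_seq S ++ seg_seq S'. Proof. by []. Qed.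
Lemma seg_head_cat S S' : seg_head (seg_cat S S') = seg_head S. Proof. by []. Qed.
Lemma seg_last_cat S S' : seg_last (seg_cat S S') = seg_last S'.
Proof. by rewrite /seg_last /= last_cat. Qed.
Lemma seg_cost_cat w S S' :
  seg_cost w (seg_cat S S') = seg_cost w S + (w (seg_last S) (seg_head S') + seg_cost w S').
Proof. by rewrite /seg_cost /= pcost_cat. Qed.

Lemma last_segs_seq x L S : last x (segs_seq (L ++ [:: S])) = seg_last S.
Proof. by rewrite /segs_seq map_cat flatten_cat last_cat /= cats0. Qed.

Lemma segs_cost_seq w S L : exists s, segs_seq (S :: L) = seg_head S :: s /\
  pcost w (seg_head S) s = segs_cost w (S :: L).
Proof.
elim: L S => [|S' L IH] S.
  by exists S.2; split; [exact: cats0 | rewrite /= addr0].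
have [s [fs ps]] := IH S'; exists (S.2 ++ seg_head S' :: s); split.
  by rewrite -[segs_seq _]/(seg_seq S ++ segs_seq (S' :: L)) fs.
by rewrite pcost_cat /= -[X in _ = _ + (_ + X)]/(segs_cost w (S' :: L)) -ps.
Qed.

Lemma count_segs_seq0 (P : pred T) : count P (segs_seq [::]) = 0%N.
Proof. by []. Qed.

Lemma count_segs_seq (P : pred T) S L : count P (segs_seq (S :: L)) = (count P (seg_seq S) + count P (segs_seq L))%N.
Proof. by rewrite -[segs_seq _]/(seg_seq S ++ segs_seq L) count_cat. Qed.

Lemma segs_cost1 w S : segs_cost w [:: S] = seg_cost w S.
Proof. by rewrite /= addr0. Qed.

Lemma segs_cost_cons w S S' L :
  segs_cost w [:: S, S' & L] = seg_cost w S + (w (seg_last S) (seg_head S') + segs_cost w (S' :: L)).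
Proof. by []. Qed.

Lemma normalC w z u v : (forall u v, w u v = w v u) -> normal w z u v = normal w z v u.
Proof. by move=> wC; rewrite /normal (wC u); ring. Qed.

End Paths.

(** * Regions of a comb *)

Section Regions.
Context (I : finType).
Notation region := (bool * option I)%type.

(* Whether a vertex lies in the handle, and the tooth containing it. *)
Definition rA (i : I) : region := (true, Some i).
Definition rD (i : I) : region := (false, Some i).
Definition rO : region := (false, None).
Definition rZ : region := (true, None).

(* The coefficient of the comb inequality on an edge between two regions. *)
Definition comb_coef (a b : region) : nat :=
  ((a.1 != b.1) + (if a.2 == b.2 then 0 else (a.2 != None) + (b.2 != None)))%N.

Lemma comb_coefC a b : comb_coef a b = comb_coef b a.
Proof. by rewrite /comb_coef eq_sym [a.2 == _]eq_sym [in RHS]addnC [in RHS]addnC; case: ifP => // _; rewrite [((a.2 != _) + _)%N]addnC. Qed.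

Lemma comb_coefxx a : comb_coef a a = 0%N.
Proof. by rewrite /comb_coef !eqxx. Qed.

Context (T : finType) (z : T) (hd : T -> bool) (th : T -> option I).
Definition reg (v : T) : region := (hd v, th v).
Definition reglist (a : region) : seq T := [seq v <- enum T | reg v == a].

(** Filler for the teeth not under study, two at a time: enter and leave off the handle, and pass
    from one tooth to the other inside it. Hence an even number of teeth must remain after three are
    set aside. *)
Fixpoint fillT (g : seq I) : seq T := if g is a :: b :: g' then
  reglist (rD a) ++ reglist (rA a) ++ reglist (rA b) ++ reglist (rD b) ++ fillT g' else [::].

Definition offz : seq T := [seq v <- enum T | v != z].

Hypothesis zP : forall v, (reg v == rZ) = (v == z).

Lemma seq_ind2 (P : seq I -> Prop) : P [::] -> (forall a, P [:: a]) ->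
  (forall a b s, P s -> P (a :: b :: s)) -> forall s, P s.
Proof.
move=> P0 P1 P2 s; suff : P s /\ forall a, P (a :: s) by case.
by elim: s => [|b s [IH1 IH2]]; split=> // a; apply: P2.
Qed.

Lemma count_fillT (P : pred T) g : ~~ odd (size g) ->
  count P (fillT g) = (\sum_(a <- g) (count P (reglist (rD a)) + count P (reglist (rA a))))%N.
Proof.
elim/seq_ind2: g => [|a|a b g IH] //= og; first by rewrite big_nil.
rewrite !count_cat IH; last by move: og; rewrite negbK.
by rewrite !big_cons; lia.
Qed.

Lemma count_reglist (P : pred T) a : count P (reglist a) = (\sum_(v | reg v == a) P v)%N.
Proof.
rewrite count_filter -sum1_count big_enum_cond/= [LHS]big_mkcond [RHS]big_mkcond/=.
by apply: eq_bigr => v _; rewrite /=; case: (P v); case: (_ == a).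
Qed.

Lemma count_offz (P : pred T) i j l g : perm_eq (i :: j :: l :: g) (enum I) ->
  ~~ odd (size g) ->
  count P offz = (count P (reglist rO) + count P (fillT g) +
    (count P (reglist (rD i)) + count P (reglist (rA i))) +
    (count P (reglist (rD j)) + count P (reglist (rA j))) +
    (count P (reglist (rD l)) + count P (reglist (rA l))))%N.
Proof.
move=> pI og; rewrite count_fillT//.
have -> : count P offz = (\sum_(v | v != z) P v)%N.
  rewrite count_filter -sum1_count big_enum_cond/= [LHS]big_mkcond [RHS]big_mkcond/=.
  by apply: eq_bigr => v _; rewrite /=; case: (P v); case: (_ == z).
have E : (\sum_(v | th v != None) P v = \sum_(a <- i :: j :: l :: g)
    (count P (reglist (rD a)) + count P (reglist (rA a))))%N.
  rewrite (perm_big _ pI)/= big_enum/=.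
  rewrite (partition_big (fun v => odflt i (th v)) xpredT)//=; apply: eq_bigr => a _.
  rewrite !count_reglist (bigID hd)/= addnC; congr (_ + _)%N; apply: eq_bigl => v;
    rewrite /reg xpair_eqE; case: (th v) => [b|]; case: (hd v) => //=; rewrite ?andbT ?andbF //; exact/esym/inj_eq/Some_inj.
rewrite (bigID (fun v => th v != None))/=.
have -> : (\sum_(v | (v != z) && (th v != None)) P v = \sum_(v | th v != None) P v)%N.
  apply: eq_bigl => v; rewrite -zP /reg xpair_eqE.
  by case: (hd v); case: (th v).
have -> : (\sum_(v | (v != z) && ~~ (th v != None)) P v = count P (reglist rO))%N.
  rewrite count_reglist; apply: eq_bigl => v; rewrite -zP /reg !xpair_eqE negbK.
  by case: (hd v); case: (th v).
by rewrite E !big_cons; set x := (\sum_(a <- g) _)%N; lia.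
Qed.

End Regions.

(** * Rigidity of edge weights that are constant on tight tours *)

Section CombFacet.
Context (R : realType) (I T : finType) (z : T) (hd : T -> bool) (th : T -> option I).
Notation region := (bool * option I)%type.
Notation reg := (reg hd th).
Notation reglist := (reglist hd th).
Notation fillT := (fillT hd th).
Notation offz := (offz z).
Notation segment := (segment T).
Notation rO := (rO I).
Notation rZ := (rZ I).
Implicit Types (a b : region) (S : segment) (L : seq segment) (u v : T) (i j l : I).

Definition ccost u v : R := (comb_coef (reg u) (reg v))%:R.
Notation cn := (normal ccost z).

Hypothesis zP : forall v, (reg v == rZ) = (v == z).
Hypothesis Ane : forall i, exists v, reg v = rA i.
Hypothesis Dne : forall i, exists v, reg v = rD i.

(** Off [rZ] only three values occur: 0 from a handle region to any region outside its tooth, -4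
    within one tooth off the handle, and -2 otherwise. *)
Definition ncoef a b : R :=
  (comb_coef a b)%:R - (comb_coef rZ a)%:R - (comb_coef rZ b)%:R.

Lemma ccostC u v : ccost u v = ccost v u.
Proof. by rewrite /ccost comb_coefC. Qed.

Lemma cnE u v : cn u v = ncoef (reg u) (reg v).
Proof. by rewrite /normal /ncoef /ccost; have /eqP -> : reg z == rZ by rewrite zP. Qed.

Lemma ncoefC a b : ncoef a b = ncoef b a.
Proof. by rewrite /ncoef comb_coefC; ring. Qed.

Lemma ncoef_DA i : ncoef (rD i) (rA i) = - 2.
Proof. by rewrite /ncoef /comb_coef /= eqxx; ring. Qed.

Lemma ncoef_AA i : ncoef (rA i) (rA i) = - 2.
Proof. by rewrite /ncoef /comb_coef /= eqxx; ring. Qed.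

Lemma ncoef_DD i : ncoef (rD i) (rD i) = - 4.
Proof. by rewrite /ncoef /comb_coef /= eqxx; ring. Qed.

Lemma ncoef_A i b : b != rZ -> b.2 != Some i -> ncoef (rA i) b = 0.
Proof.
case: b => [[] [j|]]; rewrite ?eqxx// => _; rewrite /ncoef /comb_coef /=.
- by rewrite eq_sym => /negbTE ->; ring.
- by rewrite eq_sym => /negbTE ->; ring.
- by move=> _; ring.
Qed.

Lemma ncoef_W a b : ~~ a.1 -> ~~ b.1 -> (a.2 != b.2) || (a.2 == None) -> ncoef a b = - 2.
Proof.
case: a => [[] [i|]]//; case: b => [[] [j|]]//= _ _; rewrite /ncoef /comb_coef /= ?orbF.
- by move=> /negbTE ->; ring.
- by move=> _; ring.
- by move=> _; ring.
- by move=> _; ring.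
Qed.

Lemma regE v a : v \in reglist a -> reg v = a.
Proof. by rewrite mem_filter => /andP[/eqP]. Qed.

(** This is [perm_eq] stated by counts, so that rearrangements of segments become identities between
    naturals that [ring] closes. *)
Definition covers S a := forall P, count P (seg_seq S) = count P (reglist a).

Lemma covers_reg S a v : covers S a -> v \in seg_seq S -> reg v = a.
Proof.
move=> Sa vS; apply: regE; rewrite -has_pred1 has_count -Sa -has_count has_pred1.
exact: vS.
Qed.

Lemma covers_head S a : covers S a -> reg (seg_head S) = a.
Proof. by move=> Sa; apply: (covers_reg Sa); rewrite mem_head. Qed.

Lemma covers_last S a : covers S a -> reg (seg_last S) = a.
Proof. by move=> Sa; apply: (covers_reg Sa); exact: mem_last. Qed.

Lemma covers_rev S a : covers S a -> covers (seg_rev S) a.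
Proof. by move=> Sa P; rewrite seg_seq_rev count_rev. Qed.

Lemma exists_head u a : reg u = a -> exists2 S, covers S a & seg_head S = u.
Proof.
move=> ua; exists (u, rem u (reglist a)) => // P.
apply/esym; move: P; apply/seq.permP/perm_to_rem.
by rewrite mem_filter ua eqxx mem_enum.
Qed.

Lemma exists_last u a : reg u = a -> exists2 S, covers S a & seg_last S = u.
Proof.
move=> /exists_head[S Sa Su]; exists (seg_rev S); first exact: covers_rev.
by rewrite seg_last_rev.
Qed.

Lemma pcost_hom x s a : reg x = a -> all (fun v => reg v == a) s -> pcost ccost x s = 0.
Proof.
elim: s x => [//|y s IH] x xa /= /andP[/eqP ya sa].
by rewrite (IH y)// /ccost xa ya comb_coefxx addr0.
Qed.

Lemma seg_cost_hom S a : covers S a -> seg_cost ccost S = 0.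
Proof.
move=> Sa; apply: (@pcost_hom _ _ a); first exact: (covers_head Sa).
by apply/allP => v vS; apply/eqP/(covers_reg Sa); rewrite inE vS orbT.
Qed.

Lemma pcost_reglist x a : (exists v, reg v = a) -> exists2 y, reg y = a &
  forall s, pcost ccost x (reglist a ++ s) = (comb_coef (reg x) a)%:R + pcost ccost y s /\
            last x (reglist a ++ s) = last y s.
Proof.
move=> [v va]; have : v \in reglist a by rewrite mem_filter va eqxx mem_enum.
have : all (fun v => reg v == a) (reglist a) by apply/allP => u /regE ->.
case: (reglist a) => [//|y r] /= /andP[/eqP ya ra] _.
exists (last y r).
  by have := mem_last y r; rewrite inE => /orP[/eqP ->//|/(allP ra)/eqP].
by move=> s; rewrite pcost_cat (pcost_hom ya ra) add0r last_cat /ccost ya.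
Qed.

Notation rank v := (th v != None : nat).

(** The exit from the last tooth is paid by the edge that follows; the [rank] terms carry this debt,
    so the pairs telescope to 3 per tooth. *)
Lemma pcost_fillT g x : ~~ odd (size g) -> uniq g -> ~~ hd x ->
  (forall i, i \in g -> th x != Some i) ->
  [/\ pcost ccost x (fillT g) + (rank (last x (fillT g)))%:R =
        (3 * size g + rank x)%:R,
      ~~ hd (last x (fillT g)) &
      forall i, i \notin g -> th x != Some i -> th (last x (fillT g)) != Some i].
Proof.
elim/seq_ind2: g x => [|a|a b g IH] x //=; first by move=> _ _ hx _; rewrite add0r muln0 add0n.
rewrite negbK inE negb_or => og /and3P[/andP[ab ag] bg ug] hx tx.
have xa : (th x == Some a) = false by apply/negbTE/tx; rewrite mem_head.
have [y1 r1 e1] := pcost_reglist x (Dne a).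
have [y2 r2 e2] := pcost_reglist y1 (Ane a).
have [y3 r3 e3] := pcost_reglist y2 (Ane b).
have [y4 r4 e4] := pcost_reglist y3 (Dne b).
have [|i ig|e5 h5 t5] := IH y4 og ug.
- by case: r4 => -> _.
- by case: r4 => _ ->; rewrite (inj_eq Some_inj); apply: contraNneq bg => ->.
rewrite (e1 _).1 (e2 _).1 (e3 _).1 (e4 _).1 (e1 _).2 (e2 _).2 (e3 _).2 (e4 _).2.
split=> //; last first.
  move=> i; rewrite !inE !negb_or => /and3P[ia ib ig] tix; apply: t5 => //.
  by case: r4 => _ ->; rewrite (inj_eq Some_inj) eq_sym.
rewrite r1 r2 r3 /comb_coef /= !eqxx !(inj_eq Some_inj) (negbTE ab) (negbTE hx) xa /=.
have -> : pcost ccost y4 (fillT g) = (3 * size g + rank y4)%:R - (rank (last y4 (fillT g)))%:R.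
  by rewrite -e5 addrK.
case: r4 => _ ->; rewrite /= !mulnS !natrD; ring.
Qed.

Context (w : T -> T -> R).
Hypothesis wC : forall u v, w u v = w v u.
Notation wn := (normal w z).
Notation K := ((3 * #|I| + 1)%:R : R).
Hypothesis tight_const : forall s s', perm_eq s offz -> perm_eq s' offz ->
  cycost ccost z s = K -> cycost ccost z s' = K -> cycost w z s = cycost w z s'.

Definition good L := [/\ (0 < size L)%N, forall P, count P (segs_seq L) = count P offz &
  segs_cost cn L + 2 * (\sum_(v <- offz) ccost z v) = K].

Lemma segs_cost_cycost (f : T -> T -> R) L : (forall u v, f u v = f v u) -> (0 < size L)%N ->
  (forall P, count P (segs_seq L) = count P offz) ->
  cycost f z (segs_seq L) = segs_cost (normal f z) L + 2 * (\sum_(v <- offz) f z v).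
Proof.
move=> fC; case: L => // S L _ SL; have [s [fs ps]] := segs_cost_seq (normal f z) S L.
rewrite fs cycost_normal// ps -fs (perm_big offz)//.
exact/seq.permP.
Qed.

(** The engine of the facet proof: a rearrangement with the same comb cost stays tight, so it also
    preserves the cost under [w]. This is a linear relation between the few edges exchanged. *)
Lemma good_move L L' : good L -> (0 < size L')%N ->
  (forall P, count P (segs_seq L') = count P (segs_seq L)) -> segs_cost cn L' = segs_cost cn L ->
  good L' /\ segs_cost wn L' = segs_cost wn L.
Proof.
move=> [L0 cL kL] L0' LL cLL.
have cL' P : count P (segs_seq L') = count P offz by rewrite LL.
have kL' : segs_cost cn L' + 2 * (\sum_(v <- offz) ccost z v) = K by rewrite cLL.
split; first by split.
have := @tight_const (segs_seq L') (segs_seq L).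
rewrite !(segs_cost_cycost ccostC)// !(segs_cost_cycost wC)// => h.
by apply: (addIr (2 * (\sum_(v <- offz) w z v))); apply: h => //; apply/seq.permP.
Qed.

(** Each tooth costs 3: pairs are joined inside the handle, and the odd tooth [l] leads through the
    handle back to [z]. The remaining unit of 3k + 1 is paid by leaving the handle from [z] to
    [Di]. *)
Lemma base_good i j l g o Os Di Ai Aj Dj Dl Al :
  perm_eq (i :: j :: l :: g) (enum I) -> ~~ odd (size g) ->
  covers (o, Os) rO ->
  covers Di (rD i) -> covers Ai (rA i) -> covers Aj (rA j) -> covers Dj (rD j) ->
  covers Dl (rD l) -> covers Al (rA l) ->
  good [:: Di; Ai; Aj; Dj; (o, Os ++ fillT g); Dl; Al].
Proof.
move=> pI og cO cDi cAi cAj cDj cDl cAl; set L := [:: _; _; _; _; _; _; _].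
have uI : uniq (i :: j :: l :: g) by rewrite (perm_uniq pI) enum_uniq.
have cL P : count P (segs_seq L) = count P offz.
  have -> : segs_seq L = seg_seq Di ++ seg_seq Ai ++ seg_seq Aj ++ seg_seq Dj ++ (seg_seq (o, Os) ++ fillT g) ++ seg_seq Dl ++ seg_seq Al.
    by rewrite /segs_seq /= cats0.
  rewrite (count_offz zP P pI og) !count_cat.
  rewrite !cDi !cAi !cAj !cDj !cDl !cAl cO. ring.
split=> //; rewrite -(segs_cost_cycost ccostC)//.
have [s [fs ps]] := segs_cost_seq ccost Di (behead L).
rewrite /L fs /cycost pcost_rcons /=.
have -> : last (seg_head Di) s = seg_last Al.
  have : last z (segs_seq L) = seg_last Al.
    exact: (last_segs_seq z [:: Di; Ai; Aj; Dj; (o, Os ++ fillT g); Dl] Al).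
  by rewrite /L fs.
rewrite ps /= !addr0 (seg_cost_hom cDi) (seg_cost_hom cAi) (seg_cost_hom cAj) (seg_cost_hom cDj) (seg_cost_hom cDl) (seg_cost_hom cAl).
set x := last o Os.
have [rx1 rx2] : ~~ hd x /\ th x = None.
  have : reg x = rO by exact: (covers_last cO).
  by rewrite /reg => -[-> ->].
have [|||y1 y2 y3] := @pcost_fillT g x og.
- by move: uI => /= /and4P[].
- by [].
- by move=> a _; rewrite rx2.
have -> : seg_cost ccost (o, Os ++ fillT g) = pcost ccost x (fillT g).
  by rewrite [LHS]pcost_cat [X in X + _](seg_cost_hom cO) add0r.
have -> : seg_last (o, Os ++ fillT g) = last x (fillT g) by rewrite /seg_last /= last_cat.
have ll : th (last x (fillT g)) != Some l.
  by apply: y3; [move: uI => /= /and4P[_ _ ->]|rewrite rx2].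
rewrite /ccost (covers_head cDi) (covers_last cDi) (covers_head cAi) (covers_last cAi) (covers_head cAj)
 (covers_last cAj) (covers_head cDj) (covers_last cDj) (covers_head cDl) (covers_last cDl) (covers_head cAl) (covers_last cAl).
have -> : reg (seg_head (o, Os ++ fillT g)) = rO by exact: (covers_head cO).
have /eqP -> : reg z == rZ by rewrite zP.
have -> : #|I| = (size g).+3 by rewrite cardE -(perm_size pI).
have ij : (i == j) = false.
  by move: uI; rewrite /= !inE negb_or => /and4P[/andP[/negbTE]].
move: y1; rewrite rx2 /= addn0 => y1.
have -> : pcost ccost x (fillT g) = (3 * size g)%:R - (rank (last x (fillT g)))%:R.
  by rewrite -y1 addrK.
rewrite /comb_coef /= !eqxx !(inj_eq Some_inj) ij (negbTE ll) (negbTE y2) /=.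
rewrite !natrD !mulnS !natrD; ring.
Qed.

Section Triple.
Context (i j l : I) (g : seq I) (o : T) (Os : seq T) (Di Ai Aj Dj Dl Al : segment).
Hypothesis pI : perm_eq (i :: j :: l :: g) (enum I).
Hypothesis og : ~~ odd (size g).
Hypothesis cO : covers (o, Os) rO.
Hypothesis cDi : covers Di (rD i).
Hypothesis cAi : covers Ai (rA i).
Hypothesis cAj : covers Aj (rA j).
Hypothesis cDj : covers Dj (rD j).
Hypothesis cDl : covers Dl (rD l).
Hypothesis cAl : covers Al (rA l).
Let OG : segment := (o, Os ++ fillT g).

Let cnC u v : cn u v = cn v u. Proof. apply: normalC; exact: ccostC. Qed.
Let wnC u v : wn u v = wn v u. Proof. apply: normalC; exact: wC. Qed.

Lemma triple_neq : [/\ i != j, i != l & j != l].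
Proof.
have : uniq (i :: j :: l :: g) by rewrite (perm_uniq pI) enum_uniq.
by rewrite /= !inE !negb_or => /and4P[/and3P[-> -> _] /andP[-> _] _ _].
Qed.

Lemma region_last_OG : [/\ ~~ hd (seg_last OG), th (seg_last OG) != Some i, th (seg_last OG) != Some j
  & th (seg_last OG) != Some l].
Proof.
have uI : uniq (i :: j :: l :: g) by rewrite (perm_uniq pI) enum_uniq.
set x := last o Os; have : reg x = rO by exact: (covers_last cO).
rewrite /reg => -[hx tx].
have [|||_ y2 y3] := @pcost_fillT g x og.
- by move: uI => /= /and4P[].
- by rewrite hx.
- by move=> a _; rewrite tx.
have -> : seg_last OG = last x (fillT g) by rewrite /seg_last /= last_cat.
by split=> //; apply: y3; rewrite ?tx//;
  move: uI; rewrite /= !inE !negb_or => /and4P[/and3P[? ? ?] /andP[? ?] ? ?].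
Qed.

Lemma region_last_OG_coef : exists2 y, reg (seg_last OG) = y &
  [/\ ncoef y (rD i) = - 2, ncoef y (rD j) = - 2 & ncoef y (rD l) = - 2].
Proof.
exists (reg (seg_last OG)) => //; have [h ti tj tl] := region_last_OG.
by split; apply: ncoef_W => //; apply/orP; left.
Qed.

Let regs := (covers_head cDi, covers_last cDi, covers_head cAi, covers_last cAi, covers_head cAj,
  covers_last cAj, covers_head cDj, covers_last cDj, covers_head cDl, covers_last cDl, covers_head cAl,
  covers_last cAl).

Let B0 := base_good pI og cO cDi cAi cAj cDj cDl cAl.

Lemma zero_facts : [/\ ncoef (rA i) (rA j) = 0, ncoef (rA l) (rD i) = 0,
  ncoef (rA l) rO = 0, ncoef (rA i) (rA l) = 0 & ncoef (rA l) (rA j) = 0].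
Proof.
have [ij il jl] := triple_neq.
by split; apply: ncoef_A; rewrite //= (inj_eq Some_inj) // eq_sym.
Qed.

(** As in the relations that follow, the edges removed and the edges added have equal comb cost, so
    their costs under [w] agree. Here the path is cut between Ai and Aj and closed between Al and
    Di. *)
Lemma handle_exit_tooth : wn (seg_last Ai) (seg_head Aj) = wn (seg_last Al) (seg_head Di).
Proof.
have [f1 f2 _ _ _] := zero_facts.
have [||_] := @good_move _ [:: Aj; Dj; OG; Dl; Al; Di; Ai] B0 isT.
- by move=> P; rewrite !(count_segs_seq, count_segs_seq0); ring.
- by rewrite !(segs_cost1, segs_cost_cons) !cnE !regs f1 f2; ring.
by rewrite !(segs_cost1, segs_cost_cons); lra.
Qed.

Lemma outside_facts : [/\ ncoef (rD j) rO = - 2, ncoef (rD i) rO = - 2,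
  ncoef (rD j) (rD l) = - 2, ncoef (rD l) (rD i) = - 2 & ncoef rO rO = - 2].
Proof.
have [ij il jl] := triple_neq.
by split; apply: ncoef_W; rewrite //= (inj_eq Some_inj) ?jl// eq_sym il.
Qed.

Let rOG : reg (seg_head OG) = rO. Proof. exact: (covers_head cO). Qed.

Let X0 : good [:: OG; Di; Ai; Aj; Dj; Dl; Al].
Proof.
have [y yE [y1 y2 y3]] := region_last_OG_coef; have [q1 q2 q3 q4 q5] := outside_facts.
have [||G _] := @good_move _ [:: OG; Di; Ai; Aj; Dj; Dl; Al] B0 isT.
- by move=> P; rewrite !(count_segs_seq, count_segs_seq0); ring.
- by rewrite !(segs_cost1, segs_cost_cons) !cnE !regs rOG yE y1 y3 q1 q3; ring.
exact: G.
Qed.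

Lemma handle_exit_outside : wn (seg_last Ai) (seg_head Aj) = wn (seg_last Al) o.
Proof.
have [f1 f2 f3 _ _] := zero_facts.
have [||_] := @good_move _ [:: Aj; Dj; Dl; Al; OG; Di; Ai] X0 isT.
- by move=> P; rewrite !(count_segs_seq, count_segs_seq0); ring.
- by rewrite !(segs_cost1, segs_cost_cons) !cnE !regs rOG f1 f3; ring.
by rewrite !(segs_cost1, segs_cost_cons) (_ : o = seg_head OG)//; lra.
Qed.

Let P1 : good [:: Al; Aj; Dj; OG; Dl; Di; Ai] /\
  wn (seg_last Ai) (seg_head Aj) + wn (seg_last Dl) (seg_head Al) = wn (seg_last Al) (seg_head Aj) + wn (seg_last Dl) (seg_head Di).
Proof.
have [f1 f2 f3 f4 f5] := zero_facts; have [q1 q2 q3 q4 q5] := outside_facts.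
have [||G E] := @good_move _ [:: Al; Aj; Dj; OG; Dl; Di; Ai] B0 isT.
- by move=> P; rewrite !(count_segs_seq, count_segs_seq0); ring.
- by rewrite !(segs_cost1, segs_cost_cons) !cnE !regs rOG f1 f5 q4 !ncoef_DA; ring.
by split=> //; move: E; rewrite !(segs_cost1, segs_cost_cons); lra.
Qed.

Lemma tooth_inside_rel :
  wn (seg_last Ai) (seg_head Aj) + wn (seg_last Dl) (seg_head Al) = wn (seg_last Al) (seg_head Aj) + wn (seg_last Dl) (seg_head Di).
Proof. exact: P1.2. Qed.

Lemma handle_handle_rel : wn (seg_last Ai) (seg_head Al) = wn (seg_last Al) (seg_head Aj).
Proof.
have [f1 f2 f3 f4 f5] := zero_facts.
have [||_] := @good_move _ [:: Aj; Dj; OG; Dl; Di; Ai; Al] P1.1 isT.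
- by move=> P; rewrite !(count_segs_seq, count_segs_seq0); ring.
- by rewrite !(segs_cost1, segs_cost_cons) !cnE !regs rOG f4 f5; ring.
by rewrite !(segs_cost1, segs_cost_cons); lra.
Qed.

Let seg_sym := (seg_head_rev, seg_last_rev, fun S : segment => seg_cost_rev S cnC,
  fun S : segment => seg_cost_rev S wnC).
Let flat_sym := (seg_seq_rev, count_rev).

(** Reversing the piece from Di to Dj exchanges its free end with the end next to [o]. *)
Lemma outside_rel : wn (seg_last Dj) o = wn (seg_head Di) o.
Proof.
have [q1 q2 q3 q4 q5] := outside_facts.
have [||_] := @good_move _ [:: seg_rev Dj; seg_rev Aj; seg_rev Ai; seg_rev Di; OG; Dl; Al] B0 isT.
- move=> P; by rewrite !(count_segs_seq, count_segs_seq0) !flat_sym; ring.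
- rewrite !(segs_cost1, segs_cost_cons) !seg_sym !cnE !regs rOG q1 q2 [ncoef (rA i) (rD i)]ncoefC
   [ncoef (rA j) (rD j)]ncoefC [ncoef (rA j) (rA i)]ncoefC; ring.
rewrite !(segs_cost1, segs_cost_cons) !seg_sym (_ : o = seg_head OG)//.
have := wnC (seg_last Aj) (seg_head Dj); have := wnC (seg_last Ai) (seg_head Aj); have := wnC (seg_last Di) (seg_head Ai).
by lra.
Qed.

Section TwoOutside.
Context (o2 : T) (Os2 : seq T).
Hypothesis OsE : Os = o2 :: Os2.
Let O1 : segment := (o, [::]).
Let OG2 : segment := (o2, Os2 ++ fillT g).

Let OGE : OG = seg_cat O1 OG2. Proof. by rewrite /OG OsE. Qed.
Let rO1 : reg (seg_head O1) = rO. Proof. exact: (covers_head cO). Qed.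
Let rO1' : reg (seg_last O1) = rO. Proof. exact: (covers_head cO). Qed.
Let rOG2 : reg (seg_head OG2) = rO.
Proof. by apply: (covers_reg cO); rewrite OsE /seg_seq /= !inE eqxx orbT. Qed.
Let stOG2 : seg_last OG2 = seg_last OG. Proof. by rewrite OGE seg_last_cat. Qed.

Let B1 : good [:: Di; Ai; Aj; Dj; O1; OG2; Dl; Al].
Proof.
have [||G _] := @good_move _ [:: Di; Ai; Aj; Dj; O1; OG2; Dl; Al] B0 isT.
- by move=> P; rewrite -/OG OGE !(count_segs_seq, count_segs_seq0); ring.
- rewrite (_ : (o, Os ++ fillT g) = seg_cat O1 OG2); last exact: OGE.
  by rewrite !(segs_cost1, segs_cost_cons) seg_head_cat seg_last_cat seg_cost_cat; ring.
exact: G.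
Qed.

Lemma outside_outside_rel : wn (seg_last Dj) o + wn o o2 = wn o (seg_head Di) + wn (seg_last Dj) o2.
Proof.
have [f1 f2 f3 f4 f5] := outside_facts.
have [||_] := @good_move _ [:: O1; Di; Ai; Aj; Dj; OG2; Dl; Al] B1 isT.
- by move=> P; rewrite !(count_segs_seq, count_segs_seq0); ring.
- by rewrite !(segs_cost1, segs_cost_cons) !cnE !regs rO1 ?rO1' rOG2 f1 f5 [ncoef rO (rD i)]ncoefC f2; ring.
rewrite !(segs_cost1, segs_cost_cons) (_ : o = seg_head O1)// (_ : o2 = seg_head OG2)// (_ : seg_last O1 = seg_head O1)//.
by lra.
Qed.

(** The outside vertex [o] travels past the two teeth i and j. This relation gives the cost of an
    edge between two teeth off the handle, once the edges at outside vertices are known. *)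
Lemma outside_move_rel : wn o2 (seg_head Di) + wn (seg_last Dj) o + wn o (seg_head Dl) =
  wn o2 o + wn o (seg_head Di) + wn (seg_last Dj) (seg_head Dl).
Proof.
have [y yE [y1 y2 y3]] := region_last_OG_coef; rewrite -stOG2 in yE.
have [f1 f2 f3 f4 f5] := outside_facts.
have fl : ncoef rO (rD l) = - 2 by apply: ncoef_W.
have [||G _] := @good_move _ [:: seg_rev OG2; O1; Di; Ai; Aj; Dj; Dl; Al] B1 isT.
- by move=> P; rewrite !(count_segs_seq, count_segs_seq0) !flat_sym; ring.
- by rewrite !(segs_cost1, segs_cost_cons) !seg_sym !cnE !regs rO1 ?rO1' rOG2 yE y3 f1 f3 f5 [ncoef rO (rD i)]ncoefC f2; ring.
have [||_] := @good_move _ [:: seg_rev OG2; Di; Ai; Aj; Dj; O1; Dl; Al] G isT.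
- by move=> P; rewrite !(count_segs_seq, count_segs_seq0) !flat_sym; ring.
- by rewrite !(segs_cost1, segs_cost_cons) !seg_sym !cnE !regs rO1 ?rO1' rOG2 f1 f3 f5 fl [ncoef rO (rD i)]ncoefC f2; ring.
rewrite !(segs_cost1, segs_cost_cons) !seg_sym (_ : o = seg_head O1)// (_ : o2 = seg_head OG2)// (_ : seg_last O1 = seg_head O1)//.
by lra.
Qed.

End TwoOutside.

(** Splitting a segment exposes an edge inside its region; here Dl is inserted between two parts of
    Al. *)
Lemma handle_part_rel (A2 a1 : segment) : Al = seg_cat A2 a1 -> wn (seg_last A2) (seg_head a1) + wn (seg_last OG) (seg_head Dl) + wn (seg_last Dl) (seg_head Di) =
  wn (seg_last A2) (seg_head Dl) + wn (seg_last Dl) (seg_head a1) + wn (seg_last OG) (seg_head Di).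
Proof.
move=> AlE; have [y yE [y1 y2 y3]] := region_last_OG_coef; have [f1 f2 f3 f4 f5] := outside_facts.
have rl v : v \in seg_seq A2 ++ seg_seq a1 -> reg v = rA l by move=> vA; apply: (covers_reg cAl); rewrite AlE seg_seq_cat.
have r1 : reg (seg_last A2) = rA l by apply: rl; rewrite mem_cat; apply/orP; left; exact: mem_last.
have r2 : reg (seg_head a1) = rA l by apply: rl; rewrite mem_cat mem_head orbT.
have r3 : reg (seg_last a1) = rA l by apply: rl; rewrite mem_cat; apply/orP; right; exact: mem_last.
have [||G _] := @good_move _ [:: A2; a1; Aj; Dj; OG; Dl; Di; Ai] P1.1 isT.
- by move=> P; rewrite AlE !(count_segs_seq, count_segs_seq0) seg_seq_cat count_cat; ring.
- by rewrite AlE !(segs_cost1, segs_cost_cons) seg_last_cat seg_cost_cat; ring.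
have [||_] := @good_move _ [:: A2; Dl; a1; Aj; Dj; OG; Di; Ai] G isT.
- by move=> P; rewrite !(count_segs_seq, count_segs_seq0); ring.
- by rewrite !(segs_cost1, segs_cost_cons) !cnE !regs r1 r2 r3 yE y1 y3 f4 [ncoef (rA l) (rD l)]ncoefC !ncoef_DA ncoef_AA; ring.
by rewrite !(segs_cost1, segs_cost_cons); lra.
Qed.

(** Inserting Al into Dl trades edges of normalized comb cost 0 and -4 for two of cost -2; this ties
    the third value of [w] to the other two. *)
Lemma tooth_part_rel (D2 d1 : segment) : Dl = seg_cat D2 d1 -> wn (seg_last Al) (seg_head Aj) + wn (seg_last D2) (seg_head d1) =
  wn (seg_last D2) (seg_head Al) + wn (seg_last Al) (seg_head d1).
Proof.
move=> DlE; have [f1 f2 f3 f4 f5] := zero_facts.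
have rl v : v \in seg_seq D2 ++ seg_seq d1 -> reg v = rD l by move=> vA; apply: (covers_reg cDl); rewrite DlE seg_seq_cat.
have r1 : reg (seg_last D2) = rD l by apply: rl; rewrite mem_cat; apply/orP; left; exact: mem_last.
have r2 : reg (seg_head d1) = rD l by apply: rl; rewrite mem_cat mem_head orbT.
have r3 : reg (seg_last d1) = rD l by apply: rl; rewrite mem_cat; apply/orP; right; exact: mem_last.
have [||G _] := @good_move _ [:: Al; Aj; Dj; OG; D2; d1; Di; Ai] P1.1 isT.
- by move=> P; rewrite DlE !(count_segs_seq, count_segs_seq0) seg_seq_cat count_cat; ring.
- by rewrite DlE !(segs_cost1, segs_cost_cons) seg_head_cat seg_last_cat seg_cost_cat; ring.
have [||_] := @good_move _ [:: Aj; Dj; OG; D2; Al; d1; Di; Ai] G isT.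
- by move=> P; rewrite !(count_segs_seq, count_segs_seq0); ring.
- by rewrite !(segs_cost1, segs_cost_cons) !cnE !regs r1 r2 r3 f5 [ncoef (rA l) (rD l)]ncoefC !ncoef_DA ncoef_DD; ring.
by rewrite !(segs_cost1, segs_cost_cons); lra.
Qed.

End Triple.

Hypothesis I3 : (3 <= #|I|)%N.
Hypothesis oddI : odd #|I|.
Hypothesis O2 : forall u, exists2 v, v != u & reg v = rO.

Lemma triple_rest i j l : i != j -> i != l -> j != l ->
  exists2 g, perm_eq (i :: j :: l :: g) (enum I) & ~~ odd (size g).
Proof.
move=> ij il jl; pose g := rem l (rem j (rem i (enum I))).
have ui := enum_uniq I; have uj := rem_uniq i ui.
have pI : perm_eq (i :: j :: l :: g) (enum I).
  rewrite perm_sym; apply: perm_trans (perm_to_rem (mem_enum I i)) _; rewrite perm_cons.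
  have ji : j \in rem i (enum I) by rewrite mem_rem_uniq// !inE eq_sym ij mem_enum.
  apply: perm_trans (perm_to_rem ji) _; rewrite perm_cons perm_to_rem//.
  rewrite mem_rem_uniq// !inE eq_sym jl mem_rem_uniq// !inE eq_sym il mem_enum //.
exists g => //; move: oddI; rewrite cardE -(perm_size pI) /= negbK.
by case: (odd _).
Qed.

Lemma third_tooth i j : exists2 l, l != i & l != j.
Proof.
apply: contrapT => no; have : (#|I| <= 2)%N.
  apply: leq_trans (card_size [:: i; j]); apply/subset_leq_card/fintype.subsetP => l _.
  rewrite !inE; apply: contraT; rewrite negb_or => /andP[li lj]; exfalso.
  by apply: no; exists l.
by move: I3; lia.
Qed.

Lemma other_teeth l : exists i j, [/\ i != j, i != l & j != l].
Proof.
have [i il _] := third_tooth l l; have [j jl ji] := third_tooth l i.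
by exists i, j; rewrite eq_sym.
Qed.

Lemma exists_outside o : reg o = rO -> exists Os, covers (o, Os) rO.
Proof. by move/exists_head => [[x Os] cO /= <-]; exists Os. Qed.

Lemma covers_two u v a : u != v -> reg u = a -> reg v = a ->
  exists s, covers (u, v :: s) a.
Proof.
move=> uv ua va; exists (rem v (rem u (reglist a))) => P.
apply/esym; move: P; apply/seq.permP.
have rlu : uniq (reglist a) by rewrite filter_uniq// enum_uniq.
apply: perm_trans (perm_to_rem (_ : u \in _)) _; first by rewrite mem_filter ua eqxx mem_enum.
rewrite perm_cons perm_to_rem// mem_rem_uniq// !inE eq_sym uv mem_filter va eqxx.
by rewrite mem_enum.
Qed.

Lemma exists_split u v a : u != v -> reg u = a -> reg v = a ->
  exists S, covers (seg_cat S (v, [::])) a /\ seg_last S = u.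
Proof.
move=> uv ua va; have [s cs] := covers_two uv ua va.
exists (seg_rev (u, s)); split; last by rewrite seg_last_rev.
move=> P; rewrite -cs seg_seq_cat count_cat seg_seq_rev count_rev /seg_seq /=; ring.
Qed.

Lemma exists_tight_and_loose : exists s s', [/\ perm_eq s offz, perm_eq s' offz,
  cycost ccost z s = K & cycost ccost z s' = K + 2].
Proof.
have /card_gt0P[l _] : (0 < #|I|)%N by move: I3; lia.
have [i [j [ij il jl]]] := other_teeth l; have [g pI og] := triple_rest ij il jl.
have [p _ pO] := O2 z; have [Os cO] := exists_outside pO.
have [a ai] := Ane i; have [a' aj] := Ane j; have [a2 al] := Ane l.
have [d di] := Dne i; have [d' dj] := Dne j; have [d2 dl] := Dne l.
have [A cA _] := exists_head ai; have [A' cA' _] := exists_head aj; have [A2 cA2 _] := exists_head al.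
have [D cD _] := exists_head di; have [D' cD' _] := exists_head dj; have [D2 cD2 _] := exists_head dl.
have [L0 cL kL] := base_good pI og cO cD cA cA' cD' cD2 cA2; set OG := (p, _) in L0 cL kL.
(* With A' and D' exchanged, the tour leaves the handle between the teeth i and j and comes back to
   it, which costs 2 more. *)
pose L' := [:: D; A; D'; A'; OG; D2; A2].
exists (segs_seq [:: D; A; A'; D'; OG; D2; A2]), (segs_seq L').
have cL' P : count P (segs_seq L') = count P offz.
  by rewrite -cL !(count_segs_seq, count_segs_seq0); ring.
split; [exact/seq.permP|exact/seq.permP| |]; rewrite (segs_cost_cycost ccostC)//.
rewrite -kL; set X := segs_cost cn [:: D; A; A'; D'; OG; D2; A2].
suff : segs_cost cn L' = X + 2 by move=> ->; ring.
rewrite /X.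
have rO' : reg (seg_head OG) = rO by exact: (covers_head cO).
have ji : Some j != Some i by rewrite (inj_eq Some_inj) eq_sym.
have f1 : cn (seg_last A) (seg_head D') = 0 by rewrite cnE (covers_last cA) (covers_head cD') ncoef_A.
have f2 : cn (seg_last A) (seg_head A') = 0 by rewrite cnE (covers_last cA) (covers_head cA') ncoef_A.
have f3 : cn (seg_last D') (seg_head A') = - 2 by rewrite cnE (covers_last cD') (covers_head cA') ncoef_DA.
have f4 : cn (seg_last A') (seg_head D') = - 2.
  by rewrite cnE (covers_last cA') (covers_head cD') ncoefC ncoef_DA.
have f5 : cn (seg_last A') (seg_head OG) = 0 by rewrite cnE (covers_last cA') rO' ncoef_A.
have f6 : cn (seg_last D') (seg_head OG) = - 2 by rewrite cnE (covers_last cD') rO' ncoef_W.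
rewrite !(segs_cost1, segs_cost_cons); lra.
Qed.

Let wnC u v : wn u v = wn v u. Proof. apply: normalC; exact: wC. Qed.

Let Oex : exists o, reg o = rO. Proof. by have [p _ pO] := O2 z; exists p. Qed.

(** In [handle_exit_tooth] the right side does not involve the ends chosen in Ai and Aj, so the cost
    depends on the two teeth only ([ind]). Then [handle_handle_rel] changes the pair of teeth
    ([shift]), and all pairs are compared with one fixed pair. *)
Lemma handle_teeth_const : exists m, forall i j u v, i != j -> reg u = rA i -> reg v = rA j ->
  wn u v = m.
Proof.
have [p pO] := Oex; have [Os cO] := exists_outside pO.
have ind i j u v u' v' : i != j -> reg u = rA i -> reg v = rA j -> reg u' = rA i ->
    reg v' = rA j -> wn u v = wn u' v'.
  move=> ij ui vj ui' vj'; have [l li lj] := third_tooth i j.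
  have [||g pI og] := @triple_rest i j l ij; try by rewrite // eq_sym.
  have [a al] := Ane l; have [d di] := Dne i; have [d' dj] := Dne j; have [d2 dl] := Dne l.
  have [A cA aE] := exists_last al; have [D cD dE] := exists_head di.
  have [D' cD' _] := exists_head dj; have [D2 cD2 _] := exists_head dl.
  have [U cU uE] := exists_last ui; have [V cV vE] := exists_head vj.
  have [U' cU' uE'] := exists_last ui'; have [V' cV' vE'] := exists_head vj'.
  have := handle_exit_tooth pI og cO cD cU cV cD' cD2 cA.
  have := handle_exit_tooth pI og cO cD cU' cV' cD' cD2 cA.
  by rewrite uE vE uE' vE' => -> ->.
have shift i j l u v v' x : i != j -> i != l -> j != l -> reg u = rA i -> reg v = rA j ->
    reg v' = rA j -> reg x = rA l -> wn u v = wn v' x.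
  move=> ij il jl ui vj vj' xl.
  have [|g pI og] := @triple_rest i l j il ij; try by rewrite // eq_sym.
  have [d di] := Dne i; have [d' dj] := Dne j; have [d2 dl] := Dne l.
  have [D cD dE] := exists_head di.
  have [D' cD' _] := exists_head dj; have [D2 cD2 _] := exists_head dl.
  have [U cU uE] := exists_last ui; have [X cX xE] := exists_head xl; have [V cV _] := exists_head vj.
  have := handle_handle_rel pI og cO cD cU cX cD2 cD' cV; rewrite uE xE.
  rewrite (ind i j u (seg_head V) u v)//; last exact: (covers_head cV).
  by rewrite (ind j l (seg_last V) x v' x)//; exact: (covers_last cV).
have /card_gt0P[i0 _] : (0 < #|I|)%N by move: I3; lia.
have [j0 j0i _] := third_tooth i0 i0.
have [u0 u0r] := Ane i0; have [v0 v0r] := Ane j0.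
have at_i0 j v x : j != i0 -> reg v = rA j -> reg x = rA i0 -> wn v x = wn u0 v0.
  move=> ji0 vr xr; case: (eqVneq j j0) => [jj0|jj0].
    by rewrite wnC jj0 in vr *; apply: (ind i0 j0) => //; rewrite eq_sym.
  by rewrite (shift j i0 j0 v x u0 v0)// eq_sym.
exists (wn u0 v0) => i j u v ij ur vr.
case: (eqVneq i i0) => [ii0|ii0].
  by rewrite wnC; apply: (at_i0 j) => //; [rewrite -ii0 eq_sym|rewrite -ii0].
case: (eqVneq j i0) => [ji0|ji0]; first by apply: (at_i0 i) => //; rewrite -ji0.
by rewrite (shift i j i0 u v v u0)// (at_i0 j).
Qed.

(** Where [cn] is 0, -2, -4, the weight is [m], [n], [2 * n - m]. Two values fit an affine function
    for free; the content is that each class has one value and that the third is aligned. *)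
Lemma normal_two_values : exists m n, forall u v, u != v -> u != z -> v != z ->
  wn u v = m - (n - m) / 2 * cn u v.
Proof.
have [m zAA] := handle_teeth_const.
have zAD i l u v : l != i -> reg u = rA l -> reg v = rD i -> wn u v = m.
  move=> li ur vr; have [j ji jl] := third_tooth i l.
  have [|||g pI og] := @triple_rest i j l; try by rewrite // eq_sym.
  have [p pO] := Oex; have [Os cO] := exists_outside pO.
  have [a ai] := Ane i; have [a' aj] := Ane j; have [d' dj] := Dne j; have [d2 dl] := Dne l.
  have [A cA _] := exists_head ai; have [A' cA' _] := exists_head aj.
  have [D' cD' _] := exists_head dj; have [D2 cD2 _] := exists_head dl.
  have [U cU uE] := exists_last ur; have [V cV vE] := exists_head vr.
  have := handle_exit_tooth pI og cO cV cA cA' cD' cD2 cU; rewrite uE vE => <-.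
  by apply: (zAA i j); rewrite 1?eq_sym// ?(covers_last cA) ?(covers_head cA').
have zAO l u v : reg u = rA l -> reg v = rO -> wn u v = m.
  move=> ur vr; have [i [j [ij il jl]]] := other_teeth l.
  have [g pI og] := triple_rest ij il jl.
  have [Os cO] := exists_outside vr.
  have [a ai] := Ane i; have [a' aj] := Ane j; have [d di] := Dne i; have [d' dj] := Dne j.
  have [d2 dl] := Dne l.
  have [A cA _] := exists_head ai; have [A' cA' _] := exists_head aj; have [D cD _] := exists_head di.
  have [D' cD' _] := exists_head dj; have [D2 cD2 _] := exists_head dl.
  have [U cU uE] := exists_last ur.
  have := handle_exit_outside pI og cO cD cA cA' cD' cD2 cU; rewrite uE => <-.
  by apply: (zAA i j); rewrite ?(covers_last cA) ?(covers_head cA').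
have DO i j u v x : i != j -> reg u = rD i -> reg v = rD j -> reg x = rO -> wn u x = wn v x.
  move=> ij ur vr xr; have [l li lj] := third_tooth i j.
  have [||g pI og] := @triple_rest i j l ij; try by rewrite // eq_sym.
  have [Os cO] := exists_outside xr.
  have [a ai] := Ane i; have [a' aj] := Ane j; have [a2 al] := Ane l; have [d2 dl] := Dne l.
  have [A cA _] := exists_head ai; have [A' cA' _] := exists_head aj; have [A2 cA2 _] := exists_head al.
  have [D2 cD2 _] := exists_head dl.
  have [U cU uE] := exists_head ur; have [V cV vE] := exists_last vr.
  by have := outside_rel pI og cO cU cA cA' cV cD2 cA2; rewrite uE vE => ->.
have {}DO i j u v x : reg u = rD i -> reg v = rD j -> reg x = rO -> wn u x = wn v x.
  move=> ur vr xr; case: (eqVneq i j) => [ij|ij]; last exact: (DO i j).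
  have [l li lj] := third_tooth i j; have [y yr] := Dne l.
  by rewrite (DO i l u y x) 1?eq_sym// (DO l j y v x).
have OO u v : u != v -> reg u = rO -> reg v = rO -> forall i d, reg d = rD i -> wn u v = wn d v.
  move=> uv ur vr i d dr; have [j ji _] := third_tooth i i; have [l li lj] := third_tooth i j.
  have [|||g pI og] := @triple_rest i j l; try by rewrite // eq_sym.
  have [Os cO] := covers_two uv ur vr.
  have [a ai] := Ane i; have [a' aj] := Ane j; have [a2 al] := Ane l; have [d2 dl] := Dne l.
  have [d' dj] := Dne j; have [d0 di] := Dne i.
  have [A cA _] := exists_head ai; have [A' cA' _] := exists_head aj; have [A2 cA2 _] := exists_head al.
  have [D2 cD2 _] := exists_head dl; have [D' cD' _] := exists_head dj; have [D cD dE] := exists_head di.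
  have := outside_outside_rel pI og cO cD cA cA' cD' cD2 cA2 erefl.
  rewrite [wn u (seg_head D)]wnC (DO j i (seg_last D') (seg_head D) u) ?(covers_last cD') ?(covers_head cD)//.
  by rewrite (DO j i (seg_last D') d v) ?(covers_last cD')//; lra.
have [p pO] := Oex; have [p' p'p p'O] := O2 p.
have pp' : p != p' by rewrite eq_sym.
have /card_gt0P[i0 _] : (0 < #|I|)%N by move: I3; lia.
have [d0 d0r] := Dne i0; pose n := wn d0 p.
have nDO i d x : reg d = rD i -> reg x = rO -> wn d x = n.
  move=> dr xr; rewrite (DO i i0 d d0 x)// /n; case: (eqVneq x p) => [->//|xp].
  by rewrite -(OO p x _ _ _ i0)// ?[wn p x]wnC ?(OO x p _ _ _ i0 d0)// eq_sym.
have nOO x y : x != y -> reg x = rO -> reg y = rO -> wn x y = n.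
  by move=> xy xr yr; rewrite (OO x y xy xr yr i0 d0)// (nDO i0).
have nDD j l u v : j != l -> reg u = rD j -> reg v = rD l -> wn u v = n.
  move=> jl ur vr; have [i ij il] := third_tooth j l.
  have [g pI og] := triple_rest ij il jl.
  have [Os cO] := covers_two pp' pO p'O.
  have [a ai] := Ane i; have [a' aj] := Ane j; have [a2 al] := Ane l; have [d di] := Dne i.
  have [A cA _] := exists_head ai; have [A' cA' _] := exists_head aj; have [A2 cA2 _] := exists_head al.
  have [D cD _] := exists_head di; have [U cU uE] := exists_last ur; have [V cV vE] := exists_head vr.
  have := outside_move_rel pI og cO cD cA cA' cU cV cA2 erefl; rewrite uE vE.
  rewrite [wn p' (seg_head D)]wnC [wn p (seg_head D)]wnC [wn p v]wnC (nDO i (seg_head D) p') ?(covers_head cD)//.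
  by rewrite (nDO i (seg_head D) p) ?(covers_head cD)// (nDO j u p)// (nDO l v p)// nOO//; lra.
have nDA l u v : reg u = rD l -> reg v = rA l -> wn u v = n.
  move=> ur vr; have [i [j [ij il jl]]] := other_teeth l.
  have [g pI og] := triple_rest ij il jl; have [Os cO] := exists_outside pO.
  have [a ai] := Ane i; have [a' aj] := Ane j; have [d di] := Dne i; have [d' dj] := Dne j.
  have [A cA _] := exists_head ai; have [A' cA' _] := exists_head aj; have [D cD _] := exists_head di.
  have [D' cD' _] := exists_head dj.
  have [U cU uE] := exists_last ur; have [V cV vE] := exists_head vr.
  have := tooth_inside_rel pI og cO cD cA cA' cD' cU cV; rewrite uE vE.
  rewrite (zAA i j (seg_last A) (seg_head A')) ?(covers_last cA) ?(covers_head cA')//.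
  rewrite (zAA l j (seg_last V) (seg_head A')) 1?eq_sym ?(covers_last cV) ?(covers_head cA')//.
  by rewrite (nDD l i u (seg_head D)) 1?eq_sym ?(covers_head cD)//; lra.
have nAA l u v : u != v -> reg u = rA l -> reg v = rA l -> wn u v = n.
  move=> uv ur vr; have [i [j [ij il jl]]] := other_teeth l.
  have [g pI og] := triple_rest ij il jl; have [Os cO] := exists_outside pO.
  have [a ai] := Ane i; have [a' aj] := Ane j; have [d di] := Dne i; have [d' dj] := Dne j.
  have [d2 dl] := Dne l.
  have [A cA _] := exists_head ai; have [A' cA' _] := exists_head aj; have [D cD _] := exists_head di.
  have [D' cD' _] := exists_head dj; have [D2 cD2 _] := exists_head dl.
  have [U [cU uE]] := exists_split uv ur vr.
  have := handle_part_rel pI og cO cD cA cA' cD' cD2 cU erefl.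
  rewrite uE (_ : seg_head (v, [::]) = v)//.
  have [hy yi _ yl] := region_last_OG pI og cO.
  set y := seg_last _ in hy yi yl *.
  have yD k e : th y != Some k -> reg e = rD k -> wn y e = n.
    move=> yk er; case ty: (th y) => [c|].
      apply: (nDD c k) => //; first by apply: contraNneq yk => <-; rewrite ty.
      by rewrite /reg (negbTE hy) ty.
    by rewrite wnC; apply: (nDO k) => //; rewrite /reg (negbTE hy) ty.
  rewrite (yD l (seg_head D2)) ?(covers_head cD2)// (yD i (seg_head D)) ?(covers_head cD)//.
  rewrite (nDD l i (seg_last D2) (seg_head D)) 1?eq_sym ?(covers_last cD2) ?(covers_head cD)//.
  rewrite wnC [wn u (seg_head D2)]wnC (nDA l (seg_head D2) u) ?(covers_head cD2)//.
  by rewrite (nDA l (seg_last D2) v) ?(covers_last cD2)// wnC; lra.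
have nDDl l u v : u != v -> reg u = rD l -> reg v = rD l -> wn u v = 2 * n - m.
  move=> uv ur vr; have [i [j [ij il jl]]] := other_teeth l.
  have [g pI og] := triple_rest ij il jl; have [Os cO] := exists_outside pO.
  have [a ai] := Ane i; have [a' aj] := Ane j; have [d di] := Dne i; have [d' dj] := Dne j.
  have [a2 al] := Ane l.
  have [A cA _] := exists_head ai; have [A' cA' _] := exists_head aj; have [D cD _] := exists_head di.
  have [D' cD' _] := exists_head dj; have [A2 cA2 _] := exists_head al.
  have [U [cU uE]] := exists_split uv ur vr.
  have := tooth_part_rel pI og cO cD cA cA' cD' cU cA2 erefl.
  rewrite uE (_ : seg_head (v, [::]) = v)//.
  rewrite (zAA l j (seg_last A2) (seg_head A')) 1?eq_sym ?(covers_last cA2) ?(covers_head cA')//.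
  rewrite (nDA l u (seg_head A2)) ?(covers_head cA2)// wnC [wn _ v]wnC.
  by rewrite (nDA l v (seg_last A2)) ?(covers_last cA2)// wnC; lra.
exists m, n.
(* The endpoints are ordered: handle, then teeth off the handle, then outside. The other order
   follows by symmetry. *)
have key u v : u != v -> u != z -> v != z -> (hd v ==> hd u) -> (~~ hd u ==> (th u == None) ==> (th v == None)) ->
    wn u v = m - (n - m) / 2 * cn u v.
  move=> uv uz vz hvu tuv; rewrite cnE.
  have uZ : reg u != rZ by rewrite zP. have vZ : reg v != rZ by rewrite zP.
  case ur : (reg u) uZ => [[] [i|]]; rewrite ?eqxx// => _.
  - have [vi|vi] := eqVneq (th v) (Some i); last first.
      rewrite ncoef_A// mulr0 subr0; case vr : (reg v) vZ => [[] [j|]]; rewrite ?eqxx// => _.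
      + apply: (zAA i j) => //; rewrite eq_sym; apply: contraNneq vi => <-.
        by move: vr => -[_ ->].
      + apply: (zAD j i) => //; rewrite eq_sym; apply: contraNneq vi => <-.
        by move: vr => -[_ ->].
      + exact: (zAO i).
    case hv : (hd v).
      have -> : reg v = rA i by rewrite /reg hv vi.
      rewrite (nAA i)// ?/reg ?hv ?vi// ncoef_AA; lra.
    have -> : reg v = rD i by rewrite /reg hv vi.
    by rewrite wnC (nDA i)// ?/reg ?hv ?vi// ncoefC ncoef_DA; lra.
  - move: ur => -[hu tu]; move: hvu tuv; rewrite hu tu implybF => /negbTE hv _.
    have [vi|vi] := eqVneq (th v) (Some i).
      have -> : reg v = rD i by rewrite /reg hv vi.
      rewrite (nDDl i)// ?/reg ?hv ?hu ?tu ?vi// ncoef_DD; lra.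
    rewrite ncoef_W//= ?hv// 1?eq_sym ?vi//.
    case tv : (th v) => [j|].
      rewrite (nDD i j)// ?/reg ?hv ?hu ?tu ?tv//; last first.
        by apply: contraNneq vi => ->; rewrite tv.
      lra.
    rewrite (nDO i)// ?/reg ?hv ?hu ?tu ?tv//; lra.
  - move: ur => -[hu tu]; move: hvu tuv; rewrite hu tu /= implybF => /negbTE hv /eqP tv.
    have vr : reg v = rO by rewrite /reg hv tv.
    rewrite vr ncoef_W// nOO// /reg ?hu ?tu//; lra.
move=> u v uv uz vz.
case: (boolP ((hd v ==> hd u) && (~~ hd u ==> (th u == None) ==> (th v == None)))) => [/andP[h1 h2]|h].
  exact: key.
rewrite wnC (normalC z u v ccostC); apply: key => //; first by rewrite eq_sym.
all: by move: h; case: (hd u); case: (hd v); case: (th u); case: (th v).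
Qed.

Lemma pcost_affine (f h : T -> T -> R) (b k : R) x s :
  (forall u v, u \in x :: s -> v \in x :: s -> u != v -> f u v = b + k * h u v) -> uniq (x :: s) ->
  pcost f x s = b * (size s)%:R + k * pcost h x s.
Proof.
elim: s x => [|y s IH] x fh; first by rewrite /= !mulr0 addr0.
rewrite cons_uniq => /andP[xs us] /=; rewrite IH//; last first.
  by move=> u v us' vs'; apply: fh; rewrite inE ?us' ?vs' orbT.
rewrite fh ?inE ?eqxx ?orbT//; first by rewrite -addn1 natrD; ring.
by move: xs; rewrite inE negb_or => /andP[].
Qed.

(** All tours have the same number of edges and the same sum of potentials, so the additive
    constants of the affine relation cancel in differences. *)
Lemma comb_tours_proportional : exists k, forall s s', perm_eq s offz -> perm_eq s' offz ->
  cycost w z s - cycost w z s' = k * (cycost ccost z s - cycost ccost z s').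
Proof.
have [m [n wnE]] := normal_two_values; exists (- (n - m) / 2).
pose W (f : T -> T -> R) := 2 * (\sum_(v <- offz) f z v).
have uz : uniq offz by rewrite filter_uniq// enum_uniq.
have main s : perm_eq s offz -> exists c, cycost w z s = m * (size offz).-1%:R - (n - m) / 2 * c + W w /\
    cycost ccost z s = c + W ccost.
  case: s => [|x s] ps.
    have [p pO] := Oex; have : p \in offz.
      rewrite mem_filter mem_enum andbT; apply/negP; rewrite -zP pO //.
    by rewrite -(perm_mem ps).
  exists (pcost cn x s); rewrite !cycost_normal//; last exact: ccostC.
  rewrite !(perm_big _ ps) -(perm_size ps) -/(W w) -/(W ccost); split=> //; congr (_ + _).
  rewrite (@pcost_affine wn cn m (- ((n - m) / 2)))//; first by rewrite mulNr.
    move=> u v; rewrite !(perm_mem ps) !mem_filter => /andP[uz' _] /andP[vz' _] uv.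
    by rewrite wnE// mulNr.
  by rewrite (perm_uniq ps).
move=> s s' /main[c [-> ->]] /main[c' [-> ->]]; lra.
Qed.

End CombFacet.

(** * Tours and comb facets *)

Section Tours.
Context (R : realType) (n : nat).
Notation V := 'I_n.
Notation edge := (edge n).
Notation vec := (vec R edge).
Implicit Types (a : vec) (C : {set edge}).

Definition edge_val a (u v : V) : R :=
  if insub [set u; v]%SET is Some e then a (e : edge) else 0.

Lemma edge_valC a u v : edge_val a u v = edge_val a v u.
Proof. by rewrite /edge_val finset.setUC. Qed.

Definition tour_edges (s : seq V) : {set edge} :=
  [set e : edge | [exists v, val e == [set v; next s v]%SET]]%SET.

Lemma pcost_nth (T : eqType) (F : T -> T -> R) (d x : T) (s : seq T) :
  pcost F x s = \sum_(i < size s) F (nth d (x :: s) i) (nth d s i).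
Proof.
elim: s x => [|y s IH] x /=; first by rewrite big_ord0.
by rewrite big_ord_recl /= IH.
Qed.

Lemma sum_next (T : eqType) (F : T -> T -> R) (z : T) (s : seq T) : uniq (z :: s) ->
  \sum_(v <- z :: s) F v (next (z :: s) v) = cycost F z s.
Proof.
move=> us; rewrite /cycost (pcost_nth _ z) size_rcons (big_nth z) big_mkord.
apply: eq_bigr => i _; have iz : (i < size (z :: s))%N by [].
rewrite next_nth mem_nth// index_uniq//; congr (F _ _).
  rewrite -rcons_cons nth_rcons iz //.
rewrite nth_rcons; case: ltnP => // si; rewrite nth_default//.
by case: eqP.
Qed.

Lemma next_neq2 (s : seq V) u : uniq s -> u \in s -> (3 <= size s)%N ->
  next s u != u /\ next s (next s u) != u.
Proof.
move=> us uin s3; case/rot_to: (uin) => i s' rs.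
have us' : uniq (u :: s') by rewrite -rs rot_uniq.
have sz : size (u :: s') = size s by rewrite -rs size_rot.
rewrite -!(next_rot i us) rs.
case: s' us' sz {rs} => [|v [|x s']] //= us' sz; rewrite -?sz// in s3.
move: us'; rewrite !inE !negb_or => /and3P[/and3P[uv ux us'] /andP[vx vs'] _].
by rewrite !eqxx [v == u]eq_sym (negbTE uv) [x == u]eq_sym ux.
Qed.

Section OneTour.
Context (z : V) (s : seq V).
Hypothesis ps : perm_eq s (offz z).
Hypothesis n3 : (3 <= n)%N.
Let c := z :: s.

Lemma tour_uniq : uniq c.
Proof.
by rewrite /c cons_uniq (perm_uniq ps) filter_uniq ?enum_uniq// andbT (perm_mem ps) mem_filter eqxx.
Qed.

Lemma tour_full v : v \in c.
Proof. by rewrite inE (perm_mem ps) mem_filter mem_enum andbT; case: eqP. Qed.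

Lemma perm_tour : perm_eq c (enum V).
Proof. by apply: uniq_perm; rewrite ?tour_uniq ?enum_uniq// => v; rewrite tour_full mem_enum. Qed.

Lemma size_tour : size c = n.
Proof. by rewrite (perm_size perm_tour) size_enum_ord. Qed.

Lemma next_edge v : #|[set v; next c v]%SET| == 2%N.
Proof.
have s3 : (3 <= size c)%N by rewrite size_tour.
have [h _] := next_neq2 tour_uniq (tour_full v) s3.
by rewrite cards2 [v == _]eq_sym h.
Qed.

Definition edge_of v : edge := exist _ [set v; next c v]%SET (next_edge v).

(** This is where [n3] enters: on two vertices both steps of the cycle would use the same edge. *)
Lemma edge_of_inj : injective edge_of.
Proof.
move=> u v /(congr1 val) uv; apply/eqP; apply: contraT => neq.
have s3 : (3 <= size c)%N by rewrite size_tour.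
have [_ h] := next_neq2 tour_uniq (tour_full u) s3.
have mem_edge w w' : (w' \in val (edge_of w)) = (w' == w) || (w' == next c w).
  by rewrite !inE.
have : u \in val (edge_of v) by rewrite -uv mem_edge eqxx.
rewrite mem_edge (negbTE neq) orFb => /eqP uE.
have : v \in val (edge_of u) by rewrite uv mem_edge eqxx.
rewrite mem_edge eq_sym (negbTE neq) orFb => /eqP vE.
by move: h; rewrite -vE -uE eqxx.
Qed.

Lemma tour_edgesE : tour_edges c = [set edge_of v | v in V]%SET.
Proof.
apply/setP => e; rewrite inE; apply/existsP/imsetP => [[v /eqP ev]|[v _ ->]].
  by exists v => //; apply: val_inj.
by exists v.
Qed.

Lemma sum_tour (F : edge -> R) : \sum_(e in tour_edges c) F e = \sum_v F (edge_of v).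
Proof. by rewrite tour_edgesE big_imset//=; move=> u v _ _; exact: edge_of_inj. Qed.

Lemma edge_val_of a v : edge_val a v (next c v) = a (edge_of v).
Proof. by rewrite /edge_val (insubT (fun e : {set V} => #|e| == 2%N) (next_edge v)). Qed.

Lemma dot_tour a : dot a (char_vec R (tour_edges c)) = cycost (edge_val a) z s.
Proof.
rewrite -sum_next ?tour_uniq// (perm_big _ perm_tour)/= big_enum/=.
transitivity (\sum_(e in tour_edges c) a e).
  rewrite /dot [RHS]big_mkcond/=; apply: eq_bigr => e _.
  by rewrite ffunE; case: (e \in _); rewrite ?mulr1 ?mulr0.
by rewrite sum_tour; apply: eq_bigr => v _; rewrite edge_val_of.
Qed.

Lemma hamiltonian_tour : hamiltonian_cycle (tour_edges c).
Proof. by split=> //; exists c; split; [exact: tour_uniq|exact: tour_full|]. Qed.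

End OneTour.

Lemma hamiltonian_cycleP z C : hamiltonian_cycle C ->
  (3 <= n)%N /\ exists2 s, perm_eq s (offz z) & C = tour_edges (z :: s).
Proof.
move=> [n3 [c [uc fc CE]]]; split=> //; case/rot_to: (fc z) => i s rs.
have us : uniq (z :: s) by rewrite -rs rot_uniq.
exists s.
  apply: uniq_perm; [by case/andP: us|by rewrite filter_uniq// enum_uniq|].
  move=> v; rewrite mem_filter mem_enum andbT.
  have : v \in z :: s by rewrite -rs mem_rot.
  rewrite inE; case: eqP => [-> _|//].
  by case/andP: us => /negbTE ->.
rewrite CE; apply/setP => e; rewrite !inE; apply: eq_existsb => v.
by rewrite -rs next_rot.
Qed.

Definition tour_vecs : seq vec :=
  [seq char_vec R C | C <- enum {set edge} & `[< hamiltonian_cycle C >]].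

Lemma tour_vecsP x : reflect (exists2 C, hamiltonian_cycle C & x = char_vec R C) (x \in tour_vecs).
Proof.
apply: (iffP mapP) => [[C]|[C hC ->]].
  by rewrite mem_filter => /andP[/asboolP hC _] ->; exists C.
by exists C => //; rewrite mem_filter mem_enum andbT; exact/asboolP.
Qed.

Lemma TSPE : TSP R n = conv_hull [set` tour_vecs]%classic.
Proof.
congr conv_hull; apply/seteqP; split=> x /=.
  by move=> [C hC <-]; apply/tour_vecsP; exists C.
by move/tour_vecsP => [C hC ->]; exists C.
Qed.

Lemma edge_val_delta (S : {set V}) u v : u != v ->
  edge_val (char_vec R (delta S)) u v = ((u \in S) != (v \in S))%:R.
Proof.
move=> uv; have uv2 : #|[set u; v]%SET| == 2%N by rewrite cards2 uv.
rewrite /edge_val (insubT (fun e : {set V} => #|e| == 2%N) uv2) ffunE inE /=.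
congr (nat_of_bool _)%:R; rewrite finset.setIUl.
have I1 w : ([set w] :&: S = if w \in S then [set w] else finset.set0)%SET.
  apply/setP => x; rewrite !inE; case: (boolP (w \in S)) => wS; rewrite !inE; case: eqP => //= ->.
    by rewrite wS.
  by rewrite (negbTE wS).
rewrite !I1; case: (u \in S); case: (v \in S); rewrite ?finset.setU0 ?finset.set0U ?cards1 ?cards0//.
by rewrite cards2 uv.
Qed.

End Tours.

(** * Cuts of a tour *)

Section Cuts.
Context (n : nat) (z : 'I_n) (s : seq 'I_n).
Hypothesis ps : perm_eq s (offz z).
Let c := z :: s.
Implicit Types (S : {set 'I_n}) (v : 'I_n).

Definition cut_size S : nat := (\sum_v ((v \in S) != (next c v \in S)))%N.

Lemma next_tour_inj : injective (next c).
Proof. by apply: (can_inj (prev_next _)); exact: (tour_uniq ps). Qed.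

Lemma cut_size_even S : cut_size S = (2 * \sum_v ((v \in S) && (next c v \notin S)))%N.
Proof.
pose f v : nat := (v \in S) && (next c v \notin S).
pose b v : nat := (v \notin S) && (next c v \in S).
pose m v : nat := (v \in S) && (next c v \in S).
have e1 : (\sum_v (v \in S) = \sum_v f v + \sum_v m v)%N.
  rewrite -big_split/=; apply: eq_bigr => v _; rewrite /f /m.
  by case: (v \in S); case: (_ \in S).
have e2 : (\sum_v (v \in S) = \sum_v b v + \sum_v m v)%N.
  rewrite (reindex_inj next_tour_inj) -big_split/=; apply: eq_bigr => v _; rewrite /b /m.
  by case: (v \in S); case: (_ \in S).
have e3 : (cut_size S = \sum_v f v + \sum_v b v)%N.
  rewrite -big_split/=; apply: eq_bigr => v _; rewrite /f /b.
  by case: (v \in S); case: (_ \in S).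
rewrite e3 -/f; move: e1 e2; set x := (\sum_v f v)%N; set y := (\sum_v b v)%N.
by move=> -> /eqP; rewrite eqn_add2r => /eqP <-; rewrite mul2n addnn.
Qed.

(** If no edge left [S], then [S] would be closed under [next] and contain the whole cycle; evenness
    raises 1 to 2. *)
Lemma cut_size_ge2 S u v : u \in S -> v \notin S -> (2 <= cut_size S)%N.
Proof.
move=> uS vS; rewrite cut_size_even -[2%N]muln1 leq_mul2l /= lt0n; apply: contraNneq vS.
move/eqP; rewrite sum_nat_eq0 => /forallP h.
have step w : w \in S -> next c w \in S.
  by move=> wS; apply/negPn/negP => nS; move: (h w); rewrite wS nS.
have [i t rt] := rot_to (tour_full ps u).
have ut : uniq (u :: t) by rewrite -rt rot_uniq (tour_uniq ps).
have : path (frel (next c)) u t.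
  have := cycle_next ut; rewrite /= rcons_path => /andP[+ _].
  by apply: sub_path => x y; rewrite -rt /frel [X in is_true X -> _]/= next_rot ?(tour_uniq ps).
have : v \in u :: t by rewrite -rt mem_rot (tour_full ps).
elim: t u uS {rt ut} => [|x t IH] u uS /=; first by rewrite inE => /eqP -> .
rewrite inE => /orP[/eqP -> //|vt] /andP[/eqP ux pt].
by apply: (IH x) => //; rewrite -ux step.
Qed.

End Cuts.

Lemma sum_some_eq (I : finType) (x : option I) : (\sum_i (x == Some i) = (x != None))%N.
Proof.
case: x => [i|]; last by rewrite big1.
rewrite (bigD1 i)//= eqxx big1 ?addn0// => j ji.
by rewrite (inj_eq Some_inj) eq_sym (negbTE ji).
Qed.

Lemma sum_some_neq (I : finType) (x y : option I) :
  (\sum_i ((x == Some i) != (y == Some i)) =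
   if x == y then 0 else (x != None) + (y != None))%N.
Proof.
case: eqP => [->|/eqP xy]; first by rewrite big1// => i _; rewrite eqxx.
rewrite -!sum_some_eq -big_split/=; apply: eq_bigr => i _.
by case: (x =P Some i) => [xi|_]; case: (y =P Some i) => [yi|_] //; rewrite xi yi eqxx in xy.
Qed.

(** * Combs with one free handle vertex are facets *)

Section Comb.
Context (R : realType) (n k : nat) (H : {set 'I_n}) (T : 'I_k -> {set 'I_n}) (z : 'I_n).
Hypothesis combHT : is_comb H T.
Hypothesis Tout : forall i, (T i :\: H != finset.set0)%SET.
Hypothesis zE : (H :\: \bigcup_i T i = [set z])%SET.

Definition hd (v : 'I_n) : bool := v \in H.
Definition th (v : 'I_n) : option 'I_k := [pick i | v \in T i].

Lemma thP v i : (th v == Some i) = (v \in T i).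
Proof.
rewrite /th; case: pickP => [j vj|none]; last by rewrite none.
rewrite (inj_eq Some_inj); apply/eqP/idP => [<- //|vi].
case: combHT => _ _ dis _; apply/eqP; apply: contraT => ji.
have /eqP/setP/(_ v) := dis j i ji.
by rewrite !inE vj vi.
Qed.

Lemma th_None v : (th v == None) = (v \notin \bigcup_i T i)%SET.
Proof.
apply/eqP/negP => [tv /finset.bigcupP[i _ vi]|no].
  by move: vi; rewrite -thP tv.
case tv : (th v) => [i|//]; exfalso; apply: no; apply/finset.bigcupP; exists i => //.
by rewrite -thP tv.
Qed.

Lemma reg_z v : (reg hd th v == rZ 'I_k) = (v == z).
Proof.
rewrite xpair_eqE /= th_None eqb_id.
have -> : (v == z) = (v \in [set z]%SET) by rewrite inE.
by rewrite -zE inE andbC.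
Qed.

Lemma reg_A i : exists v, reg hd th v = rA i.
Proof.
case: combHT => _ HT _ _; have /finset.set0Pn[v] := HT i; rewrite inE => /andP[vH vT].
by exists v; rewrite /reg /hd vH /rA; congr (_, _); apply/eqP; rewrite thP.
Qed.

Lemma reg_D i : exists v, reg hd th v = rD i.
Proof.
have /finset.set0Pn[v] := Tout i; rewrite inE => /andP[/negbTE vH vT].
by exists v; rewrite /reg /hd vH /rD; congr (_, _); apply/eqP; rewrite thP.
Qed.

Lemma comb_coef_cuts u v : comb_coef (reg hd th u) (reg hd th v) =
  (((u \in H) != (v \in H)) + \sum_i ((u \in T i) != (v \in T i)))%N.
Proof.
rewrite /comb_coef /= -sum_some_neq; congr (_ + _)%N.
by apply: eq_bigr => i _; rewrite -!thP.
Qed.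

Notation ccost := (ccost R hd th).

Lemma dot_char_tour (S : {set 'I_n}) s : (3 <= n)%N -> perm_eq s (offz z) ->
  dot (char_vec R (delta S)) (char_vec R (tour_edges (z :: s))) = (cut_size z s S)%:R.
Proof.
move=> n3 ps; rewrite (dot_tour ps n3) -(sum_next _ (tour_uniq ps)) (perm_big _ (perm_tour ps)) big_enum/=.
rewrite natr_sum; apply: eq_bigr => v _; rewrite edge_val_delta//.
have s3 : (3 <= size (z :: s))%N by rewrite (size_tour ps).
by have [+ _] := next_neq2 (tour_uniq ps) (tour_full ps v) s3; rewrite eq_sym.
Qed.

Lemma dot_comb_cuts s : (3 <= n)%N -> perm_eq s (offz z) ->
  dot (comb_ineq R H T).1 (char_vec R (tour_edges (z :: s))) =
  (cut_size z s H + \sum_i cut_size z s (T i))%:R.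
Proof.
move=> n3 ps; rewrite /comb_ineq /= dotDl dot_char_tour// natrD; congr (_ + _).
rewrite natr_sum; elim/big_rec2: _ => [|i x y _ <-]; first by rewrite dot0l.
by rewrite dotDl dot_char_tour.
Qed.

Lemma dot_comb s : (3 <= n)%N -> perm_eq s (offz z) ->
  dot (comb_ineq R H T).1 (char_vec R (tour_edges (z :: s))) = cycost ccost z s.
Proof.
move=> n3 ps; rewrite dot_comb_cuts// -(sum_next _ (tour_uniq ps)) (perm_big _ (perm_tour ps)) big_enum/=.
rewrite /cut_size exchange_big/= -big_split/= natr_sum; apply: eq_bigr => v _.
by rewrite /ccost comb_coef_cuts.
Qed.

(** The cuts of [T i], [T i :&: H] and [T i :\: H] are at least 2 each; half their sum is the cut of
    [T i] plus the number [x i] of tour edges inside [T i] that cross the handle, hence at least 3.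
    The [x i] count distinct edges in the cut of [H], so the total is at least 3k, and parity raises
    it by 1. *)
Lemma comb_bound s : (3 <= n)%N -> perm_eq s (offz z) ->
  (3 * k + 1 <= cut_size z s H + \sum_i cut_size z s (T i))%N.
Proof.
move=> n3 ps; pose nx := next (z :: s).
pose x i := (\sum_v [&& v \in T i, nx v \in T i & (v \in H) != (nx v \in H)])%N.
have zT i : z \notin T i.
  apply/negP => zi; have : z \in [set z]%SET by rewrite inE.
  by rewrite -zE inE => /andP[/finset.bigcupP[]]; exists i.
have AD i : (cut_size z s (T i :&: H) + cut_size z s (T i :\: H) = cut_size z s (T i) + 2 * x i)%N.
  rewrite /cut_size big_distrr -!big_split/=; apply: eq_bigr => v _; rewrite !inE -/nx.
  by case: (v \in T i); case: (nx v \in T i); case: (v \in H); case: (nx v \in H).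
have tooth i : (3 <= cut_size z s (T i) + x i)%N.
  have [a] := reg_A i; have [d] := reg_D i; move=> [dH dT] [aH aT].
  have {}dT : d \in T i by rewrite -thP dT.
  have {}aT : a \in T i by rewrite -thP aT.
  rewrite /hd in aH dH.
  have c1 : (2 <= cut_size z s (T i))%N by apply: (cut_size_ge2 ps aT (zT i)).
  have c2 : (2 <= cut_size z s (T i :&: H))%N.
    by apply: (@cut_size_ge2 _ _ _ ps _ a z); rewrite !inE ?aT ?aH// (negbTE (zT i)).
  have c3 : (2 <= cut_size z s (T i :\: H))%N.
    by apply: (@cut_size_ge2 _ _ _ ps _ d z); rewrite !inE ?dT ?dH// (negbTE (zT i)) andbF.
  by move: (AD i); lia.
have xH : (\sum_i x i <= cut_size z s H)%N.
  rewrite /x exchange_big/=; apply: leq_sum => v _; rewrite -/nx.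
  case: ((v \in H) != (nx v \in H)); last by rewrite big1// => i _; rewrite !andbF.
  apply: (@leq_trans (\sum_i (th v == Some i))); last by rewrite sum_some_eq leq_b1.
  by apply: leq_sum => i _; rewrite thP; case: (v \in T i) => //; exact: leq_b1.
have lb : (3 * k <= cut_size z s H + \sum_i cut_size z s (T i))%N.
  apply: (@leq_trans (\sum_i (cut_size z s (T i) + x i))).
    by rewrite -[X in (_ * X)%N]card_ord -[(3 * _)%N]mulnC -sum_nat_const; exact: leq_sum.
  by rewrite big_split/= addnC leq_add2r.
have ev : ~~ odd (cut_size z s H + \sum_i cut_size z s (T i)).
  have evS S : odd (cut_size z s S) = false by rewrite (cut_size_even ps) oddM.
  by rewrite oddD evS; elim/big_ind: _ => // [a b|i _]; [rewrite oddD; case: odd; case: odd|rewrite evS].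
case: combHT => -[_ ok] _ _ _.
rewrite addn1 ltn_neqAle lb andbT; apply: contraNneq ev => <-.
by rewrite oddM ok.
Qed.

Lemma comb_facet : (3 <= n)%N ->
  (forall u, exists2 v, v != u & reg hd th v = rO 'I_k) ->
  facet_defining (TSP R n) (comb_ineq R H T).
Proof.
move=> n3 O2; rewrite TSPE; apply: facet_on_facet_defining.
have [[k3 ok] _ _ _] := combHT.
have I3 : (3 <= #|'I_k|)%N by rewrite card_ord.
have oI : odd #|'I_k| by rewrite card_ord.
have tour s : perm_eq s (offz z) -> char_vec R (tour_edges (z :: s)) \in tour_vecs R n.
  by move=> ps; apply/tour_vecsP; exists (tour_edges (z :: s)) => //; exact: hamiltonian_tour.
have tours v : v \in tour_vecs R n -> exists2 s, perm_eq s (offz z) & v = char_vec R (tour_edges (z :: s)).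
  by move=> /tour_vecsP[C /(hamiltonian_cycleP z)[_ [s ps ->]] ->]; exists s.
have slackE s : perm_eq s (offz z) ->
    slack (comb_ineq R H T) (char_vec R (tour_edges (z :: s))) = cycost ccost z s - (3 * #|'I_k| + 1)%:R.
  by move=> ps; rewrite /slack dot_comb// card_ord.
have [s0 [s1 [ps0 ps1 c0 c1]]] := exists_tight_and_loose R reg_z reg_A reg_D I3 oI O2.
split.
- move=> v /tours[s ps ->]; rewrite /slack dot_comb_cuts// subr_ge0 ler_nat.
  exact: comb_bound.
- by exists (char_vec R (tour_edges (z :: s0))); rewrite ?tour ?slackE ?c0 ?subrr.
- exists (char_vec R (tour_edges (z :: s1))); rewrite ?tour ?slackE ?c1//.
  by rewrite addrC addKr.
move=> g gt.
(* The coefficients of [g] are edge weights that are constant on tight tours; the tight tour [s0]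
   then fixes the additive constant. *)
have [|k0 kE] := @comb_tours_proportional R _ _ z hd th reg_z reg_A reg_D (edge_val g.1)
    (edge_valC g.1) _ I3 oI O2.
  move=> s s' ps ps' cs cs'; rewrite -!dot_tour//.
  have tz t : perm_eq t (offz z) -> cycost ccost z t = (3 * #|'I_k| + 1)%:R ->
      dot g.1 (char_vec R (tour_edges (z :: t))) = g.2.
    move=> pt ct; apply/eqP; rewrite -subr_eq0; apply/eqP; apply: gt; first exact: tour.
    by rewrite slackE// ct subrr.
  by rewrite !tz.
exists k0 => v /tours[s ps ->].
have g0 : slack g (char_vec R (tour_edges (z :: s0))) = 0.
  by apply: gt; rewrite ?tour ?slackE ?c0 ?subrr.
rewrite slackE// -c0 -kE// -!dot_tour//; move: g0; rewrite /slack; lra.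
Qed.

End Comb.

(** * The matching slack matrix *)

(** With l = e / 2, this is exp(-l) <= 1 / (1 + l) <= 1 - l + l^2. *)
Lemma expR_tilt (R : realType) (e : R) : 0 <= e ->
  e / 2 * (1 - e) - (1 - expR (- (e / 2))) <= - (e ^+ 2 / 4).
Proof.
move=> e0; set l := e / 2; have -> : e = 2 * l by rewrite /l; field.
have l0 : 0 <= l by rewrite /l; lra.
have h : expR (- l) <= (1 + l)^-1.
  by rewrite expRN lef_pV2 ?posrE ?expR_gt0 ?expR_ge1Dx//; lra.
have h2 : (1 + l)^-1 <= 1 - l + l ^+ 2.
  rewrite -[leLHS]mul1r ler_pdivrMr; last by lra.
  suff : 0 <= l ^+ 3 by rewrite !exprS expr0; nra.
  exact: exprn_ge0.
move: h h2; rewrite !expr2; nra.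
Qed.

(* A weight that is scarce at [w j] for every [j] in [B] favours configurations which
   meet [w] less often than a uniform one, so its mass is bounded as in Chernoff's
   inequality. *)
Lemma tilt_bound (R : realType) (J Om : finType) (G : {ffun J -> Om} -> R)
    (B : {set J}) (w : J -> Om) (e : R) :
  0 <= e -> (0 < #|Om|)%N -> (forall x, 0 <= G x <= 1) ->
  (forall j, j \in B ->
     #|Om|%:R * \sum_(x : {ffun J -> Om} | x j == w j) G x <= (1 - e) * \sum_x G x) ->
  \sum_x G x <= #|Om|%:R ^+ #|J| * expR (- (e ^+ 2 / 4 * (#|B|%:R / #|Om|%:R))).
Proof.
move=> e0 Om0 G01 Gw; set N := #|Om|%:R; have N0 : 0 < N :> R by rewrite ltr0n.
set S := \sum_x G x; set l := e / 2; set m := (1 - e) * (#|B|%:R / N).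
have l0 : 0 <= l by rewrite /l; lra.
pose cnt (x : {ffun J -> Om}) : R := \sum_(j in B) (x j == w j)%:R.
have cntS : \sum_x G x * cnt x <= m * S.
  under eq_bigr do rewrite mulr_sumr.
  rewrite exchange_big /=.
  apply: (@le_trans _ _ (\sum_(j in B) (1 - e) * S / N)).
    apply: ler_sum => j jB; rewrite ler_pdivlMr// mulrC.
    have -> : \sum_i G i * (i j == w j)%:R = \sum_(x : {ffun J -> Om} | x j == w j) G x.
      by rewrite [RHS]big_mkcond; apply: eq_bigr => x _; case: eqP; rewrite ?mulr1 ?mulr0.
    exact: Gw.
  by rewrite sumr_const /m -[leLHS]mulr_natr; lra.
(* Under the weight [G] the mean of [cnt] is at most [m], so the factor 1 - l (cnt - m) does not
   lower the sum, and the exponential dominates it. *)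
have S1 : S <= \sum_x G x * expR (- (l * (cnt x - m))).
  apply: (@le_trans _ _ (\sum_x G x * (1 - l * (cnt x - m)))).
    have -> : \sum_x G x * (1 - l * (cnt x - m)) =
      S + l * (m * S - \sum_x G x * cnt x).
      rewrite /S !mulr_sumr -sumrB mulr_sumr -big_split/=.
      by apply: eq_bigr => x _; ring.
    by rewrite lerDl mulr_ge0// subr_ge0.
  apply: ler_sum => x _; case/andP: (G01 x) => Gx0 _.
  by rewrite ler_wpM2l// expR_ge1Dx.
pose h (j : J) (a : Om) : R := if (j \in B) && (a == w j) then expR (- l) else 1.
(* Now [G] is bounded by 1, and what remains factors over the coordinates. *)
have S2 : S <= expR (l * m) * \prod_j \sum_a h j a.
  apply: le_trans S1 _; rewrite bigA_distr_bigA mulr_sumr; apply: ler_sum => x _.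
  have -> : \prod_i h i (x i) = expR (- (l * cnt x)).
    rewrite -mulNr /cnt mulr_sumr expR_sum [RHS]big_mkcond; apply: eq_bigr => j _.
    rewrite /h; case: (j \in B) => //=; case: eqP => _; rewrite ?mulr1// mulr0 expR0//.
  rewrite -expRD -[leRHS]mul1r; case/andP: (G01 x) => _ Gx1.
  have -> : l * m - l * cnt x = - (l * (cnt x - m)) by ring.
  by rewrite ler_wpM2r// expR_ge0.
have S3 : \prod_j \sum_a h j a <= N ^+ #|J| * expR (- (1 - expR (- l)) / N) ^+ #|B|.
  have -> : N ^+ #|J| * expR (- (1 - expR (- l)) / N) ^+ #|B| =
     \prod_j (N * (if j \in B then expR (- (1 - expR (- l)) / N) else 1)).
    rewrite big_split/= prodr_const; congr (_ * _).
    by rewrite -big_mkcond/= prodr_const.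
  apply: ler_prod => j _; apply/andP; split.
    by apply: sumr_ge0 => a _; rewrite /h; case: ifP => // _; rewrite expR_ge0.
  rewrite /h; case: (boolP (j \in B)) => jB /=; last by rewrite sumr_const mulr1.
  have -> : \sum_a (if a == w j then expR (- l) else 1) = N * (1 + (- (1 - expR (- l)) / N)).
    rewrite (bigD1 (w j))//= eqxx.
    rewrite (eq_bigr (fun=> 1)) => [|a /negbTE->//].
    rewrite sumr_const (@eq_card _ _ (predC1 (w j)))//.
    have := cardC1 (w j); rewrite -/N => ->.
    have -> : (#|Om|.-1)%:R = N - 1 :> R by rewrite -subn1 natrB.
    by field; rewrite gt_eqF.
  by rewrite ler_wpM2l ?(ltW N0)// expR_ge1Dx.
apply: (le_trans S2); apply: (@le_trans _ _ (expR (l * m) * (N ^+ #|J| * expR (- (1 - expR (- l)) / N) ^+ #|B|))).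
  by rewrite ler_wpM2l// expR_ge0.
rewrite mulrCA ler_wpM2l ?exprn_ge0 ?(ltW N0)// -expRM_natl -expRD ler_expR.
have := expR_tilt e0; rewrite -/l => H.
set b := #|B|%:R / N; have b0 : 0 <= b by rewrite /b divr_ge0// ltW.
have -> : l * m + #|B|%:R * (- (1 - expR (- l)) / N) = (l * (1 - e) - (1 - expR (- l))) * b.
  by rewrite /m /b; field; rewrite gt_eqF.
by rewrite -[leRHS]mulNr ler_wpM2r.
Qed.

(** * Skewed coordinates of a function on a product *)

Section Exchange.
Context (R : realType) (I W : finType).
Notation J := (option I).
Notation Om := (bool * W)%type.
Notation config := {ffun J -> Om}.
Implicit Types (G : config -> R) (j : J).

Definition lo_at j G : R := \sum_(Y : config | ~~ (Y j).1) G Y.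
Definition hi_at j G : R := \sum_(Y : config | (Y j).1) G Y.
(** If no value falls below 9/10 of its uniform share, each half keeps at least 9/20 of the mass, so
    that low to high is at most 11 to 9. *)
Definition skew_at j G : bool :=
  [exists w, #|{: Om}|%:R * (\sum_(Y : config | Y j == w) G Y) < 9 / 10 * \sum_Y G Y].

Definition moved j (Y : config) : config := [ffun i => Y (tperm None j i)].

Lemma movedK j : involutive (moved j).
Proof. by move=> Y; apply/ffunP => i; rewrite !ffunE tpermK. Qed.

Lemma moved_None j Y : moved j Y None = Y j.
Proof. by rewrite ffunE tpermL. Qed.

Lemma lo_moved j G : lo_at None (G \o moved j) = lo_at j G.
Proof.
rewrite /lo_at (reindex_inj (inv_inj (movedK j))).
by apply: eq_big => Y; rewrite ?moved_None//= movedK.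
Qed.

Lemma skew_moved j G : skew_at None (G \o moved j) = skew_at j G.
Proof.
apply: eq_existsb => w; congr (_ * _ < _ * _).
  rewrite (reindex_inj (inv_inj (movedK j))).
  by apply: eq_big => Y; rewrite ?moved_None//= movedK.
by rewrite (reindex_inj (inv_inj (movedK j))); apply: eq_bigr => Y _ /=; rewrite movedK.
Qed.

Lemma lohiE j G : \sum_Y G Y = lo_at j G + hi_at j G.
Proof. by rewrite (bigID (fun Y : config => (Y j).1))/= addrC. Qed.

Lemma half_sumE j G b : \sum_(Y : config | (Y j).1 == b) G Y =
  \sum_w \sum_(Y : config | Y j == (b, w)) G Y.
Proof.
by rewrite (partition_big (fun Y : config => (Y j).2) xpredT).
Qed.

Lemma half_ge j G b : ~~ skew_at j G ->
  9 / 20 * \sum_Y G Y <= \sum_(Y : config | (Y j).1 == b) G Y.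
Proof.
move=> /existsPn ns; rewrite half_sumE.
case: (posnP #|W|) => [W0|W0].
  rewrite [X in _ * X <= _]big1 ?mulr0 => [|Y _].
    by rewrite big1// => w _; have := @card0_eq _ _ W0 w; rewrite inE.
  by have := @card0_eq _ _ W0 (Y None).2; rewrite inE.
have W0' : 0 < #|W|%:R :> R by rewrite ltr0n.
have -> : 9 / 20 * \sum_Y G Y = \sum_(w : W) (9 / 10 * (\sum_Y G Y) / (2 * #|W|%:R)).
  by rewrite sumr_const -[RHS]mulr_natr; field; rewrite gt_eqF.
apply: ler_sum => w _; have := ns (b, w); rewrite -leNgt card_prod card_bool natrM => H.
by rewrite ler_pdivrMr ?mulr_gt0//; lra.
Qed.

Lemma lo_hi_ratio j G : ~~ skew_at j G -> 9 * lo_at j G <= 11 * hi_at j G.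
Proof.
move=> ns; have := half_ge true ns; rewrite (lohiE j).
have -> : \sum_(Y : config | (Y j).1 == true) G Y = hi_at j G.
  by apply: eq_bigl => Y; rewrite eqb_id.
lra.
Qed.

(** If at most 1/50 of the coordinates are skewed, the others outweigh them, as 1/20 * 49/50 * 9/20
    > 1/50. Otherwise [tilt_bound] makes the whole mass exponentially small. *)
Lemma sum_skew_lo G : (0 < #|W|)%N -> (forall Y, 0 <= G Y <= 1) ->
  \sum_(j | skew_at j G) lo_at j G <= 1 / 20 * (\sum_j lo_at j G) +
   #|{: J}|%:R * (#|{: Om}|%:R ^+ #|{: J}| * expR (- (#|{: J}|%:R / #|{: Om}|%:R / 100 / 200))).
Proof.
move=> W0 G01; set N := #|{: Om}|%:R; set n := #|{: J}|%:R; set S := \sum_Y G Y.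
have N0 : 0 < N :> R by rewrite ltr0n card_prod card_bool muln_gt0.
have n0 : 0 < n :> R by rewrite ltr0n card_option.
have G0 Y : 0 <= G Y by case/andP: (G01 Y).
have S0 : 0 <= S by apply: sumr_ge0.
have loS j : 0 <= lo_at j G <= S.
  rewrite /S (lohiE j); have : 0 <= lo_at j G by apply: sumr_ge0.
  have : 0 <= hi_at j G by apply: sumr_ge0.
  by move=> ? ?; apply/andP; lra.
have Snonneg : 0 <= \sum_j lo_at j G by apply: sumr_ge0 => j _; case/andP: (loS j).
set t := N ^+ _ * _; have t0 : 0 <= t by rewrite mulr_ge0 ?expR_ge0// exprn_ge0// ltW.
pose B := [set j | skew_at j G].
have sumB : \sum_(j | skew_at j G) lo_at j G <= #|B|%:R * S.
  apply: (@le_trans _ _ (\sum_(j in B) S)).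
    rewrite [leRHS](eq_bigl (fun j => skew_at j G)); last by move=> j; rewrite inE.
    by apply: ler_sum => j _; case/andP: (loS j).
  by rewrite sumr_const -[leLHS]mulr_natr mulrC.
have Bn : #|B|%:R <= n by rewrite ler_nat max_card.
case: (leP (50 * #|B|%:R) n) => Bsmall.
  have big : (49 / 50 * n) * (9 / 20 * S) <= \sum_j lo_at j G.
    rewrite (bigID (fun j => skew_at j G))/=.
    apply: (@le_trans _ _ (0 + \sum_(j | ~~ skew_at j G) (9 / 20 * S))); last first.
      apply: lerD; first by apply: sumr_ge0 => j _; case/andP: (loS j).
      apply: ler_sum => j ns; apply: le_trans (half_ge false ns) _.
      by rewrite le_eqVlt; apply/orP; left; apply/eqP/eq_bigl => Y; rewrite eqbF_neg.
    rewrite add0r sumr_const -[leRHS]mulr_natr mulrC ler_wpM2l//; first by lra.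
    have -> : #|[pred j | ~~ skew_at j G]| = (#|{: J}| - #|B|)%N.
      by rewrite -(cardC B) addKn; apply: eq_card => j; rewrite !inE.
    by rewrite natrB ?max_card// -/n; lra.
  apply: (le_trans sumB); have : #|B|%:R * S <= n / 50 * S by rewrite ler_wpM2r//; lra.
  have := mulr_ge0 (ltW n0) t0; have : 0 <= n * S by rewrite mulr_ge0// ltW.
  by move=> *; lra.
have Ssmall : S <= t.
  have wit (j : J) : exists w, (j \in B) ==> (N * \sum_(Y : config | Y j == w) G Y < 9 / 10 * S).
    case: (boolP (j \in B)) => jB /=; last first.
      by case/card_gt0P : W0 => a _; exists (true, a).
    by move: jB; rewrite inE => /existsP.
  have [w wP] := fin_all_exists wit.
  (* With e = 1/10, e^2 / 4 is 1/400; times more than 1/50 of the coordinates, it gives the divisor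
     20000 = 100 * 200. *)
  have e0 : 0 <= 1 / 10 :> R by lra.
  have Om0 : (0 < #|{: Om}|)%N by rewrite card_prod card_bool muln_gt0.
  have h j : j \in B -> #|{: Om}|%:R * \sum_(x : config | x j == w j) G x <= (1 - 1 / 10) * \sum_x G x.
    move=> jB; have := wP j; rewrite jB /= => /ltW; rewrite -/N -/S.
    by have -> : 1 - 1 / 10 = 9 / 10 :> R by field.
  apply: le_trans (tilt_bound e0 Om0 G01 h) _.
  rewrite -/N ler_wpM2l ?exprn_ge0 ?(ltW N0)// ler_expR lerN2.
  have : n / N <= 50 * (#|B|%:R / N) by rewrite mulrA ler_wpM2r ?invr_ge0// ltW.
  by rewrite expr2; lra.
apply: (le_trans sumB).
have : #|B|%:R * S <= n * t by rewrite ler_pM// ?ler0n.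
by move=> *; lra.
Qed.

(* Averaging over [s] lets every coordinate play the role of [None], and only few
   coordinates can be skewed. *)
Lemma exchange (X : finType) (G : X -> config -> R) (s : J -> X -> X) (K : X -> R) (b : R) :
  (0 < #|W|)%N -> (forall x Y, 0 <= G x Y <= 1) -> (forall j, injective (s j)) ->
  (forall j x Y, G (s j x) Y = G x (moved j Y)) ->
  (forall j x, K (s j x) = K x) -> (forall x, 0 <= K x <= b) ->
  \sum_(x | skew_at None (G x)) lo_at None (G x) * K x <=
  1 / 20 * (\sum_x lo_at None (G x) * K x) +
   #|X|%:R * (#|{: Om}|%:R ^+ #|{: J}| * expR (- (#|{: J}|%:R / #|{: Om}|%:R / 100 / 200))) * b.
Proof.
move=> W0 G01 sI Gs Ks Kb; set t := _ ^+ _ * expR _.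
have t0 : 0 <= t by rewrite mulr_ge0 ?expR_ge0// exprn_ge0.
have n0 : 0 < #|{: J}|%:R :> R by rewrite ltr0n card_option.
have GE j x : G (s j x) = G x \o moved j by apply/funext => Y; rewrite Gs.
have avgE (F : X -> R) : #|{: J}|%:R * \sum_x F x = \sum_x \sum_j F (s j x).
  rewrite exchange_big /= mulr_natl -sumr_const; apply: eq_bigr => j _.
  by rewrite (reindex_inj (sI j)).
rewrite -(ler_pM2l n0) mulrDr mulrCA [\sum_(x | _) _]big_mkcond/= !avgE.
have -> : #|{: J}|%:R * (#|X|%:R * t * b) = \sum_(x : X) (#|{: J}|%:R * t) * b.
  by rewrite sumr_const -[RHS]mulr_natr; ring.
rewrite mulr_sumr -big_split/=; apply: ler_sum => x _.
have -> : \sum_j (if skew_at None (G (s j x)) then lo_at None (G (s j x)) * K (s j x) else 0) =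
   (\sum_(j | skew_at j (G x)) lo_at j (G x)) * K x.
  rewrite mulr_suml [RHS]big_mkcond/=; apply: eq_bigr => j _.
  by rewrite GE skew_moved lo_moved Ks.
have -> : \sum_j lo_at None (G (s j x)) * K (s j x) = (\sum_j lo_at j (G x)) * K x.
  by rewrite mulr_suml; apply: eq_bigr => j _; rewrite GE lo_moved Ks.
case/andP: (Kb x) => K0 Kb'.
have := sum_skew_lo W0 (G01 x); rewrite -/t => H.
apply: (le_trans (ler_wpM2r K0 H)); rewrite mulrDl -[1 / 20 * _ * _]mulrA lerD2l.
by rewrite ler_wpM2l// mulr_ge0// ltW.
Qed.

End Exchange.

(** * The Fano plane *)

Lemma all_ord n (P : pred nat) : all P (iota 0 n) -> forall i : 'I_n, P i.
Proof. by move=> /allP aP i; apply: aP; rewrite mem_iota add0n ltn_ord. Qed.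

Lemma card_ord_count n (P : pred nat) : #|[set i : 'I_n | P i]%SET| = count P (iota 0 n).
Proof. by rewrite cardsE cardE size_filter -val_enum_ord count_map -enumT. Qed.

(* The lines of the Fano plane, and their complements. *)
Definition fano_lines : seq (seq nat) :=
  [:: [:: 0; 1; 2]; [:: 0; 3; 4]; [:: 0; 5; 6]; [:: 1; 3; 5]; [:: 1; 4; 6];
      [:: 2; 3; 6]; [:: 2; 4; 5]]%N.
Definition fano_colines : seq (seq nat) :=
  [seq [seq l <- iota 0 7 | l \notin s] | s <- fano_lines].
Definition pairings4 : seq (seq nat) :=
  [:: [:: 1; 0; 3; 2]; [:: 2; 3; 0; 1]; [:: 3; 2; 1; 0]]%N.

(** The tables live on [nat], where they compute; [all_ord] reduces each fact about ordinals to a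
    finite Boolean check. *)
Definition on_line_nat (H l : nat) : bool := l \in nth [::] fano_lines H.
Definition off_pt_nat (H i : nat) : nat := nth 0%N (nth [::] fano_colines H) i.
Definition off_idx_nat (H l : nat) : nat := index l (nth [::] fano_colines H).
Definition pairing_nat (w i : nat) : nat := nth 0%N (nth [::] pairings4 w) i.

Definition on_line (H l : 'I_7) : bool := on_line_nat H l.
Definition off_pt (H : 'I_7) (i : 'I_4) : 'I_7 := inord (off_pt_nat H i).
Definition off_idx (H l : 'I_7) : 'I_4 := inord (off_idx_nat H l).
Definition pairing (w : 'I_3) (i : 'I_4) : 'I_4 := inord (pairing_nat w i).

Lemma val_off_pt H i : val (off_pt H i) = off_pt_nat H i.
Proof.
rewrite /off_pt /= inordK//; apply: (@all_ord 4 (fun i => off_pt_nat H i < 7)%N).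
by apply: (@all_ord 7 (fun H => all (fun i => off_pt_nat H i < 7) (iota 0 4))%N).
Qed.

Lemma val_off_idx H l : ~~ on_line H l -> val (off_idx H l) = off_idx_nat H l.
Proof.
move=> Hl; rewrite /off_idx /= inordK//; move: Hl; apply/implyP.
apply: (@all_ord 7 (fun l => ~~ on_line_nat H l ==> (off_idx_nat H l < 4))%N).
by apply: (@all_ord 7 (fun H => all (fun l => ~~ on_line_nat H l ==> (off_idx_nat H l < 4)) (iota 0 7))%N).
Qed.

Lemma val_pairing w i : val (pairing w i) = pairing_nat w i.
Proof.
rewrite /pairing /= inordK//; apply: (@all_ord 4 (fun i => pairing_nat w i < 4)%N).
by apply: (@all_ord 3 (fun w => all (fun i => pairing_nat w i < 4) (iota 0 4))%N).
Qed.

Lemma off_pt_off H i : ~~ on_line H (off_pt H i).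
Proof.
rewrite /on_line val_off_pt.
apply: (@all_ord 4 (fun i => ~~ on_line_nat H (off_pt_nat H i))%N).
by apply: (@all_ord 7 (fun H => all (fun i => ~~ on_line_nat H (off_pt_nat H i)) (iota 0 4))%N).
Qed.

Lemma off_ptK H i : off_idx H (off_pt H i) = i.
Proof.
apply/val_inj; rewrite val_off_idx ?off_pt_off// val_off_pt; apply/eqP.
apply: (@all_ord 4 (fun i => off_idx_nat H (off_pt_nat H i) == i)%N).
by apply: (@all_ord 7 (fun H => all (fun i => off_idx_nat H (off_pt_nat H i) == i) (iota 0 4))%N).
Qed.

Lemma off_idxK H l : ~~ on_line H l -> off_pt H (off_idx H l) = l.
Proof.
move=> Hl; apply/val_inj; rewrite val_off_pt val_off_idx//; apply/eqP; move: Hl; apply/implyP.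
apply: (@all_ord 7 (fun l => ~~ on_line_nat H l ==> (off_pt_nat H (off_idx_nat H l) == l))%N).
by apply: (@all_ord 7 (fun H => all (fun l => ~~ on_line_nat H l ==> (off_pt_nat H (off_idx_nat H l) == l)) (iota 0 7))%N).
Qed.

Lemma pairingK w : involutive (pairing w).
Proof.
move=> i; apply/val_inj; rewrite !val_pairing; apply/eqP.
apply: (@all_ord 4 (fun i => pairing_nat w (pairing_nat w i) == i)%N).
by apply: (@all_ord 3 (fun w => all (fun i => pairing_nat w (pairing_nat w i) == i) (iota 0 4))%N).
Qed.

Lemma pairing_neq w i : pairing w i != i.
Proof.
rewrite -val_eqE /= val_pairing.
apply: (@all_ord 4 (fun i => pairing_nat w i != i)%N).
by apply: (@all_ord 3 (fun w => all (fun i => pairing_nat w i != i) (iota 0 4))%N).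
Qed.

Lemma card_line H : #|[set l | on_line H l]%SET| = 3%N.
Proof.
rewrite (card_ord_count 7 (on_line_nat H)); apply/eqP.
by apply: (@all_ord 7 (fun H => count (on_line_nat H) (iota 0 7) == 3)%N).
Qed.

(* Two lines H <> H' meet in one point, and some pairing of the complement of H'
   matches the other two points of H together. *)
Lemma fano_conflict H H' : H != H' -> exists w,
  #|[set l | on_line H l && (on_line H' l ||
       ~~ on_line H (off_pt H' (pairing w (off_idx H' l))))]%SET| = 1%N.
Proof.
move=> HH; pose P w l := on_line_nat H l && (on_line_nat H' l ||
  ~~ on_line_nat H (off_pt_nat H' (pairing_nat w (off_idx_nat H' l)))).
have : has (fun w => count (P w) (iota 0 7) == 1%N) (iota 0 3).
  move: HH; rewrite -val_eqE /=; apply/implyP; rewrite /P.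
  pose Q H H' := (H != H') ==> has (fun w => count (fun l =>
    on_line_nat H l && (on_line_nat H' l ||
    ~~ on_line_nat H (off_pt_nat H' (pairing_nat w (off_idx_nat H' l))))) (iota 0 7) == 1%N) (iota 0 3).
  apply: (@all_ord 7 (Q H)).
  by apply: (@all_ord 7 (fun H => all (Q H) (iota 0 7))); vm_compute.
case/hasP => w; rewrite mem_iota /= => w3 /eqP Pw; exists (Ordinal w3).
apply: etrans (etrans (card_ord_count 7 (P w)) Pw); apply: eq_card => l; rewrite !inE /P.
rewrite -/(on_line H l) -/(on_line H' l); congr (_ && _).
by case: (boolP (on_line H' l)) => //= Hl; rewrite /on_line val_off_pt val_pairing val_off_idx.
Qed.

Definition involution_without_fixpoint (V : finType) (M : {ffun V -> V}) : bool :=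
  [forall v, (M (M v) == v) && (M v != v)].

Definition cross (V : finType) (U : {set V}) (M : {ffun V -> V}) : nat :=
  #|[set v in U | M v \notin U]%SET|.

Definition conj_by (V : finType) (p : {perm V}) (M : {ffun V -> V}) : {ffun V -> V} :=
  [ffun v => p (M ((p^-1)%g v))].

Lemma conj_by_mul (V : finType) (s p : {perm V}) M :
  conj_by (s * p)%g M = conj_by p (conj_by s M).
Proof. by apply/ffunP => v; rewrite !ffunE invMg !permM. Qed.

Lemma cross_conj (V : finType) (p : {perm V}) (U : {set V}) (M : {ffun V -> V}) :
  cross (p @: U)%SET (conj_by p M) = cross U M.
Proof.
rewrite /cross -[RHS](card_imset _ (@perm_inj _ p)); apply: eq_card => v.
rewrite !inE; apply/andP/imsetP => [[/imsetP[u uU ->]]|[u]].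
  rewrite ffunE permK (mem_imset _ _ (@perm_inj _ p)) => Mu.
  by exists u; rewrite // inE uU.
by rewrite inE => /andP[uU Mu ->]; rewrite ffunE permK !(mem_imset _ _ (@perm_inj _ p)).
Qed.

Lemma conj_by_fpf (V : finType) (p : {perm V}) (M : {ffun V -> V}) :
  involution_without_fixpoint M -> involution_without_fixpoint (conj_by p M).
Proof.
move/forallP => h; apply/forallP => v; rewrite !ffunE permK.
have /andP[/eqP -> Mv] := h ((p^-1)%g v); rewrite permKV eqxx /=.
by rewrite -[X in _ != X](permKV p) (inj_eq (@perm_inj _ p)).
Qed.

Lemma imset_permM (V : finType) (s p : {perm V}) (U : {set V}) :
  ((s * p)%g @: U = p @: (s @: U))%SET.
Proof. by rewrite -imset_comp; apply: eq_imset => v; rewrite permM. Qed.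

(** * Template cuts and matchings *)

Section Template.
Context (q : nat).
Notation I := 'I_q.

(* Blocks [A_j] of four vertices, blocks [B_j] of twice four vertices, and seven
   vertices [C_l] facing seven vertices [D_l]. *)
Definition tvertex : finType := (I * 'I_4 + I * bool * 'I_4 + bool * 'I_7)%type.
Definition vA (j : I) (i : 'I_4) : tvertex := inl (inl (j, i)).
Definition vB (j : I) (s : bool) (i : 'I_4) : tvertex := inl (inr ((j, s), i)).
Definition vC (s : bool) (l : 'I_7) : tvertex := inr (s, l).

Notation config := {ffun option I -> bool * 'I_3}.
Notation pconfig := {ffun I -> 'I_3}.
Implicit Types (H : 'I_7) (Y : config) (X : pconfig).

Definition cutT H Y : {set tvertex} := [set v | match v with
  | inl (inl (j, _)) => (Y (Some j)).1
  | inl (inr _) => false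
  | inr (s, l) => ~~ s && ((Y None).1 || on_line H l)
  end]%SET.

(** Only the C side has a free pairing. An exchange with A_j moves C vertices but no D vertices, so
    a pairing shared by both sides would not be carried to a matching of the same form. *)
Definition side (s : bool) (w : 'I_3) : 'I_3 := if s then ord0 else w.

(** [None] governs the C and D vertices off the line exactly as [Some j] governs the two halves of
    B_j: high is matched across, low within each half. The A blocks are matched within by [X],
    outside the configuration. *)
Definition matchT H X Y : {ffun tvertex -> tvertex} := [ffun v => match v with
  | inl (inl (j, i)) => vA j (pairing (X j) i)
  | inl (inr ((j, s), i)) => if (Y (Some j)).1 then vB j (~~ s) i
      else vB j s (pairing (side s (Y (Some j)).2) i)
  | inr (s, l) => if (Y None).1 || on_line H l then vC (~~ s) l
      else vC s (off_pt H (pairing (side s (Y None).2) (off_idx H l)))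
  end].

Lemma matchT_fpf H X Y : involution_without_fixpoint (matchT H X Y).
Proof.
apply/forallP => -[[[j i]|[[j s] i]]|[s l]]; rewrite [matchT _ _ _ _ in X in matchT _ _ _ X]ffunE !ffunE /=.
- by rewrite pairingK eqxx /vA; apply/eqP => -[] /eqP; rewrite (negbTE (pairing_neq _ _)).
- case Yj: (Y (Some j)).1; rewrite /= Yj ?negbK ?pairingK eqxx /vB; apply/eqP => -[].
    by case: s.
  by move/eqP; rewrite (negbTE (pairing_neq _ _)).
- case h : ((Y None).1 || on_line H l); rewrite /= ?h.
    by rewrite negbK eqxx /vC; apply/eqP => -[]; case: s.
  move/negbT: h; rewrite negb_or => /andP[/negbTE -> lH] /=.
  rewrite (negbTE (off_pt_off _ _)) off_ptK pairingK off_idxK// eqxx /vC /=.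
  apply/eqP => -[] /(congr1 (off_idx H)); rewrite off_ptK => /eqP.
  by rewrite (negbTE (pairing_neq _ _)).
Qed.

Lemma cutT_hi H H' Y : (Y None).1 -> cutT H Y = cutT H' Y.
Proof. by move=> Yn; apply/setP => -[[[j i]|[[j s] i]]|[s l]]; rewrite !inE// Yn. Qed.

Lemma matchT_hi H H' X Y : (Y None).1 -> matchT H X Y = matchT H' X Y.
Proof. by move=> Yn; apply/ffunP => -[[[j i]|[[j s] i]]|[s l]]; rewrite !ffunE// Yn. Qed.

Lemma card_tset (P : pred tvertex) : #|[set v | P v]%SET| =
  (\sum_j \sum_i P (vA j i) + \sum_j \sum_s \sum_i P (vB j s i) + \sum_s \sum_l P (vC s l))%N.
Proof.
rewrite -sum1dep_card big_mkcond/= big_sumType/= big_sumType/=.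
congr (_ + _ + _)%N.
- by rewrite pair_bigA; apply: eq_bigr => -[j i] _ /=; case: (P _).
- by rewrite pair_bigA pair_bigA; apply: eq_bigr => -[[j s] i] _ /=; case: (P _).
- by rewrite pair_bigA; apply: eq_bigr => -[s l] _ /=; case: (P _).
Qed.

(** The A blocks contribute multiples of four, the C vertices seven or three. *)
Lemma odd_cutT H Y : odd #|cutT H Y|.
Proof.
rewrite card_tset /= [X in (_ + X + _)%N]big1 => [|j _]; last by rewrite !big1.
rewrite addn0 oddD.
have -> : odd (\sum_(j < q) \sum_(i < 4) (Y (Some j)).1) = false.
  elim/big_ind : _ => // [m n|j _]; first by rewrite oddD => -> ->.
  by rewrite sum_nat_const card_ord; case: (Y _).1.
rewrite /= big_bool /= [X in (X + _)%N]big1 // add0n.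
case: (Y None).1 => /=; first by rewrite sum_nat_const card_ord.
suff -> : (\sum_(i < 7) on_line H i)%N = 3%N by [].
apply: etrans (card_line H); rewrite -sum1dep_card [RHS]big_mkcond/=.
by apply: eq_bigr => l _; case: ifP.
Qed.

(** Only C vertices count: each A block lies on one side and is matched within itself, and no B or D
    vertex is in the cut. *)
Lemma crossE H H' X Y Y' : cross (cutT H Y) (matchT H' X Y') =
  #|[set l | ((Y None).1 || on_line H l) && (((Y' None).1 || on_line H' l)
    || ~~ ((Y None).1 || on_line H (off_pt H' (pairing (Y' None).2 (off_idx H' l)))))]%SET|.
Proof.
rewrite /cross -[RHS](@card_imset _ _ (vC false)); last by move=> l l' [].
apply: eq_card => -[[[j i]|[[j s] i]]|[s l]]; rewrite ?inE ?ffunE ?inE/=.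
- rewrite andbN; apply/esym/negbTE/imsetP => -[? _] //.
- by apply/esym/negbTE/imsetP => -[? _].
case: s => /=; first by apply/esym/negbTE/imsetP => -[? _].
rewrite (mem_imset _ _ (_ : injective (vC false))); last by move=> l1 l2 [].
rewrite inE; congr (_ && _).
by case: (_ || on_line H' l); rewrite // inE.
Qed.

Lemma cross_lo H X Y Y' : ~~ (Y None).1 -> ~~ (Y' None).1 ->
  cross (cutT H Y) (matchT H X Y') = 3%N.
Proof.
move=> /negbTE Yn /negbTE Yn'; rewrite crossE Yn Yn'; apply: etrans (card_line H); apply: eq_card => l.
by rewrite !inE /=; case: (on_line H l).
Qed.

Lemma cross_hi H X Y Y' : (Y None).1 -> (Y' None).1 ->
  cross (cutT H Y) (matchT H X Y') = 7%N.
Proof.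
by move=> Yn Yn'; rewrite crossE Yn Yn'; apply: etrans (card_ord 7); apply: eq_card => l; rewrite !inE.
Qed.

Lemma cross_conflict H H' : H != H' -> exists w, forall X Y Y',
  ~~ (Y None).1 -> Y' None = (false, w) -> cross (cutT H Y) (matchT H' X Y') = 1%N.
Proof.
case/fano_conflict => w Hw; exists w => X Y Y' /negbTE Yn Yn'.
by rewrite crossE Yn Yn'; apply: etrans Hw; apply: eq_card => l; rewrite !inE.
Qed.

(* Exchanging a block with the vertices off the line [H] moves the singled-out
   coordinate. With [A_j] this moves it in the cut, and only permutes the random
   pairings of the matching; with [B_j] it moves it in the matching and fixes the cut. *)
Definition swapA_fun H (j : I) (v : tvertex) : tvertex := match v with
  | inl (inl (j', i)) => if j' == j then vC false (off_pt H i) else v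
  | inr (false, l) => if on_line H l then v else vA j (off_idx H l)
  | _ => v
  end.

Definition swapB_fun H (j : I) (v : tvertex) : tvertex := match v with
  | inl (inr ((j', s), i)) => if j' == j then vC s (off_pt H i) else v
  | inr (s, l) => if on_line H l then v else vB j s (off_idx H l)
  | _ => v
  end.

Lemma swapA_funK H j : involutive (swapA_fun H j).
Proof.
move=> [[[j' i]|[[j' s] i]]|[[] l]] //=.
- by case: eqP => [->|/eqP/negbTE]/=; rewrite ?(negbTE (off_pt_off _ _)) ?off_ptK// => ->.
- by case: ifPn => lH /=; rewrite ?(negbTE lH) ?lH ?eqxx ?off_idxK.
Qed.

Lemma swapB_funK H j : involutive (swapB_fun H j).
Proof.
move=> [[[j' i]|[[j' s] i]]|[s l]] //=.
- by case: eqP => [->|/eqP/negbTE]/=; rewrite ?(negbTE (off_pt_off _ _)) ?off_ptK// => ->.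
- by case: ifPn => lH /=; rewrite ?(negbTE lH) ?lH ?eqxx ?off_idxK.
Qed.

Definition swapA H (j : option I) : {perm tvertex} :=
  if j is Some j then perm (inv_inj (swapA_funK H j)) else 1%g.
Definition swapB H (j : option I) : {perm tvertex} :=
  if j is Some j then perm (inv_inj (swapB_funK H j)) else 1%g.

Lemma moved_id Y : moved None Y = Y.
Proof. by apply/ffunP => i; rewrite ffunE tperm1 perm1. Qed.

Lemma conj_by1 (V : finType) (M : {ffun V -> V}) : conj_by 1%g M = M.
Proof. by apply/ffunP => v; rewrite ffunE invg1 !perm1. Qed.

Lemma imset_inv (V : finType) (f : V -> V) (fK : involutive f) (U : {set V}) v :
  (v \in (perm (inv_inj fK) @: U)%SET) = (f v \in U).
Proof.
rewrite -{1}[v]fK -[X in X \in _](permE (inv_inj fK)).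
by rewrite (mem_imset _ _ (@perm_inj _ _)).
Qed.

Lemma conj_inv (V : finType) (f : V -> V) (fK : involutive f) M v :
  conj_by (perm (inv_inj fK)) M v = f (M (f v)).
Proof.
rewrite ffunE permE; do 2 congr (_ _).
by apply: (@perm_inj _ (perm (inv_inj fK))); rewrite permKV permE fK.
Qed.

Lemma swapA_cut H j Y : (swapA H j @: cutT H Y)%SET = cutT H (moved j Y).
Proof.
case: j => [j|]; last first.
  by rewrite moved_id -[RHS]imset_id; apply: eq_imset => v; rewrite perm1.
apply/setP => v; rewrite imset_inv !inE.
case: v => [[[j' i]|[[j' s] i]]|[[] l]] //=; rewrite !ffunE.
- case: (eqVneq j' j) => [->|jj] /=; first by rewrite tpermR (negbTE (off_pt_off _ _)) orbF.
  by rewrite tpermD// (inj_eq Some_inj) eq_sym.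
- by rewrite tpermL; case: ifPn => lH /=; rewrite ?lH ?orbT ?(negbTE lH) ?orbF.
Qed.

Lemma swapB_cut H j Y : (Y None).1 = false -> (swapB H j @: cutT H Y)%SET = cutT H Y.
Proof.
move=> Yn; case: j => [j|]; last first.
  by rewrite -[RHS]imset_id; apply: eq_imset => v; rewrite perm1.
apply/setP => v; rewrite imset_inv !inE.
case: v => [[[j' i]|[[j' s] i]]|[s l]] //=.
- by case: eqP => //= _; rewrite Yn (negbTE (off_pt_off _ _)) andbF.
- by case: ifPn => lH /=; rewrite Yn ?lH /= ?andbF.
Qed.

Lemma swapB_match H j X Y : conj_by (swapB H j) (matchT H X Y) = matchT H X (moved j Y).
Proof.
case: j => [j|]; last by rewrite conj_by1 moved_id.
apply/ffunP => v; rewrite conj_inv !ffunE.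
case: v => [[[j' i]|[[j' s] i]]|[s l]] //=; rewrite ?ffunE.
- case: (eqVneq j' j) => [->|jj] /=.
    rewrite tpermR (negbTE (off_pt_off _ _)) orbF off_ptK.
    by case: ifP => Yn /=; rewrite (negbTE (off_pt_off _ _)) off_ptK.
  rewrite tpermD ?(inj_eq Some_inj) 1?eq_sym//.
  by case: ifP => _ /=; rewrite (negbTE jj).
- rewrite tpermL; case: ifPn => lH /=; rewrite ?lH ?orbT /= ?lH// orbF.
  by case: ifPn => Yj /=; rewrite eqxx// off_idxK.
Qed.

(** The effect of [swapA] on a low matching: the pairings of A_j and of the C vertices off the line
    trade places. As this is a bijection, a sum over all pairings does not see it. *)
Definition swapXY (j : I) (XY : pconfig * config) : pconfig * config :=
  ([ffun i => if i == j then (XY.2 None).2 else XY.1 i],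
   [ffun o => if o is Some i then XY.2 (Some i) else ((XY.2 None).1, XY.1 j)]).

Lemma swapXYK j : involutive (swapXY j).
Proof.
move=> [X Y]; congr (_, _); apply/ffunP.
  by move=> i; rewrite !ffunE /=; case: eqP => [->|//].
by case => [i|]; rewrite !ffunE/= ?ffunE ?eqxx //=; case: (Y None).
Qed.

Lemma swapA_match H j X Y : (Y None).1 = false ->
  conj_by (swapA H (Some j)) (matchT H X Y) =
  matchT H (swapXY j (X, Y)).1 (swapXY j (X, Y)).2.
Proof.
move=> Yn; apply/ffunP => v; rewrite conj_inv !ffunE.
case: v => [[[j' i]|[[j' s] i]]|[s l]] /=; rewrite ?ffunE /= ?ffunE /=.
- case: (eqVneq j' j) => [->|jj] /=.
    by rewrite Yn (negbTE (off_pt_off _ _)) off_ptK /= (negbTE (off_pt_off _ _)) off_ptK.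
  by rewrite (negbTE jj).
- by case: ifP.
- case: s => /=.
    by rewrite Yn /=; case: ifPn => lH /=; rewrite ?lH.
  by case: ifPn => lH /=; rewrite Yn ?lH ?(negbTE lH) /= ?eqxx.
Qed.

End Template.

Lemma sum_at_most_one (R : realType) (I : finType) (P : pred I) (F : I -> R) (c : R) :
  0 <= c -> (forall i, P i -> F i <= c) ->
  (forall i j, P i -> P j -> i != j -> F i = 0 \/ F j = 0) ->
  \sum_(i | P i) F i <= c.
Proof.
move=> c0 Fc F1; case: (pickP [pred i | P i & F i != 0]) => [i /andP[Pi Fi]|none].
  rewrite (bigD1 i)//= big1 ?addr0 ?Fc// => j /andP[Pj ji].
  by case: (F1 _ _ Pj Pi ji) => // Fi0; rewrite Fi0 eqxx in Fi.
by rewrite big1// => i Pi; have := none i; rewrite /= Pi /= => /negbFE/eqP.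
Qed.

(** * A nonnegative rank-one term *)

Section Matching.
Context (R : realType) (q : nat).
Notation I := 'I_q.
Notation V := (tvertex q).
Notation config := {ffun option I -> bool * 'I_3}.
Notation pconfig := {ffun I -> 'I_3}.
Implicit Types (f : {set V} -> R) (g : {ffun V -> V} -> R) (p : {perm V}).

Definition cutF f (H : 'I_7) p (Y : config) : R := f (p @: cutT H Y)%SET.
(** The average over [X] makes the low part invariant under [swapA], as [exchange] demands of the
    factor that stays fixed. *)
Definition matchF g (H : 'I_7) p (Y : config) : R :=
  (\sum_(X : pconfig) g (conj_by p (matchT H X Y))) / #|{: pconfig}|%:R.

Definition phi3 f g : R :=
  \sum_H \sum_p lo_at None (cutF f H p) * lo_at None (matchF g H p).
(** High cuts and matchings do not depend on the line, so one line stands for all. *)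
Definition phi7 f g : R :=
  \sum_p hi_at None (cutF f ord0 p) * hi_at None (matchF g ord0 p).

Notation nconf := (#|{: config}|%:R : R).
Notation decay := (expR (- (q.+1%:R / 6 / 100 / 200)) : R).

Lemma card_pconfig_gt0 : 0 < #|{: pconfig}|%:R :> R.
Proof. by rewrite ltr0n card_ffun card_ord expn_gt0. Qed.

Lemma decayE : #|{: bool * 'I_3}|%:R ^+ #|{: option I}| *
   expR (- (#|{: option I}|%:R / #|{: bool * 'I_3}|%:R / 100 / 200)) = nconf * decay.
Proof. by rewrite card_ffun -natrX card_option card_prod card_bool !card_ord. Qed.

Lemma lo_at_bound (G : config -> R) : (forall Y, 0 <= G Y <= 1) ->
  0 <= lo_at None G <= nconf.
Proof.
move=> G01; apply/andP; split; first by apply: sumr_ge0 => Y _; case/andP: (G01 Y).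
apply: (@le_trans _ _ (\sum_Y G Y)).
  rewrite (lohiE None) lerDl; apply: sumr_ge0 => Y _; by case/andP: (G01 Y).
apply: (@le_trans _ _ (\sum_(Y : config) 1)); last by rewrite sumr_const.
by apply: ler_sum => Y _; case/andP: (G01 Y).
Qed.

Lemma matchF_bound g H p Y : (forall M, 0 <= g M <= 1) -> 0 <= matchF g H p Y <= 1.
Proof.
move=> g01; apply/andP; split.
  by apply: divr_ge0; [apply: sumr_ge0 => X _; case/andP: (g01 (conj_by p (matchT H X Y)))|].
rewrite ler_pdivrMr ?card_pconfig_gt0// mul1r.
apply: (@le_trans _ _ (\sum_(X : pconfig) 1)); last by rewrite sumr_const.
by apply: ler_sum => X _; case/andP: (g01 (conj_by p (matchT H X Y))).
Qed.

Lemma lo_matchF_swapA g H j p :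
  lo_at None (matchF g H (swapA H j * p)%g) = lo_at None (matchF g H p).
Proof.
case: j => [j|]; last by rewrite mul1g.
rewrite /lo_at /matchF -!mulr_suml; congr (_ / _).
rewrite exchange_big [RHS]exchange_big /= !pair_big /=.
rewrite (reindex_inj (inv_inj (swapXYK j))) /=.
apply: eq_big => [[X Y]|[X Y] /=]; first by rewrite /swapXY /= ffunE.
move=> Yn; rewrite conj_by_mul swapA_match; last first.
  by apply/negbTE; move: Yn; rewrite /swapXY /= !ffunE.
by move: (swapXYK j (X, Y)); rewrite /swapXY /= => -[-> ->].
Qed.

Lemma lo_cutF_swapB f H j p :
  lo_at None (cutF f H (swapB H j * p)%g) = lo_at None (cutF f H p).
Proof.
apply: eq_bigr => Y /negbTE Yn.
by rewrite /cutF imset_permM swapB_cut.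
Qed.

(** Each line loses 1/20 to skewed cuts and 1/20 to skewed matchings, which leaves 9/10 and 2 * 7
    error terms. Of the unskewed rest, at most one line survives for each [p], with ratio (11/9)^2 =
    121/81. *)
Lemma phi_bound f g : (forall U, 0 <= f U <= 1) -> (forall M, 0 <= g M <= 1) ->
  (forall U M, cross U M = 1%N -> f U * g M = 0) ->
  9 / 10 * phi3 f g <= 121 / 81 * phi7 f g +
    14 * (#|{: {perm V}}|%:R * (nconf * decay) * nconf).
Proof.
move=> f01 g01 fg0; set D := _ * nconf.
have cF01 H p Y : 0 <= cutF f H p Y <= 1 by exact: f01.
have mF01 H p Y : 0 <= matchF g H p Y <= 1 by exact: matchF_bound.
pose LU H p := lo_at None (cutF f H p); pose LM H p := lo_at None (matchF g H p).
pose bU H p := skew_at None (cutF f H p); pose bM H p := skew_at None (matchF g H p).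
have LU0 H p : 0 <= LU H p by case/andP: (lo_at_bound (cF01 H p)).
have LM0 H p : 0 <= LM H p by case/andP: (lo_at_bound (mF01 H p)).
have exU H : \sum_(p | bU H p) LU H p * LM H p <= 1 / 20 * (\sum_p LU H p * LM H p) + D.
  rewrite /D -decayE.
  apply: (@exchange _ _ _ _ (cutF f H) (fun j p => (swapA H j * p)%g) (LM H)).
  - by rewrite card_ord.
  - exact: cF01.
  - by move=> j; exact: mulgI.
  - by move=> j p Y; rewrite /cutF imset_permM swapA_cut.
  - by move=> j p; exact: lo_matchF_swapA.
  - by move=> p; exact: lo_at_bound.
have exM H : \sum_(p | bM H p) LU H p * LM H p <= 1 / 20 * (\sum_p LU H p * LM H p) + D.
  rewrite /D -decayE; under eq_bigr do rewrite mulrC; under [in leRHS]eq_bigr do rewrite mulrC.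
  apply: (@exchange _ _ _ _ (matchF g H) (fun j p => (swapB H j * p)%g) (LU H)).
  - by rewrite card_ord.
  - exact: mF01.
  - by move=> j; exact: mulgI.
  - move=> j p Y; rewrite /matchF; congr (_ / _); apply: eq_bigr => X _.
    by rewrite conj_by_mul swapB_match.
  - by move=> j p; exact: lo_cutF_swapB.
  - by move=> p; exact: lo_at_bound.
have good : \sum_H \sum_(p | ~~ bU H p && ~~ bM H p) LU H p * LM H p <= 121 / 81 * phi7 f g.
  under eq_bigr do rewrite big_mkcond.
  rewrite exchange_big /= mulr_sumr; apply: ler_sum => p _.
  rewrite -big_mkcond /=.
  have hU H : hi_at None (cutF f H p) = hi_at None (cutF f ord0 p).
    by apply: eq_bigr => Y Yn; rewrite /cutF (cutT_hi H ord0).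
  have hM H : hi_at None (matchF g H p) = hi_at None (matchF g ord0 p).
    apply: eq_bigr => Y Yn; congr (_ / _); apply: eq_bigr => X _.
    by rewrite (matchT_hi H ord0).
  have hU0 : 0 <= hi_at None (cutF f ord0 p).
    by apply: sumr_ge0 => Y _; case/andP: (cF01 ord0 p Y).
  have hM0 : 0 <= hi_at None (matchF g ord0 p).
    by apply: sumr_ge0 => Y _; case/andP: (mF01 ord0 p Y).
  apply: sum_at_most_one; first by rewrite !mulr_ge0.
    move=> H /andP[/lo_hi_ratio U1 /lo_hi_ratio M1].
    rewrite hU -/(LU H p) in U1; rewrite hM -/(LM H p) in M1.
    have : (9 * LU H p) * (9 * LM H p) <= (11 * hi_at None (cutF f ord0 p)) * (11 * hi_at None (matchF g ord0 p)).
      by rewrite ler_pM// mulr_ge0.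
    by lra.
  (* Were both terms nonzero, some low cut for [H] would have [f] nonzero, and, the matchings for
     [H'] being unskewed, the conflicting pairing [w] would carry positive mass. Such a cut and
     matching cross once, against [fg0]. *)
  move=> H H' /andP[_ _] /andP[_ nb'] HH.
  have [|LUn] := eqVneq (LU H p) 0; first by move=> ->; left; rewrite mul0r.
  have [|LMn] := eqVneq (LM H' p) 0; first by move=> ->; right; rewrite mulr0.
  exfalso.
  have [Y Yn fY] : exists2 Y : config, ~~ (Y None).1 & cutF f H p Y != 0.
    apply: contra_neqP LUn => nY; apply: big1 => Y Yn.
    by apply/eqP; apply/negP => /negP h; apply: nY; exists Y.
  have [w Hw] := cross_conflict q HH.
  have Spos : 0 < \sum_Y matchF g H' p Y.
    rewrite (lohiE None) ltr_wpDr ?lt_def ?LMn ?LM0//.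
    by apply: sumr_ge0 => Y' _; case/andP: (mF01 H' p Y').
  move: nb' => /existsPn /(_ (false, w)); rewrite -leNgt => Sw.
  have : 0 < \sum_(Y' : config | Y' None == (false, w)) matchF g H' p Y'.
    have N0 : 0 < #|{: bool * 'I_3}|%:R :> R by rewrite ltr0n card_prod card_bool card_ord.
    rewrite -(pmulr_rgt0 _ N0); apply: lt_le_trans Sw.
    by rewrite mulr_gt0.
  rewrite big1 ?ltxx// => Y' /eqP Yw.
  rewrite /matchF big1 ?mul0r// => X _.
  have c1 := Hw X Y Y' Yn Yw.
  have /eqP := fg0 (p @: cutT H Y)%SET (conj_by p (matchT H' X Y')) (etrans (cross_conj _ _ _) c1).
  by rewrite mulf_eq0 (negbTE fY) => /eqP.
have split3 : phi3 f g <= \sum_H (\sum_(p | bU H p) LU H p * LM H p +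
    \sum_(p | bM H p) LU H p * LM H p + \sum_(p | ~~ bU H p && ~~ bM H p) LU H p * LM H p).
  apply: ler_sum => H _; rewrite !(big_mkcond (bU H)) !(big_mkcond (bM H)) /= [X in _ + X]big_mkcond -!big_split /=.
  apply: ler_sum => p _; rewrite -/(LU H p) -/(LM H p).
  have := mulr_ge0 (LU0 H p) (LM0 H p).
  by case: (bU H p); case: (bM H p) => /=; lra.
have {}split3 : phi3 f g <= \sum_H (1 / 10 * (\sum_p LU H p * LM H p) + 2 * D) + 121 / 81 * phi7 f g.
  apply: (le_trans split3); rewrite big_split/=; apply: lerD => //.
  by apply: ler_sum => H _; have := exU H; have := exM H; lra.
move: split3; rewrite big_split/= -mulr_sumr -/(phi3 f g) sumr_const card_ord -[_ *+ 7]mulr_natr.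
by lra.
Qed.

Lemma phi_scale f g (a b : R) :
  phi3 (fun U => a * f U) (fun M => b * g M) = a * b * phi3 f g /\
  phi7 (fun U => a * f U) (fun M => b * g M) = a * b * phi7 f g.
Proof.
have mE H p Y : matchF (fun M => b * g M) H p Y = b * matchF g H p Y.
  by rewrite /matchF -mulr_sumr mulrA.
have E (u v : R) : (a * u) * (b * v) = a * b * (u * v) by ring.
split.
  rewrite /phi3 mulr_sumr; apply: eq_bigr => H _; rewrite mulr_sumr; apply: eq_bigr => p _.
  by rewrite -E /lo_at; congr (_ * _); rewrite mulr_sumr; apply: eq_bigr => Y _; rewrite ?mE.
rewrite /phi7 mulr_sumr; apply: eq_bigr => p _.
by rewrite -E /hi_at; congr (_ * _); rewrite mulr_sumr; apply: eq_bigr => Y _; rewrite ?mE.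
Qed.

(** Divide [f] and [g] by their maxima; the product of these is at most [B], which becomes the
    factor of the error. *)
Lemma phi_bound_scaled f g (B : R) : (forall U, 0 <= f U) -> (forall M, 0 <= g M) ->
  (forall U M, f U * g M <= B) ->
  (forall U M, cross U M = 1%N -> f U * g M = 0) ->
  9 / 10 * phi3 f g <= 121 / 81 * phi7 f g +
    B * (14 * (#|{: {perm V}}|%:R * (nconf * decay) * nconf)).
Proof.
move=> f0 g0 fgB fg0; set D := 14 * _.
have D0 : 0 <= D by apply: mulr_ge0 => //; apply: mulr_ge0 => //; apply: mulr_ge0 => //; apply: mulr_ge0 => //; exact: expR_ge0.
have [U0 _ U0max] := @arg_maxP _ _ _ (finset.set0 : {set V}) xpredT f isT.
have [M0 _ M0max] := @arg_maxP _ _ _ ([ffun v => v] : {ffun V -> V}) xpredT g isT.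
have [ab0|abn] := eqVneq (f U0 * g M0) 0.
  have z U M : f U * g M = 0.
    apply/eqP; rewrite eq_le mulr_ge0// -ab0 ler_pM//; [exact: U0max|exact: M0max].
  have -> : phi3 f g = 0.
    apply: big1 => H _; apply: big1 => p _; rewrite /lo_at mulr_suml; apply: big1 => Y _.
    rewrite mulr_sumr; apply: big1 => Y' _; rewrite /cutF /matchF mulrA mulr_sumr big1 ?mul0r//.
  have -> : phi7 f g = 0.
    apply: big1 => p _; rewrite /hi_at mulr_suml; apply: big1 => Y _.
    rewrite mulr_sumr; apply: big1 => Y' _; rewrite /cutF /matchF mulrA mulr_sumr big1 ?mul0r//.
  by rewrite !mulr0 add0r mulr_ge0// -ab0 fgB.
have [an bn] : f U0 != 0 /\ g M0 != 0 by move: abn; rewrite mulf_eq0 negb_or => /andP.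
have a0 : 0 < f U0 by rewrite lt_def an f0.
have b0 : 0 < g M0 by rewrite lt_def bn g0.
have := @phi_bound (fun U => (f U0)^-1 * f U) (fun M => (g M0)^-1 * g M).
have [-> ->] := phi_scale f g (f U0)^-1 (g M0)^-1.
rewrite -/D => H.
have {}H : 9 / 10 * ((f U0)^-1 / g M0 * phi3 f g) <= 121 / 81 * ((f U0)^-1 / g M0 * phi7 f g) + D.
  apply: H.
  - move=> U; rewrite mulr_ge0 ?invr_ge0// mulrC ler_pdivrMr// mul1r; exact: U0max.
  - move=> M; rewrite mulr_ge0 ?invr_ge0// mulrC ler_pdivrMr// mul1r; exact: M0max.
  - by move=> U M /fg0 E; rewrite mulrACA E mulr0.
have : f U0 * g M0 * D <= B * D by rewrite ler_wpM2r.
have ab : 0 < f U0 * g M0 by rewrite mulr_gt0.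
rewrite -(ler_pM2l ab) in H.
have E (x : R) : f U0 * g M0 * ((f U0)^-1 / g M0 * x) = x by field; rewrite an bn.
have := E (phi3 f g); have := E (phi7 f g); move: H.
move: (_ / g M0) (f U0 * g M0) (phi3 f g) (phi7 f g) (D) => v u x y d *.
by lra.
Qed.

End Matching.

(** * Nonnegative rank of the matching slack matrix *)

Section RankBound.
Context (R : realType) (q : nat).
Notation I := 'I_q.
Notation V := (tvertex q).
Notation config := {ffun option I -> bool * 'I_3}.
Notation pconfig := {ffun I -> 'I_3}.
Notation nconf := (#|{: config}|%:R : R).
Notation decay := (expR (- (q.+1%:R / 6 / 100 / 200)) : R).

Lemma sum_lo1 : \sum_(Y : config | ~~ (Y None).1) (1 : R) = nconf / 2.
Proof.
have E : \sum_(Y : config | ~~ (Y None).1) (1 : R) = \sum_(Y : config | (Y None).1) (1 : R).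
  pose neg (Y : config) : config := [ffun o => (~~ (Y o).1, (Y o).2)].
  have negK : involutive neg by move=> Y; apply/ffunP => o; rewrite !ffunE negbK; case: (Y o).
  rewrite (reindex_inj (inv_inj negK)) /=; apply: eq_bigl => Y.
  by rewrite ffunE negbK.
have : nconf = \sum_(Y : config) 1 by rewrite sumr_const.
rewrite (bigID (fun Y : config => (Y None).1))/= -E; lra.
Qed.

Lemma sum_hi1 : \sum_(Y : config | (Y None).1) (1 : R) = nconf / 2.
Proof.
have : nconf = \sum_(Y : config) 1 by rewrite sumr_const.
rewrite (bigID (fun Y : config => (Y None).1))/= sum_lo1 => E.
by move: E; lra.
Qed.

Lemma sum_prod_matchF (r : nat) (f : 'I_r -> {set V} -> R) (g : 'I_r -> {ffun V -> V} -> R)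
    (P : pred config) (H : 'I_7) (p : {perm V}) (c : R) :
  (forall X Y Y', P Y -> P Y' ->
    \sum_k f k (p @: cutT H Y)%SET * g k (conj_by p (matchT H X Y')) = c) ->
  \sum_k (\sum_(Y | P Y) cutF (f k) H p Y) * (\sum_(Y | P Y) matchF (g k) H p Y) =
  c * (\sum_(Y | P Y) 1) ^+ 2.
Proof.
move=> fgc.
under eq_bigr do rewrite big_distrlr /=.
have -> : c * (\sum_(Y | P Y) 1) ^+ 2 = \sum_(Y : config | P Y) \sum_(Y' : config | P Y') c.
  rewrite expr2 big_distrlr mulr_sumr; apply: eq_bigr => Y _.
  by rewrite mulr_sumr; apply: eq_bigr => Z _; rewrite /= !mulr1.
rewrite exchange_big/=; apply: eq_bigr => Y PY.
rewrite exchange_big/=; apply: eq_bigr => Y' PY'.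
rewrite /cutF /matchF.
under eq_bigr do rewrite mulrA mulr_sumr.
rewrite -mulr_suml exchange_big /=.
under eq_bigr do rewrite fgc//.
by rewrite sumr_const -[X in X / _]mulr_natr mulfK// gt_eqF// card_pconfig_gt0.
Qed.

Lemma matching_rank_bound (r : nat) (a : 'I_r -> {set V} -> R) (b : 'I_r -> {ffun V -> V} -> R) :
  (forall k U, 0 <= a k U) -> (forall k M, 0 <= b k M) ->
  (forall (U : {set V}) M, odd #|U| -> involution_without_fixpoint M ->
    (cross U M)%:R - 1 = \sum_k a k U * b k M) ->
  1 <= 16 * #|{: V}|%:R * decay * r%:R.
Proof.
move=> a0 b0 ab; set B := #|{: V}|%:R.
(* Cut off to zero outside odd sets and perfect matchings, the factors meet the hypotheses of
   [phi_bound_scaled], which range over all sets and all functions. *)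
pose f k (U : {set V}) := if odd #|U| then a k U else 0.
pose g k M := if involution_without_fixpoint M then b k M else 0.
have f0 k U : 0 <= f k U by rewrite /f; case: ifP.
have g0 k M : 0 <= g k M by rewrite /g; case: ifP.
have fg_le k U M : f k U * g k M <= Num.max 0 ((cross U M)%:R - 1).
  rewrite le_max /f /g; case: ifP => oU; last by rewrite mul0r lexx.
  case: ifP => iM; last by rewrite mulr0 lexx.
  apply/orP; right; rewrite ab// (bigD1 k)//= lerDl.
  by apply: sumr_ge0 => k' _; rewrite mulr_ge0.
have fgB k U M : f k U * g k M <= B.
  apply: le_trans (fg_le k U M) _; rewrite ge_max ler0n /=.
  apply: (@le_trans _ _ (cross U M)%:R); first by lra.
  by rewrite ler_nat max_card.
have fg0 k U M : cross U M = 1%N -> f k U * g k M = 0.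
  move=> c1; have := fg_le k U M; rewrite c1 subrr maxxx => h.
  by apply/eqP; rewrite eq_le h mulr_ge0.
have fgS (U : {set V}) M : odd #|U| -> involution_without_fixpoint M ->
    \sum_k f k U * g k M = (cross U M)%:R - 1.
  by move=> oU iM; rewrite ab//; apply: eq_bigr => k _; rewrite /f /g oU iM.
have odd_im (p : {perm V}) H Y : odd #|(p @: cutT H Y)%SET|.
  by rewrite (card_imset _ (@perm_inj _ p)) odd_cutT.
set n := #|{: {perm V}}|%:R : R.
have S3 : \sum_k phi3 (f k) (g k) = 7 * (n * (2 * (nconf / 2) ^+ 2)).
  rewrite /phi3 exchange_big/=.
  have -> : 7 * (n * (2 * (nconf / 2) ^+ 2)) = \sum_(H : 'I_7) \sum_(p : {perm V}) 2 * (nconf / 2) ^+ 2.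
    by rewrite !sumr_const card_ord /n !mulr_natl.
  apply: eq_bigr => H _; rewrite exchange_big/=; apply: eq_bigr => p _.
  rewrite /lo_at (@sum_prod_matchF _ _ _ _ _ _ 2) ?sum_lo1// => X Y Y' Yn Yn'.
  by rewrite fgS ?conj_by_fpf ?matchT_fpf// cross_conj cross_lo//; lra.
have S7 : \sum_k phi7 (f k) (g k) = n * (6 * (nconf / 2) ^+ 2).
  rewrite /phi7 exchange_big/=.
  have -> : n * (6 * (nconf / 2) ^+ 2) = \sum_(p : {perm V}) 6 * (nconf / 2) ^+ 2.
    by rewrite sumr_const /n !mulr_natl.
  apply: eq_bigr => p _.
  rewrite /hi_at (@sum_prod_matchF _ _ _ _ _ _ 6) ?sum_hi1// => X Y Y' Yn Yn'.
  by rewrite fgS ?conj_by_fpf ?matchT_fpf// cross_conj cross_hi//; lra.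
have : \sum_k 9 / 10 * phi3 (f k) (g k) <= \sum_(k < r) (121 / 81 * phi7 (f k) (g k) +
    B * (14 * (n * (nconf * decay) * nconf))).
  by apply: ler_sum => k _; exact: (phi_bound_scaled (f0 k) (g0 k) (fgB k) (fg0 k)).
rewrite big_split/= -!mulr_sumr S3 S7 sumr_const card_ord.
rewrite -[nconf *+ r]mulr_natr.
have n0 : 0 < n by rewrite ltr0n; apply/card_gt0P; exists 1%g.
have c0 : 0 < nconf by rewrite ltr0n card_ffun card_prod card_bool !card_ord expn_gt0.
set K := n * nconf ^+ 2; have K0 : 0 < K by rewrite mulr_gt0// exprn_gt0.
have -> : 9 / 10 * (7 * (n * (2 * (nconf / 2) ^+ 2))) = 63 / 20 * K by rewrite /K; field.
have -> : 121 / 81 * (n * (6 * (nconf / 2) ^+ 2)) = 121 / 54 * K by rewrite /K; field.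
have -> : B * (14 * (n * (nconf * decay) * (nconf * r%:R))) = 14 * B * decay * r%:R * K.
  by rewrite /K; ring.
rewrite -mulrDl ler_pM2r// => h.
(* The constant 16 comes from 63/20 - 121/54 > 14/16. *)
by set x := decay in h *; lra.
Qed.

End RankBound.

(** * Combs and tours from cuts and matchings *)

Section Blocks.
Context (R : realType) (n h t : nat) (B : finType).
Implicit Types b : B.
Hypothesis h0 : (1 <= h)%N.
Hypothesis ht : (h < t)%N.
Hypothesis Bn : (#|B| * t < n)%N.

(* Consecutive blocks of [t] vertices, one for each element of [B]; the first [h]
   vertices of a block are its low part. *)
Definition block (v : 'I_n) : option B :=
  if @insub _ _ 'I_#|B| (v %/ t)%N is Some i then Some (enum_val i) else None.
Definition low (v : 'I_n) : bool := (v %% t < h)%N.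
Definition hub : 'I_n := Ordinal Bn.

Let t0 : (0 < t)%N. Proof. exact: leq_trans ht. Qed.

Lemma block_hub : block hub = None.
Proof. by rewrite /block /= mulnK// insubF// ltnn. Qed.

Lemma blockE v b : (block v == Some b) = (v %/ t == enum_rank b)%N.
Proof.
rewrite /block; case: insubP => [i vt iE|vt].
  rewrite (inj_eq Some_inj) -iE; apply/eqP/eqP => [<-|/val_inj ->]; first by rewrite enum_valK.
  by rewrite enum_rankK.
by apply/esym/negbTE; apply: contraNneq vt => ->.
Qed.

Lemma vertex_lt b (i : 'I_t) : (enum_rank b * t + i < n)%N.
Proof.
apply: leq_trans Bn; rewrite ltnS; apply: (@leq_trans ((enum_rank b).+1 * t)).
  by rewrite mulSn addnC leq_add2r ltnW.
by rewrite leq_mul2r ltn_ord orbT.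
Qed.
Definition vertex b (i : 'I_t) : 'I_n := Ordinal (vertex_lt b i).

Lemma block_vertex b i : block (vertex b i) = Some b.
Proof. by apply/eqP; rewrite blockE /= divnMDl// divn_small ?addn0. Qed.

Lemma low_vertex b i : low (vertex b i) = (i < h)%N.
Proof. by rewrite /low /= modnMDl modn_small. Qed.

Lemma vertexP v b : block v = Some b -> exists i, v = vertex b i.
Proof.
move=> /eqP; rewrite blockE => /eqP vb; exists (Ordinal (ltn_pmod v t0)).
by apply/val_inj; rewrite /= -vb -divn_eq.
Qed.

Lemma vertex_inj b : injective (vertex b).
Proof. by move=> i j /(congr1 val) /= /addnI /val_inj. Qed.

Definition tooth b : {set 'I_n} := [set v | block v == Some b]%SET.

Lemma card_block_sub b (P : pred nat) :
  #|[set v | (block v == Some b) && P (v %% t)%N]%SET| = count P (iota 0 t).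
Proof.
rewrite -(card_ord_count t P) -(card_imset _ (@vertex_inj b)); apply: eq_card => v.
rewrite !inE; apply/andP/imsetP => [[/eqP /vertexP[i ->] Pi]|[i]].
  by exists i => //; rewrite inE; move: Pi; rewrite /= modnMDl modn_small.
by rewrite inE => Pi ->; rewrite block_vertex /= modnMDl modn_small.
Qed.

Context (W : {set B}).

Definition in_teeth v : bool := if block v is Some b then b \in W else false.
Definition handle : {set 'I_n} := [set v | low v && in_teeth v || (v == hub)]%SET.
Definition teeth (i : 'I_#|W|) : {set 'I_n} := tooth (enum_val i).

Lemma in_teethP v : reflect (exists i, v \in teeth i) (in_teeth v).
Proof.
rewrite /in_teeth; apply: (iffP idP) => [|[i]]; last first.
  by rewrite inE => /eqP ->; exact: enum_valP.
case bv : (block v) => [b|//] bW; exists (enum_rank_in bW b).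
by rewrite inE enum_rankK_in// bv.
Qed.

Lemma blocks_comb : (3 <= #|W|)%N -> odd #|W| -> is_comb handle teeth.
Proof.
move=> W3 Wodd; split=> //.
- move=> i; apply/finset.set0Pn; exists (vertex (enum_val i) (Ordinal t0)).
  rewrite !inE low_vertex block_vertex eqxx andbT; apply/orP; left.
  by rewrite h0; apply/in_teethP; exists i; rewrite inE block_vertex.
- move=> i j ij; apply/eqP/setP => v; rewrite !inE; apply/negbTE; rewrite negb_and.
  case: eqP => //= ->; apply: contra ij; rewrite (inj_eq Some_inj) => /eqP /enum_val_inj ->.
  exact: eqxx.
apply/finset.set0Pn; exists hub; rewrite !inE eqxx orbT andbT.
by apply/finset.bigcupP => -[i _]; rewrite inE block_hub.
Qed.

Lemma blocks_uniform i : #|teeth i| = t /\ #|handle :&: teeth i|%SET = h.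
Proof.
split.
  have := card_block_sub (enum_val i) xpredT; rewrite count_predT size_iota => E.
  by rewrite -[RHS]E; apply: eq_card => v; rewrite !inE andbT.
have E : count (fun j => (j < h)%N) (iota 0 t) = h.
  rewrite -size_filter; have -> : [seq j <- iota 0 t | (j < h)%N] = iota 0 h.
    rewrite -(subnKC (ltnW ht)) iotaD filter_cat.
    rewrite (@eq_in_filter _ _ xpredT (iota 0 h)) ?filter_predT; last first.
      by move=> j; rewrite mem_iota add0n => /andP[_ ->].
    rewrite (@eq_in_filter _ _ pred0) ?filter_pred0 ?cats0// => j.
    by rewrite mem_iota => /andP[hj _]; apply/negbTE; rewrite -leqNgt.
  exact: size_iota.
rewrite -[RHS]E -(card_block_sub (enum_val i)); apply: eq_card => v; rewrite !inE.
rewrite andbC; case: (boolP (block v == _)) => //= bv.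
have -> : in_teeth v by apply/in_teethP; exists i; rewrite inE.
rewrite andbT; case: eqP => [vc|]; rewrite ?orbF// vc in bv *.
by rewrite block_hub in bv.
Qed.

Lemma blocks_teeth_out i : (teeth i :\: handle != finset.set0)%SET.
Proof.
apply/finset.set0Pn; exists (vertex (enum_val i) (Ordinal ht)).
rewrite !inE low_vertex ltnn /= block_vertex eqxx andbT; apply/eqP => /(congr1 block).
by rewrite block_vertex block_hub.
Qed.

Lemma blocks_hub : (handle :\: \bigcup_i teeth i = [set hub])%SET.
Proof.
apply/setP => v; rewrite !inE; apply/andP/eqP => [[vT /orP[/andP[_]|/eqP//]]|->].
  by move/in_teethP => [i vi]; case/negP: vT; apply/finset.bigcupP; exists i.
rewrite eqxx orbT; split=> //.
by apply/finset.bigcupP => -[i _]; rewrite inE block_hub.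
Qed.

Notation th := (th teeth).
Notation hd := (hd handle).

Section OddW.
Hypothesis W3 : (3 <= #|W|)%N.
Hypothesis Wodd : odd #|W|.
Let cHT := blocks_comb W3 Wodd.

Lemma th_block v i : th v = Some i <-> block v = Some (enum_val i).
Proof.
split=> [/eqP|vb]; first by rewrite (thP cHT) inE => /eqP.
by apply/eqP; rewrite (thP cHT) inE vb.
Qed.

Lemma th_in_teeth v : (th v != None) = in_teeth v.
Proof.
apply/idP/in_teethP => [|[i vi]]; last by rewrite -(thP cHT) in vi; rewrite (eqP vi).
by case tv : (th v) => [i|//] _; exists i; rewrite -(thP cHT) tv.
Qed.

(** A block off [W] supplies the two outside vertices, since 1 <= h < t gives t at least 2. *)
Lemma blocks_facet : (3 <= n)%N -> (exists b, b \notin W) ->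
  facet_defining (TSP R n) (comb_ineq R handle teeth).
Proof.
move=> n3 [b bW]; apply: (comb_facet R cHT blocks_teeth_out blocks_hub n3) => u.
have out i : reg hd th (vertex b i) = rO _.
  rewrite /reg /hd inE; have iF : in_teeth (vertex b i) = false.
    by rewrite /in_teeth block_vertex; exact/negbTE.
  rewrite iF andbF /=; congr (_, _).
    by apply/eqP => /(congr1 block); rewrite block_vertex block_hub.
  by apply/eqP; rewrite -[_ == _]negbK th_in_teeth iF.
have [uE|uE] := eqVneq u (vertex b (Ordinal t0)); last first.
  by exists (vertex b (Ordinal t0)); rewrite 1?eq_sym.
exists (vertex b (Ordinal ht)) => //; rewrite uE (inj_eq (@vertex_inj b)) -val_eqE /=.
by rewrite -lt0n.
Qed.

Lemma coef_diff u v : block u != block v -> comb_coef (reg hd th u) (reg hd th v) =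
  ((hd u != hd v) + (in_teeth u + in_teeth v))%N.
Proof.
move=> uv; rewrite /comb_coef /= !th_in_teeth; congr (_ + _)%N.
case: eqP => // e; rewrite -!th_in_teeth e.
case tv : (th v) => [i|//]; exfalso; rewrite tv in e.
by move/th_block: e => e; move/th_block: tv => tv; rewrite e tv eqxx in uv.
Qed.

Lemma coef_same u v : block u = block v -> comb_coef (reg hd th u) (reg hd th v) =
  ((hd u != hd v) : nat).
Proof.
move=> uv; rewrite /comb_coef /=.
have -> : th u = th v.
  case tv : (th v) => [i|]; first by apply/th_block; rewrite uv; apply/th_block.
  by apply/eqP; rewrite -[_ == _]negbK th_in_teeth /in_teeth uv -/(in_teeth v) -th_in_teeth tv.
by rewrite eqxx addn0.
Qed.

Definition part (b : B) (l : bool) : seq 'I_n :=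
  [seq v <- enum 'I_n | (block v == Some b) && (low v == l)].

Notation ccost := (ccost R hd th).

Lemma hd_block v b : block v = Some b -> hd v = low v && (b \in W).
Proof.
move=> vb; rewrite /hd inE /in_teeth vb; case: eqP => [vc|]; rewrite ?orbF//.
by rewrite vc block_hub in vb.
Qed.

Lemma pcost_part b l x : exists2 y, (block y = Some b /\ low y = l) &
  forall s, pcost ccost x (part b l ++ s) =
     (comb_coef (reg hd th x) (reg hd th y))%:R + pcost ccost y s /\
     last x (part b l ++ s) = last y s.
Proof.
have [v vb vl] : exists2 v, block v = Some b & low v = l.
  case: l; first by exists (vertex b (Ordinal t0)); rewrite ?block_vertex ?low_vertex.
  by exists (vertex b (Ordinal ht)); rewrite ?block_vertex// low_vertex ltnn.
have hom (y : 'I_n) s : all (fun u => (block u == Some b) && (low u == l)) (y :: s) -> pcost ccost y s = 0.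
  elim: s y => [//|u s IH] y /= /and3P[/andP[/eqP yb /eqP yl] /andP[/eqP ub /eqP ul] us].
  rewrite IH ?addr0 /=; last by rewrite ub ul !eqxx us.
  by rewrite /ccost coef_same ?yb// (hd_block yb) (hd_block ub) yl ul eqxx.
have : v \in part b l by rewrite mem_filter vb vl !eqxx mem_enum.
have : all (fun u => (block u == Some b) && (low u == l)) (part b l) by exact: filter_all.
case: (part b l) => [//|y s] ys _.
have yys u : u \in y :: s -> block u = Some b /\ low u = l.
  by move/(allP ys)/andP => [/eqP -> /eqP ->].
exists (last y s); first by apply: yys; exact: mem_last.
move=> r; rewrite cat_cons /= pcost_cat hom// add0r last_cat; split=> //; congr (_ + _).
have [b1 l1] := yys y (mem_head _ _); have [b2 l2] := yys _ (mem_last y s).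
rewrite /ccost; congr (_%:R); rewrite /comb_coef.
suff -> : reg hd th y = reg hd th (last y s) by [].
rewrite /reg (hd_block b1) (hd_block b2) l1 l2; congr (_, _).
case tv : (th (last y s)) => [i|]; first by apply/th_block; rewrite b1 -b2; apply/th_block.
have E : in_teeth y = in_teeth (last y s) by rewrite /in_teeth b1 b2.
by apply/eqP; rewrite -[_ == _]negbK th_in_teeth E -th_in_teeth tv.
Qed.

End OddW.
End Blocks.

(** * The tour of a pairing of blocks *)

Section PairedTour.
Context (R : realType) (n h t : nat) (B : finType).
Hypothesis h0 : (1 <= h)%N.
Hypothesis ht : (h < t)%N.
Hypothesis Bn : (#|B| * t < n)%N.
Notation part := (@part n h t B).
Notation block := (@block n t B).
Notation low := (@low n h t).
Notation hub := (hub Bn).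

Definition pair_path (p : B * B) : seq 'I_n :=
  part p.1 false ++ part p.1 true ++ part p.2 true ++ part p.2 false.
Definition leftover : seq 'I_n := [seq v <- enum 'I_n | (block v == None) && (v != hub)].
Definition pair_list (rs : seq (B * B)) : seq B := flatten [seq [:: p.1; p.2] | p <- rs].

Lemma count_part (P : pred 'I_n) b :
  (count P (part b true) + count P (part b false) = \sum_(v | block v == Some b) P v)%N.
Proof.
have E l : count P (part b l) = (\sum_(v | (block v == Some b) && (low v == l)) P v)%N.
  rewrite count_filter -sum1_count big_enum_cond/= [LHS]big_mkcond [RHS]big_mkcond/=.
  by apply: eq_bigr => v _; rewrite /=; case: (P v); case: (_ == Some b); case: (_ == l).
rewrite !E [RHS](bigID low)/=; congr (_ + _)%N; apply: eq_bigl => v; case: (low v) => //.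
Qed.

Lemma count_pair_paths (P : pred 'I_n) rs :
  count P (flatten (map pair_path rs)) = (\sum_(b <- pair_list rs) \sum_(v | block v == Some b) P v)%N.
Proof.
elim: rs => [|[b b'] rs IH]; first by rewrite big_nil.
rewrite /= /pair_path !count_cat IH /pair_list /= !big_cons -!count_part; ring.
Qed.

Lemma count_offhub (P : pred 'I_n) :
  count P (offz hub) = (count P leftover + \sum_b \sum_(v | block v == Some b) P v)%N.
Proof.
have -> : count P (offz hub) = (\sum_(v | v != hub) P v)%N.
  rewrite count_filter -sum1_count big_enum_cond/= [LHS]big_mkcond [RHS]big_mkcond/=.
  by apply: eq_bigr => v _; rewrite /=; case: (P v); case: (_ == _).
have -> : count P leftover = (\sum_(v | (v != hub) && ~~ (block v != None)) P v)%N.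
  rewrite count_filter -sum1_count big_enum_cond/= [LHS]big_mkcond [RHS]big_mkcond/=.
  by apply: eq_bigr => v _; rewrite /= negbK andbC; case: (P v); case: (_ == None); case: (_ == hub).
rewrite (bigID (fun v => block v != None))/= addnC; congr (_ + _)%N.
have -> : (\sum_(v | (v != hub) && (block v != None)) P v = \sum_(v | block v != None) P v)%N.
  apply: eq_bigl => v; case: (eqVneq v hub) => [->|//].
  by rewrite (block_hub ht Bn).
case: (pickP (@predT B)) => [b0 _|none].
  rewrite (partition_big (fun v => odflt b0 (block v)) xpredT)//=; apply: eq_bigr => b _.
  by apply: eq_bigl => v; case: (block v) => [c|] //=; rewrite (inj_eq Some_inj).
rewrite [RHS]big1 => [|b]; last by have := none b.
by rewrite big1// => v; case: (block v) => [b|//]; have := none b.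
Qed.

Context (W : {set B}).
Hypothesis W3 : (3 <= #|W|)%N.
Hypothesis Wodd : odd #|W|.
Notation handle := (handle h Bn W).
Notation teeth := (@teeth n t B W).
Notation th := (th teeth).
Notation hd := (hd handle).
Notation ccost := (ccost R hd th).
Notation in_teeth := (@in_teeth n t B W).

Let coef_diff := coef_diff h0 ht Bn W3 Wodd.
Let coef_same := coef_same h0 ht Bn W3 Wodd.
Let pcost_part := pcost_part R h0 ht Bn W3 Wodd.
Let hd_block v b := @hd_block n h t B ht Bn W v b.

Lemma in_teeth_block v b : block v = Some b -> in_teeth v = (b \in W).
Proof. by rewrite /in_teeth => ->. Qed.

(** The exit is charged to the next edge, whence [in_teeth y] on the left. The low parts meet in the
    middle, so the handle is crossed there exactly when one of the two blocks is a tooth; this is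
    the extra unit. *)
Lemma pcost_pair x p : ~~ hd x -> p.1 != p.2 -> block x != Some p.1 ->
  exists y, [/\ block y = Some p.2, ~~ hd y & forall s,
    pcost ccost x (pair_path p ++ s) + (in_teeth y)%:R =
      (in_teeth x + 3 * ((p.1 \in W) + (p.2 \in W)) + ((p.1 \in W) != (p.2 \in W)))%:R
      + pcost ccost y s /\ last x (pair_path p ++ s) = last y s].
Proof.
move: p => [b b'] /= hx bb xb.
have [y1 [b1 l1] e1] := pcost_part b false x.
have [y2 [b2 l2] e2] := pcost_part b true y1.
have [y3 [b3 l3] e3] := pcost_part b' true y2.
have [y4 [b4 l4] e4] := pcost_part b' false y3.
have h1 := hd_block b1; rewrite l1 /= in h1; have h2 := hd_block b2; rewrite l2 /= in h2.
have h3 := hd_block b3; rewrite l3 /= in h3; have h4 := hd_block b4; rewrite l4 /= in h4.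
exists y4; split; [by []|by rewrite h4|move=> s].
rewrite /pair_path /= -!catA (e1 _).1 (e2 _).1 (e3 _).1 (e4 _).1 (e1 _).2 (e2 _).2 (e3 _).2 (e4 _).2.
split=> //.
rewrite (coef_diff (_ : block x != block y1)) ?b1//.
rewrite (coef_same (_ : block y1 = block y2)) ?b1 ?b2//.
rewrite (coef_diff (_ : block y2 != block y3)) ?b2 ?b3 ?(inj_eq Some_inj)//.
rewrite (coef_same (_ : block y3 = block y4)) ?b3 ?b4//.
rewrite h1 h2 h3 h4 (negbTE hx) (in_teeth_block b1) (in_teeth_block b2) (in_teeth_block b3) (in_teeth_block b4).
by case: (b \in W); case: (b' \in W); case: (in_teeth x); rewrite /=; lra.
Qed.

Definition pair_cost (p : B * B) : nat :=
  (3 * ((p.1 \in W) + (p.2 \in W)) + ((p.1 \in W) != (p.2 \in W)))%N.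

Lemma pcost_pairs x rs : ~~ hd x -> uniq (pair_list rs) ->
  (forall b, b \in pair_list rs -> block x != Some b) ->
  exists y, [/\ ~~ hd y, block y = block x \/ (exists2 b, b \in pair_list rs & block y = Some b) & forall s,
    pcost ccost x (flatten (map pair_path rs) ++ s) + (in_teeth y)%:R =
      (in_teeth x + \sum_(p <- rs) pair_cost p)%:R + pcost ccost y s /\
    last x (flatten (map pair_path rs) ++ s) = last y s].
Proof.
elim: rs x => [|p rs IH] x hx.
  move=> _ _; exists x; split=> //; first by left.
  by move=> s; rewrite big_nil addn0 addrC.
rewrite /pair_list /= -/(pair_list rs) inE negb_or => /and3P[/andP[pp p1] p2 urs] xb.
have [|y1 [b1 h1 e1]] := pcost_pair hx pp; first by apply: xb; rewrite mem_head.
have [|y [hy yb e]] := IH y1 h1 urs.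
  by move=> b bin; rewrite b1 (inj_eq Some_inj); apply: contraNneq p2 => ->.
exists y; split=> //.
  case: yb => [yb|[b bin yb]].
    by right; exists p.2; rewrite ?yb// !inE eqxx orbT.
  by right; exists b; rewrite ?yb// !inE bin !orbT.
move=> s; have [e1a e1b] := e1 (flatten (map pair_path rs) ++ s); have [ea eb] := e s.
rewrite -catA e1b eb; split=> //; rewrite big_cons.
have -> : pcost ccost x (pair_path p ++ flatten (map pair_path rs) ++ s) =
  (in_teeth x + pair_cost p)%:R + pcost ccost y1 (flatten (map pair_path rs) ++ s) - (in_teeth y1)%:R.
  by rewrite /pair_cost addnA -e1a addrK.
have -> : pcost ccost y1 (flatten (map pair_path rs) ++ s) =
  (in_teeth y1 + \sum_(p0 <- rs) pair_cost p0)%:R + pcost ccost y s - (in_teeth y)%:R.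
  by rewrite -ea addrK.
by rewrite !natrD; lra.
Qed.

Lemma pcost_leftover x : ~~ hd x -> block x != None ->
  exists y, [/\ ~~ hd y, block y = block x \/ block y = None & forall s,
    pcost ccost x (leftover ++ s) + (in_teeth y)%:R = (in_teeth x)%:R + pcost ccost y s /\
    last x (leftover ++ s) = last y s].
Proof.
move=> hx xb.
have : all (fun u => (block u == None) && (u != hub)) leftover by exact: filter_all.
case: leftover => [_|y r].
  by exists x; split=> //; [left|move=> s; rewrite addrC].
have hN u : (block u == None) && (u != hub) -> hd u = false /\ in_teeth u = false.
  move=> /andP[/eqP ub /negbTE uc]; have iu : in_teeth u = false by rewrite /in_teeth ub.
  by rewrite /hd inE iu andbF uc.
have hom z s : all (fun u => (block u == None) && (u != hub)) (z :: s) -> pcost ccost z s = 0.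
  elim: s z => [//|u s IH] z /= /and3P[zN uN us].
  rewrite IH /= ?uN// addr0 /ccost coef_same ?(hN z zN).1 ?(hN u uN).1//.
  by case/andP: zN => /eqP -> _; case/andP: uN => /eqP -> _.
move=> ys; have lN : (block (last y r) == None) && (last y r != hub).
  by apply: (allP ys); exact: mem_last.
have yN : (block y == None) && (y != hub) by apply: (allP ys); exact: mem_head.
exists (last y r); split.
- by rewrite (hN _ lN).1.
- by right; case/andP: lN => /eqP.
move=> s; rewrite cat_cons /= pcost_cat hom// add0r last_cat; split=> //.
rewrite /ccost coef_diff; last by case/andP: yN => /eqP ->.
by rewrite (hN _ lN).2 (hN _ yN).1 (hN _ yN).2 (negbTE hx) /= addn0; lra.
Qed.

Context (b0 b1 : B) (rs : seq (B * B)).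
Hypothesis prs : perm_eq (b0 :: b1 :: pair_list rs) (enum B).
Hypothesis b0W : b0 \in W.
Hypothesis b1W : b1 \in W.

(** The hub is joined to the low parts of [b1] and [b0], hence within the handle; these two teeth
    cost 3 each. *)
Definition paired_tour : seq 'I_n :=
  part b1 true ++ part b1 false ++ flatten (map pair_path rs) ++ leftover ++
  part b0 false ++ part b0 true.

Lemma perm_paired_tour : perm_eq paired_tour (offz hub).
Proof.
apply/seq.permP => P; rewrite count_offhub /paired_tour !count_cat count_pair_paths.
have -> : (\sum_b \sum_(v | block v == Some b) P v = \sum_(b <- enum B) \sum_(v | block v == Some b) P v)%N.
  by rewrite big_enum.
rewrite -(perm_big _ prs)/= !big_cons -!count_part; ring.
Qed.

Lemma cost_paired_tour :
  cycost ccost hub paired_tour = (6 + \sum_(p <- rs) pair_cost p)%:R.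
Proof.
have up : uniq (b0 :: b1 :: pair_list rs) by rewrite (perm_uniq prs) enum_uniq.
move: up; rewrite /= inE negb_or => /and3P[/andP[b01 b0r] b1r ur].
have [y1 [c1 l1] e1] := pcost_part b1 true hub.
have [y2 [c2 l2] e2] := pcost_part b1 false y1.
have h1 := hd_block c1; rewrite l1 b1W /= in h1; have h2 := hd_block c2; rewrite l2 /= in h2.
have [|//||y3 [h3 c3 e3]] := @pcost_pairs y2 rs; first by rewrite h2.
  by move=> b br; rewrite c2 (inj_eq Some_inj); apply: contraNneq b1r => ->.
have [//||y4 [h4 c4 e4]] := @pcost_leftover y3.
  by case: c3 => [->|[b _ ->]]; rewrite ?c2.
have y4b : block y4 != Some b0.
  case: c4 => [->|->] //; case: c3 => [->|[b br ->]].
    by rewrite c2 (inj_eq Some_inj) eq_sym.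
  by rewrite (inj_eq Some_inj); apply: contraNneq b0r => <-.
have [y5 [c5 l5] e5] := pcost_part b0 false y4.
have [y6 [c6 l6] e6] := pcost_part b0 true y5.
have h5 := hd_block c5; rewrite l5 /= in h5; have h6 := hd_block c6; rewrite l6 b0W /= in h6.
rewrite /cycost /paired_tour -cats1 -!catA (e1 _).1 (e2 _).1.
have -> : forall s, pcost ccost y2 (flatten (map pair_path rs) ++ s) =
   (in_teeth y2 + \sum_(p <- rs) pair_cost p)%:R + pcost ccost y3 s - (in_teeth y3)%:R.
  by move=> s; rewrite -(e3 s).1 addrK.
have -> : forall s, pcost ccost y3 (leftover ++ s) =
   (in_teeth y3)%:R + pcost ccost y4 s - (in_teeth y4)%:R.
  by move=> s; rewrite -(e4 s).1 addrK.
rewrite (e5 _).1 (e6 _).1 /= /ccost.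
have hc : hd hub by rewrite /hd inE eqxx orbT.
have ic : in_teeth hub = false by rewrite /in_teeth (block_hub ht Bn).
rewrite (coef_diff (_ : block hub != block y1)) ?c1 ?(block_hub ht Bn)//.
rewrite (coef_same (_ : block y1 = block y2)) ?c1 ?c2//.
rewrite (coef_diff (_ : block y4 != block y5)) ?c5//.
rewrite (coef_same (_ : block y5 = block y6)) ?c5 ?c6//.
rewrite (coef_diff (_ : block y6 != block hub)) ?c6 ?(block_hub ht Bn)//.
rewrite hc ic h1 h2 (negbTE h4) h5 h6 (in_teeth_block c1) (in_teeth_block c2) (in_teeth_block c5) (in_teeth_block c6).
by rewrite b0W b1W /= !natrD; lra.
Qed.

End PairedTour.

(** * Combs of odd cuts and tours of perfect matchings *)

Section MatchingTours.
Context (V : finType).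
Notation B := (V + bool)%type.

Definition match_reps (M : {ffun V -> V}) : seq V :=
  [seq u <- enum V | (enum_rank u < enum_rank (M u))%N].
Definition match_pairs (M : {ffun V -> V}) : seq (B * B) :=
  [seq (inl u, inl (M u)) | u <- match_reps M].
Definition ext_cut (U : {set V}) : {set B} :=
  [set b : B | if b is inl u then u \in U else true]%SET.

Lemma sum_match_reps M (F : V -> nat) : involution_without_fixpoint M ->
  (\sum_(u <- match_reps M) (F u + F (M u)) = \sum_u F u)%N.
Proof.
move=> /forallP fpf; have MK : involutive M by move=> u; have /andP[/eqP] := fpf u.
rewrite big_filter big_enum_cond/= big_split/= [RHS](bigID (fun u => enum_rank u < enum_rank (M u))%N)/=.
congr (_ + _)%N; rewrite [RHS](reindex_inj (inv_inj MK))/=.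
apply: eq_bigl => u; rewrite MK -leqNgt [in RHS]leq_eqVlt.
have /andP[_ Mu] := fpf u; case: eqP => //= e; have uM := enum_rank_inj (ord_inj e).
by rewrite -uM eqxx in Mu.
Qed.

Lemma sum_plus_bool (F : B -> nat) : (\sum_b F b = F (inr false) + F (inr true) + \sum_u F (inl u))%N.
Proof. by rewrite big_sumType/= big_bool /= addnC [(F (inr true) + _)%N]addnC. Qed.

Lemma perm_match_pairs M : involution_without_fixpoint M ->
  perm_eq (inr false :: inr true :: pair_list (match_pairs M)) (enum {: B}).
Proof.
move=> fpf; apply/seq.permP => P /=.
have -> : count P (enum {: B}) = (\sum_b P b)%N.
  rewrite -sum1_count big_enum_cond/= [LHS]big_mkcond/=.
  by apply: eq_bigr => b _; rewrite /=; case: (P b).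
rewrite sum_plus_bool -(sum_match_reps _ fpf) addnA; congr (_ + _)%N.
rewrite /match_pairs /pair_list -map_comp.
elim: (match_reps M) => [|u s IH] /=; first by rewrite big_nil.
by rewrite big_cons IH addnA.
Qed.

Lemma card_ext_cut U : #|ext_cut U| = #|U|.+2.
Proof.
rewrite -sum1_card big_mkcond/= sum_plus_bool !inE /= -sum1_card [in RHS]big_mkcond/=.
by congr (_ + _)%N; apply: eq_bigr => u _; rewrite inE.
Qed.

Lemma sum_pair_cost M U : involution_without_fixpoint M ->
  (\sum_(p <- match_pairs M) pair_cost (ext_cut U) p = 3 * #|U| + cross U M)%N.
Proof.
move=> fpf; have MK : involutive M by move=> u; move/forallP: fpf => /(_ u)/andP[/eqP].
rewrite /match_pairs big_map.
pose F u := (3 * (u \in U) + ((u \in U) && (M u \notin U)))%N.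
rewrite (eq_bigr (fun u => F u + F (M u))%N); last first.
  move=> u _; rewrite /pair_cost /F !inE /= MK.
  by case: (u \in U); case: (M u \in U).
rewrite (sum_match_reps _ fpf) /F big_split/= -big_distrr/=; congr (3 * _ + _)%N.
  by rewrite -sum1_card [RHS]big_mkcond/=; apply: eq_bigr => u _; case: (u \in U).
rewrite /cross -sum1_card [RHS]big_mkcond/=; apply: eq_bigr => u _; rewrite inE.
by case: (_ && _).
Qed.

Context (R : realType) (n h t : nat).
Hypothesis h0 : (1 <= h)%N.
Hypothesis ht : (h < t)%N.
Hypothesis Bn : (#|{: B}| * t < n)%N.
Hypothesis n3 : (3 <= n)%N.

Definition cut_comb (U : {set V}) : ineq R (edge n) :=
  comb_ineq R (handle h Bn (ext_cut U)) (@teeth n t _ (ext_cut U)).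
Definition match_tour (M : {ffun V -> V}) : vec R (edge n) :=
  char_vec R (tour_edges (hub Bn :: @paired_tour n h t _ Bn (inr false) (inr true) (match_pairs M))).

Lemma ext_cut_odd (U : {set V}) : odd #|U| -> (3 <= #|ext_cut U|)%N /\ odd #|ext_cut U|.
Proof. by move=> oU; rewrite card_ext_cut /= negbK; split => //; case: #|U| oU. Qed.

(** The tour costs 6 + 3 |U| + cross, against a right-hand side of 3 (|U| + 2) + 1. *)
Lemma slack_cut_match (U : {set V}) M : odd #|U| -> involution_without_fixpoint M ->
  slack (cut_comb U) (match_tour M) = (cross U M)%:R - 1.
Proof.
move=> /ext_cut_odd[W3 Wodd] fpf.
have pt := perm_paired_tour ht Bn (perm_match_pairs fpf).
rewrite /slack (dot_comb R (blocks_comb h0 ht Bn W3 Wodd) n3 pt).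
rewrite (cost_paired_tour R h0 ht Bn W3 Wodd (perm_match_pairs fpf)) ?inE//.
by rewrite sum_pair_cost//= card_ext_cut !natrD; lra.
Qed.

Lemma cut_comb_uniform (U : {set V}) : odd #|U| -> uniform_comb_ineqs R n h t (cut_comb U).
Proof.
move=> /ext_cut_odd[W3 Wodd]; exists #|ext_cut U|, (handle h Bn (ext_cut U)), (@teeth n t _ (ext_cut U)).
by split=> //; [exact: blocks_comb|exact: blocks_uniform].
Qed.

Lemma cut_comb_facet (U : {set V}) : odd #|U| -> ~~ odd #|V| -> facet_defining (TSP R n) (cut_comb U).
Proof.
move=> oU eV; have [W3 Wodd] := ext_cut_odd oU; apply: blocks_facet => //.
(* An odd [U] is not all of an even [V], which leaves a block outside the comb. *)
have [u uU] : exists u, u \notin U.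
  apply/existsP; apply: contraNT eV => /existsPn h1.
  rewrite -cardsT (_ : [set: V]%SET = U)//; apply/setP => u; rewrite inE.
  by have := h1 u; rewrite negbK => ->.
by exists (inl u); rewrite inE.
Qed.

Lemma match_tour_TSP M : involution_without_fixpoint M -> TSP R n (match_tour M).
Proof.
move=> fpf; apply: conv_hull_sub; exists (tour_edges (hub Bn :: @paired_tour n h t _ Bn (inr false) (inr true) (match_pairs M))) => //.
exact: (hamiltonian_tour (perm_paired_tour ht Bn (perm_match_pairs fpf)) n3).
Qed.

End MatchingTours.

Lemma char_vecE (R : realType) (n : nat) (C : {set edge n}) e : char_vec R C e = (e \in C)%:R.
Proof. by rewrite ffunE. Qed.

(** The edge between [z] and [a] is in the first tour only: in the second, [z] is followed by [b]
    and [a] by [c]. *)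
Lemma tours_swap_neq (R : realType) (n : nat) (z a b c : 'I_n) rest s s' : (3 <= n)%N ->
  s = [:: a, b, c & rest] -> s' = [:: b, a, c & rest] ->
  perm_eq s (offz z) ->
  char_vec R (tour_edges (z :: s)) <> char_vec R (tour_edges (z :: s')).
Proof.
move=> n3 sE s'E ps xy; have us := tour_uniq ps.
move: (us); rewrite sE /= !inE !negb_or => /and5P[/and4P[za zb zc _] /and3P[ab ac _] _ _ _].
have zE : next (z :: s) z = a by rewrite sE /= eqxx.
have nz : next (z :: s') z = b by rewrite s'E /= eqxx.
have na : next (z :: s') a = c by rewrite s'E /= eq_sym (negbTE za) (negbTE ab) eqxx.
have e1 : edge_of ps n3 z \in tour_edges (z :: s) by rewrite tour_edgesE; exact: imset_f.
have := char_vecE R (tour_edges (z :: s)) (edge_of ps n3 z).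
rewrite xy (char_vecE R (tour_edges (z :: s'))) e1.
case: (boolP (_ \in tour_edges (z :: s'))) => [|_ /eqP]; last by rewrite eq_sym oner_eq0.
rewrite inE => /existsP[v /eqP vE _].
have {}vE x : (x == z) || (x == a) = (x == v) || (x == next (z :: s') v).
  by have /setP/(_ x) := vE; rewrite !in_set2 zE.
have := vE z; rewrite eqxx => /esym/orP[/eqP zv|/eqP zv].
  by have := vE a; rewrite eqxx orbT -zv nz eq_sym (negbTE za) (negbTE ab).
have := vE a; rewrite eqxx orbT -zv [a == z]eq_sym (negbTE za) orbF => /esym/eqP av.
by move: zc; rewrite zv -av na eqxx.
Qed.

Lemma two_tours (R : realType) (n : nat) : (4 <= n)%N ->
  exists x y, [/\ TSP R n x, TSP R n y & x <> y].
Proof.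
move=> n4; have n3 : (3 <= n)%N by exact: ltnW.
have [z _] : exists z : 'I_n, True by exists (Ordinal (leq_trans (isT : (0 < 4)%N) n4)).
have so : size (offz z) = n.-1.
  by have := perm_size (perm_tour (perm_refl (offz z))); rewrite size_enum_ord => /(congr1 predn).
case E : (offz z) so => [|a [|b [|c rest]]] so; rewrite /= in so;
  [lia|lia|lia|].
have ps : perm_eq [:: a, b, c & rest] (offz z) by rewrite E.
have ps' : perm_eq [:: b, a, c & rest] (offz z).
  by rewrite E; apply/seq.permP => P /=; ring.
exists (char_vec R (tour_edges (z :: [:: a, b, c & rest]))).
exists (char_vec R (tour_edges (z :: [:: b, a, c & rest]))).
split; [apply: conv_hull_sub|apply: conv_hull_sub|exact: (tours_swap_neq n3 erefl erefl ps)].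
- by eexists; first exact: (hamiltonian_tour ps n3).
- by eexists; first exact: (hamiltonian_tour ps' n3).
Qed.

Lemma card_tvertex q : #|{: tvertex q}| = (12 * q + 14)%N.
Proof. by rewrite !card_sum !card_prod card_bool !card_ord; lia. Qed.

Local Open Scope classical_set_scope.
Local Open Scope ring_scope.

(** * The bound for a given extension *)

Section Extension.
Context (R : realType) (n h t : nat).
Hypothesis h0 : (1 <= h)%N.
Hypothesis ht : (h < t)%N.
Hypothesis n4 : (4 <= n)%N.
Context (H : set (ineq R (edge n))).
Hypothesis Hfree : ineq_closure (TSP R n) H `&` uniform_comb_ineqs R n h t = set0.
Context (m r : nat) (Q : set (vec R 'I_m)).
Hypothesis extQ : extension (remove_ineqs (TSP R n) H) Q.
Hypothesis Qr : (facets Q #= `I_r)%card.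

Lemma TSP_remove : TSP R n `<=` remove_ineqs (TSP R n) H.
Proof. by move=> x Px c [cP _] _; exact: cP. Qed.

Lemma extension_ge2 : (2 <= r)%N.
Proof.
have [x [y [/TSP_remove Px /TSP_remove Py xy]]] := two_tours R n4.
by have [] := extension_factorization extQ Qr Px Py xy.
Qed.

(** The template has 12 q + 14 vertices; with the two extra blocks, 12 q + 16 blocks of size [t] and
    the hub must fit. *)
Lemma extension_decay q : ((12 * q + 16) * t < n)%N ->
  1 <= 16 * (12 * q + 14)%:R * expR (- (q.+1%:R / 6 / 100 / 200)) * r%:R :> R.
Proof.
move=> qn; have n3 : (3 <= n)%N by exact: ltnW.
have Bn : (#|{: tvertex q + bool}| * t < n)%N.
  by rewrite card_sum card_tvertex card_bool -addnA.
have eV : ~~ odd #|{: tvertex q}| by rewrite card_tvertex oddD oddM.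
have [x [y [/TSP_remove Px /TSP_remove Py xy]]] := two_tours R n4.
have [_ fac] := extension_factorization extQ Qr Px Py xy.
pose cuts := {U : {set tvertex q} | odd #|U|}.
pose matchings := {M : {ffun tvertex q -> tvertex q} | involution_without_fixpoint M}.
have [||a [b [a0 b0 ab]]] := fac cuts matchings (fun U => cut_comb R h Bn (val U))
  (fun M => match_tour R h Bn (val M)).
- move=> [U oU] x' Px'; apply: Px'; first exact: cut_comb_facet.
  move=> cl; have : (ineq_closure (TSP R n) H `&` uniform_comb_ineqs R n h t) (cut_comb R h Bn U).
    by split=> //; exact: cut_comb_uniform.
  by rewrite Hfree.
- by move=> [M fM]; apply: TSP_remove; exact: match_tour_TSP.
pose a' k (U : {set tvertex q}) := if @insub _ _ cuts U is Some u then a k u else 0.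
pose b' k (M : {ffun tvertex q -> tvertex q}) := if @insub _ _ matchings M is Some u then b k u else 0.
rewrite -card_tvertex; apply: (@matching_rank_bound R q r a' b').
- by move=> k U; rewrite /a'; case: insub.
- by move=> k M; rewrite /b'; case: insub.
move=> U M oU fM; rewrite -(slack_cut_match R h0 ht Bn n3 oU fM).
have := ab (Sub U oU) (Sub M fM); rewrite !SubK => ->.
by apply: eq_bigr => k _; rewrite /a' /b' !insubT.
Qed.

End Extension.

(** With e half the decay rate and E = exp(e x), one factor of E^2 absorbs the linear factor,
    leaving E <= K r. As r >= 2, K is at most r^j, and a root of order j + 1 removes it at the price
    of a smaller exponent. *)
Lemma decay_bound (R : realType) : exists2 c : R, 0 < c & forall (q r : nat), (2 <= r)%N ->
  1 <= 16 * (12 * q + 14)%:R * expR (- (q.+1%:R / 6 / 100 / 200)) * r%:R :> R ->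
  expR (c * q.+1%:R) <= r%:R.
Proof.
pose e : R := 6^-1 / 100 / 200 / 2; have e0 : 0 < e by rewrite /e !divr_gt0// invr_gt0.
pose K : R := 224 / e; have K0 : 0 < K by rewrite divr_gt0.
pose j := Num.Def.archi_bound K.
have Kj : K <= 2 ^+ j.
  apply: (@le_trans _ _ j%:R); first by apply/ltW/archi_boundP/ltW.
  by rewrite -natrX ler_nat ltnW// ltn_expl.
exists (e / j.+1%:R); first by rewrite divr_gt0.
move=> q r r2; set x := q.+1%:R => h1.
have x1 : 1 <= x by rewrite ler1n.
have q14 : (12 * q + 14)%:R <= 14 * x.
  by rewrite /x -natrM ler_nat; lia.
set E := expR (e * x).
have E0 : 0 < E by exact: expR_gt0.
have xE : e * x <= E by apply: le_trans (expR_ge1Dx _); rewrite lerDr.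
have dE : expR (- (x / 6 / 100 / 200)) = (E * E)^-1.
  by rewrite -expRD -expRN; congr (expR (- _)); rewrite /e; field.
have r0 : 0 <= r%:R :> R by [].
have EK : E <= K * r%:R.
  rewrite dE in h1.
  have h2 : E * E <= 16 * (14 * x) * r%:R.
    have : 1 <= 16 * (14 * x) * (E * E)^-1 * r%:R.
      have v0 : 0 <= (E * E)^-1 by rewrite invr_ge0 mulr_ge0 ?ltW.
      by apply: (le_trans h1); rewrite ler_wpM2r// ler_wpM2r// ler_wpM2l.
    by rewrite [leRHS]mulrAC ler_pdivlMr ?mulr_gt0// mul1r.
  rewrite -(ler_pM2l E0); apply: (le_trans h2).
  have -> : E * (K * r%:R) = K * E * r%:R by ring.
  rewrite ler_wpM2r//; have -> : 16 * (14 * x) = K * (e * x) by rewrite /K; field; rewrite gt_eqF.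
  by rewrite ler_pM2l.
have Er : E <= r%:R ^+ j.+1.
  apply: (le_trans EK); rewrite exprSr ler_wpM2r//; apply: (le_trans Kj).
  by rewrite lerXn2r ?nnegrE// ler_nat.
rewrite -(@ler_pXn2r _ j.+1)// ?nnegrE ?expR_ge0// -expRM_natl.
by have -> : j.+1%:R * (e / j.+1%:R * x) = e * x by rewrite mulrA [_ * (e / _)]mulrC divfK// pnatr_eq0.
Qed.

Theorem theorem2 (R : realType) :
  exists2 c : R, 0 < c &
    forall n h t : nat,
      (1 <= h)%N -> (h < t)%N -> (t <= (n - 1) %/ 3)%N ->
      uniform_comb_ineqs R n h t !=set0 /\
      forall H : set (ineq R (edge n)),
        H `<=` valid (TSP R n) ->
        ineq_closure (TSP R n) H `&` uniform_comb_ineqs R n h t = set0 ->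
        ((2 `^ (c * (n%:R / t%:R)))%:E
           <= free_ext_complexity (TSP R n) H)%E.
Proof.
have [c0 c00 c0P] := decay_bound R.
(* The first term serves n <= 16 t, where the bound claimed is at most 2; the second serves the
   other case, where n <= 28 (q + 1) t. *)
pose c : R := Num.min (1 / 16) (c0 / 28).
have c_gt0 : 0 < c by rewrite lt_min !divr_gt0.
exists c => // n h t h0 ht tn; have t0 : (0 < t)%N by exact: leq_trans ht.
have n4 : (4 <= n)%N.
  by move: tn; rewrite leq_divRL//; lia.
have tR : 0 < t%:R :> R by rewrite ltr0n.
split.
  have Bn : (#|'I_3| * t < n)%N by rewrite card_ord; move: tn; rewrite leq_divRL//; lia.
  pose W : {set 'I_3} := [set: 'I_3]%SET.
  have W3 : #|W| = 3%N by rewrite cardsT card_ord.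
  exists (comb_ineq R (handle h Bn W) (@teeth n t _ W)), #|W|, (handle h Bn W), (@teeth n t _ W).
  by split; [apply: blocks_comb; rewrite ?W3|exact: blocks_uniform|].
move=> H _ Hfree; apply: le_ereal_inf_tmp => _ [r [m [Q [extQ Qr]]] <-]; rewrite lee_fin.
have r2 := extension_ge2 n4 extQ Qr.
have r2R : 2 <= r%:R :> R by rewrite ler_nat.
have small (y : R) : n%:R <= y * t%:R -> c * (n%:R / t%:R) <= c * y.
  by move=> ny; rewrite ler_pM2l// ler_pdivrMr.
(* With fewer than 16 blocks not even the template for q = 0 fits, and [r2] is enough. *)
have [f16|f16] := ltnP ((n - 1) %/ t) 16.
  apply: le_trans r2R; rewrite -[leRHS]powRr1// ler_powR ?ler1n//.
  apply: (@le_trans _ _ (c * 16)); last by rewrite /c -ler_pdivlMr// ge_min lexx.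
  apply: small; rewrite -natrM ler_nat; move: f16; rewrite ltn_divLR//; lia.
(* The largest q whose 12 q + 16 blocks fit; the vertex taken off [n] is the hub. *)
pose q := (((n - 1) %/ t - 16) %/ 12)%N.
have q1 : (12 * q + 16 <= (n - 1) %/ t)%N.
  by have := leq_trunc_div ((n - 1) %/ t - 16) 12; rewrite -/q; lia.
have q2 : ((n - 1) %/ t < 12 * q + 28)%N.
  by have := ltn_ceil ((n - 1) %/ t - 16) (isT : (0 < 12)%N); rewrite -/q; lia.
have qn : ((12 * q + 16) * t < n)%N.
  by move: q1; rewrite leq_divRL//; lia.
have nq : n%:R <= (28 * q.+1%:R) * t%:R :> R.
  rewrite -!natrM ler_nat; move: q2; rewrite ltn_divLR// => q2.
  apply: (@leq_trans ((12 * q + 28) * t)); first by lia.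
  by rewrite leq_mul2r; apply/orP; right; lia.
apply: le_trans (c0P q r r2 (extension_decay h0 ht n4 Hfree extQ Qr qn)).
apply: (@le_trans _ _ (2 `^ (c0 * q.+1%:R))).
  rewrite ler_powR ?ler1n//; apply: (le_trans (small _ nq)).
  by rewrite mulrA ler_wpM2r// -ler_pdivlMr// ge_min lexx orbT.
have ln2 : ln 2 <= 1 :> R by rewrite -[X in ln X]/(1 + 1) le_ln1Dx// ltr0_norm.
rewrite /powR gt_eqF// ler_expR -[leRHS]mulr1 ler_wpM2l//.
by rewrite mulr_ge0// ltW.
Qed.
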